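(* Let $\mathbf{G}=(J,\mu,E)$ be a graphing. (a) $\alpha\in\mathsf{mm}_+(\rho_{\mathbf{G}})$ is an exposed point of $\mathsf{mm}_+(\rho_{\mathbf{G}})$ if and only if $\alpha=\eta_{\mathbf{G}}|_F$ (i.e. $\alpha(A)=\eta_{\mathbf{G}}(A\cap F)$ for all Borel $A\subseteq E$) for a Borel set $F\subseteq E$ such that $(J,\mu,F)$ is a hyperfinite forest. (b) $\alpha\in\mathsf{bmm}_+(\rho_{\mathbf{G}})$ is an exposed point of $\mathsf{bmm}_+(\rho_{\mathbf{G}})$ if and only if $\alpha=\eta_{\mathbf{G}}|_F$ for a Borel set $F\subseteq E$ which is a hyperfinite essential spanning forest of $\mathbf{G}$.
   Context: A graphing $\mathbf{G}=(J,\mu,E)$: $(J,\mu)$ a standard Borel probability space, $E\subseteq\binom{J}{2}$ Borel with bounded degrees, satisfying $\int_A\deg(B,x)\,d\mu(x)=\int_B\deg(A,x)\,d\mu(x)$ for all measurable $A,B\subseteq J$ ($\deg(S,x)$ = number of edges from $x$ to $S$). Edge measure: $\eta_{\mathbf{G}}(F)=\frac12\int_J\deg_F(x)\,d\mu(x)$ for Borel $F\subseteq E$. Rank: $\rho_{\mathbf{G}}(F)=1-\int_J\frac{1}{|V(\mathbf{G}^F_x)|}\,d\mu(x)$, where $\mathbf{G}^F_x$ is the component of $x$ in $(J,\mu,F)$ and $1/\infty=0$. A graphing $(J,\mu,F)$ is hyperfinite if for every $\varepsilon>0$ there is Borel $S\subseteq F$ with $\eta_{\mathbf{G}}(S)\le\varepsilon$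 such that every component of $(J,\mu,F\setminus S)$ is finite. A forest is an acyclic edge set; an essential spanning forest of $\mathbf{G}$ is a forest $F\subseteq E$ forming a spanning tree in every finite component of $\mathbf{G}$ and having only infinite components inside infinite components of $\mathbf{G}$. All such notions are understood up to $\eta_{\mathbf{G}}$-null sets of edges. $\mathsf{mm}_+(\rho_{\mathbf{G}})$ is the set of measures $\alpha$ on $E$ with $0\le\alpha(A)\le\rho_{\mathbf{G}}(A)$ for all Borel $A$; $\mathsf{bmm}_+(\rho_{\mathbf{G}})=\{\alpha\in\mathsf{mm}_+(\rho_{\mathbf{G}}):\alpha(E)=\rho_{\mathbf{G}}(E)\}$. These measures are absolutely continuous w.r.t. $\eta_{\mathbf{G}}$ and are identified with their Radon–Nikodym derivatives in $L^1(E,\eta_{\mathbf{G}})$, equipped with the weak topology. A point $v$ of a convex set $C$ is exposed if there is a continuous linear functional $\Lambda$ with $\Lambda(y)<\Lambda(v)$ for all $y\in C\setminus\{v\}$. *)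

(* Defs.v *)
From HB Require Import structures.
From mathcomp Require Import all_boot all_order all_algebra.
From mathcomp Require Import all_classical all_reals all_analysis.
From Stdlib Require Import Relations.

Set Implicit Arguments.
Unset Strict Implicit.
Unset Printing Implicit Defensive.

Import Order.TTheory GRing.Theory Num.Theory.
Local Open Scope classical_set_scope.
Local Open Scope ring_scope.

Definition standard_borel (d : measure_display) (J : measurableType d)
    (R : realType) : Prop :=
  exists f : J -> R, measurable_fun setT f /\ injective f /\
    (forall A : set J, measurable A -> measurable (f @` A)).

Section Graphing.
Context (R : realType) (d : measure_display) (J : measurableType d).
Context (mu : probability J R).
Local Open Scope ereal_scope.

(* Edge sets are sets of unordered pairs, represented as symmetric sets of
   ordered pairs. *)
Definition sym_set (F : set (J * J)) : Prop :=
  forall x y, F (x, y) -> F (y, x).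

Definition sym_fun (f : J * J -> R) : Prop :=
  forall x y, f (x, y) = f (y, x).

Definition deg (F : set (J * J)) (x : J) : \bar R :=
  @counting J R [set y | F (x, y)].

Definition graphing (E : set (J * J)) : Prop :=
  [/\ measurable E, sym_set E, (forall x, ~ E (x, x)),
      (exists D : nat, forall x, deg E x <= D%:R%:E) &
      (forall A B : set J, measurable A -> measurable B ->
         \int[mu]_(x in A) deg (E `&` [set z | B z.2]) x =
         \int[mu]_(x in B) deg (E `&` [set z | A z.2]) x)].

Definition is_edge_measure (E : set (J * J))
    (eta : {measure set (J * J)%type -> \bar R}) : Prop :=
  forall F : set (J * J), measurable F ->
    eta F = (2%:R^-1)%:E * \int[mu]_x deg (F `&` E) x.

Definition comp (F : set (J * J)) (x : J) : set J :=
  [set y | clos_refl_trans J (fun a b => F (a, b)) x y].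

(* 1 / |S| with 1/oo = 0 *)
Definition inv_card (S : set J) : \bar R :=
  match @counting J R S with
  | r%:E => (r^-1)%:E
  | _ => 0
  end.

Definition rank (F : set (J * J)) : \bar R :=
  1 - \int[mu]_x inv_card (comp F x).

Context (eta : {measure set (J * J)%type -> \bar R}).

Definition hyperfinite (F : set (J * J)) : Prop :=
  forall eps : R, (0 < eps)%R ->
    exists S : set (J * J), [/\ measurable S, S `<=` F, sym_set S,
      eta S <= eps%:E &
      forall x, finite_set (comp (F `\` S) x)].

Definition edge_rel (F : set (J * J)) : rel J := fun a b => `[< F (a, b) >].

Definition acyclic (F : set (J * J)) : Prop :=
  ~ exists (x : J) (s : seq J),
      [/\ (2 <= size s)%N, uniq (x :: s), path (edge_rel F) x s &
          edge_rel F (last x s) x].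

Definition forest (F : set (J * J)) : Prop :=
  exists N : set (J * J),
    [/\ measurable N, sym_set N, eta N = 0 & acyclic (F `\` N)].

Definition ess_spanning_forest (E F : set (J * J)) : Prop :=
  [/\ measurable F, F `<=` E, sym_set F, forest F &
      {ae mu, forall x,
         (finite_set (comp E x) -> comp F x = comp E x) /\
         (infinite_set (comp E x) -> infinite_set (comp F x))}].

Definition L1_functional (L : (J * J -> R) -> R) : Prop :=
  (forall (a : R) (f g : J * J -> R),
      eta.-integrable setT (EFin \o f) -> eta.-integrable setT (EFin \o g) ->
      L (fun z => (a * f z + g z)%R) = (a * L f + L g)%R) /\
  exists C : R, forall f : J * J -> R,
      eta.-integrable setT (EFin \o f) ->
      (`|L f|)%:E <= C%:E * \int[eta]_z (`|f z|)%:E.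

(* exposed point of a set C of (densities of) measures *)
Definition exposed (C : (J * J -> R) -> Prop) (f : J * J -> R) : Prop :=
  C f /\ exists L, L1_functional L /\
    forall g, C g -> ~ {ae eta, forall z, g z = f z} -> (L g < L f)%R.

(* mm_+(rho_G): alpha given by its Radon-Nikodym density f w.r.t. eta;
   alpha(A) = int_A f deta for Borel A (sets of edges) *)
Definition mm_plus (E : set (J * J)) (f : J * J -> R) : Prop :=
  [/\ measurable_fun setT f, sym_fun f, eta.-integrable setT (EFin \o f) &
      forall A : set (J * J), measurable A -> A `<=` E -> sym_set A ->
        0 <= \int[eta]_(z in A) (f z)%:E /\
        \int[eta]_(z in A) (f z)%:E <= rank A].

Definition bmm_plus (E : set (J * J)) (f : J * J -> R) : Prop :=
  mm_plus E f /\ \int[eta]_(z in E) (f z)%:E = rank E.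

Definition is_restriction (E F : set (J * J)) (f : J * J -> R) : Prop :=
  forall A : set (J * J), measurable A -> A `<=` E -> sym_set A ->
    \int[eta]_(z in A) (f z)%:E = eta (A `&` F).

End Graphing.

(* Main.v *)
(** Vertices carry injective real labels [f], and up to a null set the graphing
    is generated by countably many measure-preserving involutions: the measurable
    projection theorem gives measurable neighbour functions.  This yields the mass
    transport principle, from which [rank A = 1 - mu (roots A)], where [roots A]
    consists of the least-labelled vertices of the finite components of [A].

    Every subgraph [H] contains subgraphs with finite components and rank
    arbitrarily close to that of [H].  Hence [rank <= eta], so the elements of the
    polytope have densities in [0, 1]; and a subgraph with [eta <= rank] is
    hyperfinite.  Therefore the indicator of [F], once in the polytope, is exposed
    by the functional with weight +1 on [F] and -1 off [F].

    Conversely, an exposing functional is integration against a bounded symmetric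
    weight [w].  Let [F] consist of the edges [e] whose ends lie in different
    components of the edges heavier than [e], one of these components being finite
    (the wired maximal spanning forest, with ties broken by labels).  Then [F] is
    acyclic, [F] restricted to a superlevel set [U] of [w] has at least the rank
    of [U], and charging every edge to the root that disappears when the edge is
    inserted gives [eta F <= rank].  So [F] is hyperfinite, its indicator lies in
    the polytope, and it maximises the functional by layer-cake integration;
    uniqueness of the maximiser makes it the given exposed point. *)

Require Import Defs.
From HB Require Import structures.
From mathcomp Require Import all_boot all_order all_algebra.
From mathcomp Require Import all_classical all_reals all_analysis.
From mathcomp Require Import measurable_realfun ring.
From Stdlib Require Import Relations.
(* Imported again so that [comp] denotes a component, not [ssrfun.comp]. *)
Import Defs.

Set Implicit Arguments.
Unset Strict Implicit.
Unset Printing Implicit Defensive.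

Import Order.TTheory GRing.Theory Num.Theory numFieldNormedType.Exports.
Local Open Scope classical_set_scope.
Local Open Scope ring_scope.

(** * Measurable projection *)

(** The obstacle is that components are defined by quantifying over vertices, while a Borel graph
    comes with no measurable list of neighbours. Projections are measurable only up to null sets;
    the exceptional vertices are closed up under adjacency and the edges at them deleted, so that
    all other components stay intact and the later combinatorics is exact. Quantifiers then run over
    words in the involutions, a countable set.

    The forest is wired because an edge between two infinite components removes no root and could
    not be paid for by rank. The bound by rank on every set [A], not only on superlevel sets, comes
    from hyperfiniteness: up to small measure [F] inside [A] has finite components, and such a part
    of the forest is its own maximal forest.

    In comparing [eta] with rank, one orientation of each edge is selected, and its reversal absorbs
    the factor 1/2. Elements of the polytope are tested on symmetric sets only, so weights and level
    sets are kept symmetric. In (a) the total mass is free and only edges of positive weight are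
    used; in (b) it is prescribed, so the weight may be shifted by a constant. *)

Section measurability_up_to_null_sets.
Context (R : realType) (d : measure_display) (T : measurableType d).
Context (mu : probability T R).
Local Open Scope ereal_scope.

(** [H] is an intersection of measurable covers whose measures tend to the infimum over all
    measurable covers of [X]. Deleting a measurable [N] inside [H] minus [X] leaves a cover, so [N]
    cannot have positive measure. *)
Lemma measurable_hull (X : set T) : exists H : set T,
  [/\ measurable H, X `<=` H &
      forall N : set T, measurable N -> N `<=` H `\` X -> mu N = 0].
Proof.
pose S := [set mu B | B in [set B | measurable B /\ X `<=` B]].
have S0 x : S x -> 0 <= x by move=> [B [mB _] <-].
have S1 : S (mu setT) by exists setT => //; split.
have infS0 : 0 <= ereal_inf S by apply: le_ereal_inf_tmp => x /S0.
have infS1 : ereal_inf S <= 1.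
  by rewrite -(probability_setT mu); exact: ereal_inf_lbound.
have finS : ereal_inf S \is a fin_num.
  by rewrite fin_numE -ltNye -ltey (lt_le_trans _ infS0)//= (le_lt_trans infS1)// ltry.
have /choice[B HB] : forall n : nat, exists B : set T,
    [/\ measurable B, X `<=` B & mu B < ereal_inf S + (n.+1%:R^-1)%:E].
  move=> n; have [|_ [B [mB XB] <-] ltB] :=
    @lb_ereal_inf_adherent _ S n.+1%:R^-1 _ finS; first by rewrite invr_gt0.
  by exists B.
pose H := \bigcap_n B n.
have mH : measurable H by apply: bigcapT_measurable => n; have [] := HB n.
have XH : X `<=` H by move=> x Xx n _; have [_ + _] := HB n; apply.
exists H; split => // N mN NHX.
have infle : ereal_inf S <= mu (H `\` N).
  apply: ereal_inf_lbound; exists (H `\` N) => //; split; first exact: measurableD.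
  by move=> x Xx; split; [exact: XH|move=> /NHX[]].
have NH : N `<=` H by move=> x /NHX[].
have muH : mu H = mu (H `\` N) + mu N.
  rewrite -measureU//; first by rewrite setDKU.
    exact: measurableD.
  by rewrite setIC setDE setICA setICr setI0.
apply/eqP; rewrite eq_le measure_ge0 andbT; apply/lee_addgt0Pr => e e0.
rewrite add0e.
have [n ne] : exists n : nat, (n.+1%:R^-1 < e)%R.
  have [n] := @ltr_add_invr R 0 e e0.
  by rewrite add0r => ?; exists n.
have : mu H < ereal_inf S + (n.+1%:R^-1)%:E.
  have [mB _ ltB] := HB n; apply: le_lt_trans ltB.
  by apply: le_measure; rewrite ?inE// => x; exact.
rewrite muH => h.
have : ereal_inf S + mu N < ereal_inf S + (n.+1%:R^-1)%:E.
  by apply: le_lt_trans h; rewrite leeD2r.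
by rewrite lteD2lE// => /ltW /le_trans; apply; rewrite lee_fin ltW.
Qed.

Lemma negligible_bigcup_count (I : countType) (F : I -> set T) :
  (forall i, mu.-negligible (F i)) -> mu.-negligible (\bigcup_i F i).
Proof.
move=> F0; apply: (@negligibleS _ _ _ _
    (\bigcup_n (oapp F set0 (unpickle n)))); last first.
  apply: negligible_bigcup => n; case: (unpickle n) => //=.
  exact: negligible_set0.
by move=> x [i _ Fx]; exists (pickle i) => //; rewrite pickleK.
Qed.

Definition ae_measurable (X : set T) := exists P : set T,
  measurable P /\ mu.-negligible [set x | ~ (P x <-> X x)].

(** Continuity into a discrete space; the length of the relevant prefix may vary with [s]. Indexing
    Suslin schemes by whole sequences in this way, rather than by finite words, turns countable
    unions and intersections into substitutions in [s]. *)
Definition locally_constant (U : Type) (h : (nat -> nat) -> U) :=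
  forall s, exists N, forall s', (forall i, (i < N)%N -> s' i = s i) ->
    h s' = h s.

Definition suslin_op (C : nat -> (nat -> nat) -> set T) : set T :=
  [set x | exists s, forall k, C k s x].

(* Marczewski's argument: take a measurable hull of every cylinder set
   [A sigma]; since [A sigma] is the union of the [A (rcons sigma n)], a point
   of the hull of [A [::]] outside a null set can be followed down a branch. *)
Lemma suslin_op_ae_measurable (C : nat -> (nat -> nat) -> set T) :
  (forall k s, measurable (C k s)) -> (forall k, locally_constant (C k)) ->
  ae_measurable (suslin_op C).
Proof.
move=> mC lC.
pose A (sg : seq nat) := [set x | exists2 s, mkseq s (size sg) = sg &
  forall k, C k s x].
have /choice[H HH] : forall sg, exists H : set T, [/\ measurable H, A sg `<=` H &
    forall N : set T, measurable N -> N `<=` H `\` A sg -> mu N = 0].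
  by move=> sg; exact: measurable_hull.
have mH sg : measurable (H sg) by case: (HH sg).
pose ext (sg : seq nat) : nat -> nat := nth 0%N sg.
pose Z1 sg := H sg `\` \bigcup_n H (rcons sg n).
(* Where [C k] is constant on the cylinder of [sg], the hull of [A sg] exceeds [C k] by a null set
   only; on other cylinders nothing is claimed and the set is empty. *)
pose Z2 (p : seq nat * nat) := if `[< forall s, mkseq s (size p.1) = p.1 ->
   C p.2 s = C p.2 (ext p.1) >] then H p.1 `\` C p.2 (ext p.1) else set0.
have nZ1 sg : mu.-negligible (Z1 sg).
  have mZ : measurable (Z1 sg).
    by apply: measurableD => //; apply: bigcupT_measurable.
  exists (Z1 sg); split => //; have [_ _ +] := HH sg; apply => //.
  move=> x [Hx nx]; split => // -[s sE Cx]; apply: nx.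
  exists (s (size sg)) => //.
  have [_ + _] := HH (rcons sg (s (size sg))); apply.
  by exists s => //; rewrite size_rcons mkseqS sE.
have nZ2 p : mu.-negligible (Z2 p).
  rewrite /Z2; case: ifPn => [/asboolP cst|_]; last exact: negligible_set0.
  have mZ : measurable (H p.1 `\` C p.2 (ext p.1)) by exact: measurableD.
  exists (H p.1 `\` C p.2 (ext p.1)); split => //.
  have [_ _ +] := HH p.1; apply => //.
  move=> x [Hx nx]; split => // -[s sE Cx]; apply: nx.
  by rewrite -(cst _ sE).
exists (H [::]); split => //.
apply: (@negligibleS _ _ _ _ ((\bigcup_sg Z1 sg) `|` (\bigcup_p Z2 p))); last first.
  by apply: negligibleU; exact: negligible_bigcup_count.
move=> x; apply: contra_notP => /not_orP[nx1 nx2]; split; last first.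
  move=> [s Cs]; have [_ + _] := HH [::]; apply; exists s => //.
move=> H0.
have step sg : H sg x -> exists n, H (rcons sg n) x.
  move=> Hx; apply: contrapT => nex; apply: nx1; exists sg => //; split => //.
  by move=> [n _ Hn]; apply: nex; exists n.
have /choice[g Hg] : forall sg, exists n, H sg x -> H (rcons sg n) x.
  move=> sg; have [/step[n Hn]|nH] := pselect (H sg x); first by exists n.
  by exists 0%N.
pose sq := fix sq n := if n is m.+1 then rcons (sq m) (g (sq m)) else [::].
pose s n := g (sq n).
have sqE n : sq n = mkseq s n.
  by elim: n => //= n IH; rewrite mkseqS -IH.
have Hsq n : H (sq n) x by elim: n => //= n IH; exact: Hg.
exists s => k; have [N HN] := lC k s.
apply: contrapT => nC; apply: nx2; exists (sq N, k) => //.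
have szN : size (sq N) = N by rewrite sqE size_mkseq.
have agr t : mkseq t N = mkseq s N -> C k t = C k s.
  move=> e; apply: HN => i iN.
  by have := congr1 (fun z => nth 0%N z i) e; rewrite !nth_mkseq.
have extE : C k (ext (sq N)) = C k s.
  by apply: HN => i iN; rewrite /ext sqE nth_mkseq.
rewrite /Z2 /= szN; case: ifPn => [_|/asboolPn[]]; last first.
  by move=> t tE; rewrite extE; apply: agr; rewrite tE sqE.
by split; [exact: Hsq|rewrite extE].
Qed.

End measurability_up_to_null_sets.

Section suslin_sets.
Context (R : realType) (d : measure_display) (T : measurableType d).

Definition closed_rect (c : set T * (R * R)) : set (T * R) :=
  [set z | c.1 z.1 /\ (c.2.1 <= z.2 <= c.2.2)].

(** Analytic subsets of the product, built from measurable sets times compact intervals. Compactness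
    of the second factor makes the projection a Suslin operation again. *)
Definition suslin (B : set (T * R)) :=
  exists C : nat -> (nat -> nat) -> set T * (R * R),
    [/\ forall k s, measurable (C k s).1, forall k, locally_constant (C k) &
        B = [set z | exists s, forall k, closed_rect (C k s) z]].

Lemma suslin_rect (A : set T) (a b : R) : measurable A ->
  suslin [set z | A z.1 /\ (a <= z.2 <= b)].
Proof.
move=> mA; exists (fun _ _ => (A, (a, b))); split => //.
  by move=> k s; exists 0%N.
apply/seteqP; split => z; first by move=> Az; exists (fun=> 0%N).
by move=> [s /(_ 0%N)].
Qed.

(** The first term of the sequence selects the set; the remaining terms form a branch for it. *)
Lemma suslin_bigcup (B : nat -> set (T * R)) :
  (forall m, suslin (B m)) -> suslin (\bigcup_m B m).
Proof.
move=> /choice[C HC].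
exists (fun k s => C (s 0%N) k (fun i => s i.+1)); split => [k s|k s|].
- by have [] := HC (s 0%N).
- have [_ /(_ k (fun i => s i.+1))[N HN] _] := HC (s 0%N).
  exists N.+1 => s' ss'; rewrite ss'//; apply: HN => i iN.
  exact: ss'.
- apply/seteqP; split => z.
    move=> [m _ Bz]; have [_ _ BE] := HC m; move: Bz; rewrite BE => -[s Hs].
    by exists (fun i => if i is j.+1 then s j else m).
  move=> [s Hs]; exists (s 0%N) => //; have [_ _ ->] := HC (s 0%N).
  by exists (fun i => s i.+1).
Qed.

Let dec (n : nat) : nat * nat := odflt (0, 0)%N (unpickle n).

Let decK p : dec (pickle p) = p.
Proof. by rewrite /dec pickleK. Qed.

(** Through the pairing of indices one sequence encodes a branch for each of the sets, and condition
    number [n] reads the branch named by the first part of [n]. *)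
Lemma suslin_bigcap (B : nat -> set (T * R)) :
  (forall m, suslin (B m)) -> suslin (\bigcap_m B m).
Proof.
move=> /choice[C HC].
pose sub (s : nat -> nat) (m j : nat) := s (pickle (m, j)).
exists (fun n s => C (dec n).1 (dec n).2 (sub s (dec n).1)); split => [n s|n s|].
- by have [] := HC (dec n).1.
- have [_ /(_ (dec n).2 (sub s (dec n).1))[N HN] _] := HC (dec n).1.
  (* A prefix of [s] that contains the positions of the first [N] terms of that branch. *)
  exists (\max_(j < N) (pickle ((dec n).1, val j)).+1)%N => s' ss'.
  apply: HN => i iN; apply: ss'.
  exact: (leq_bigmax_cond (F := fun j : 'I_N => (pickle ((dec n).1, val j)).+1)
    (Ordinal iN)).
- apply/seteqP; split => z.
    move=> Bz; have /choice[S HS] : forall m, exists s, forall k,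
        closed_rect (C m k s) z.
      by move=> m; have [_ _ BE] := HC m; have := Bz m I; rewrite BE.
    exists (fun i => S (dec i).1 (dec i).2) => n.
    rewrite [sub _ _](_ : _ = S (dec n).1)//.
    by apply/funext => j; rewrite /sub decK.
  move=> [s Hs] m _; have [_ _ ->] := HC m; exists (sub s m) => k.
  by have := Hs (pickle (m, k)); rewrite decK.
Qed.

(* The nested closed intervals over a point meet, at the supremum of their left
   endpoints. *)
Lemma suslin_proj_ae_measurable (mu : probability T R) (B : set (T * R)) :
  suslin B -> ae_measurable mu [set x | exists y, B (x, y)].
Proof.
move=> [C [mC lC ->]].
(* The left end of one interval is compared with the right end of another. On the line, compact
   intervals that meet pairwise have a common point, so this eliminates the second coordinate. *)
pose D n s := [set x | (C (dec n).1 s).1 x /\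
  ((C (dec n).1 s).2.1 <= (C (dec n).2 s).2.2)].
rewrite [X in ae_measurable _ X](_ : _ = suslin_op D).
  apply: suslin_op_ae_measurable => [n s|n s].
    rewrite /D; case: (_ <= _) => //=.
      by rewrite (_ : [set x | _] = (C (dec n).1 s).1)//; apply/seteqP; split => x //= [].
    by rewrite (_ : [set x | _] = set0)//; apply/seteqP; split => x //= [].
  have [N1 HN1] := lC (dec n).1 s; have [N2 HN2] := lC (dec n).2 s.
  exists (maxn N1 N2) => s' ss'; rewrite /D HN1 ?HN2//= => i iN; apply: ss'.
    by rewrite leq_max iN orbT.
  by rewrite leq_max iN.
apply/seteqP; split => x.
  move=> [y [s Hs]]; exists s => n; split; first by have [] := Hs (dec n).1.
  have [_ /= /andP[h _]] := Hs (dec n).1; have [_ /= /andP[_ h']] := Hs (dec n).2.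
  exact: le_trans h h'.
move=> [s Hs].
have Aab i j : (C i s).1 x /\ ((C i s).2.1 <= (C j s).2.2).
  by have := Hs (pickle (i, j)); rewrite /D decK.
pose L := range (fun i => (C i s).2.1).
exists (sup L), s => k; split => /=; first by have [] := Aab k k.
apply/andP; split.
  apply: ub_le_sup; last by exists k.
  by exists (C 0%N s).2.2 => _ [i _ <-]; have [] := Aab i 0%N.
apply: ge_sup; first by exists (C 0%N s).2.1, 0%N.
by move=> _ [i _ <-]; have [] := Aab i k.
Qed.

(** Suslin sets need not be closed under complement, so the induction over the sigma-algebra carries
    the complement along. *)
Let suslin2 : set (set (T * R)) := [set B | suslin B /\ suslin (~` B)].

Lemma suslin_measurable (B : set (T * R)) : measurable B -> suslin B.
Proof.
have sa : sigma_algebra setT suslin2.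
  split.
  - split.
      rewrite (_ : set0 = [set z | @set0 T z.1 /\ (0 <= z.2 <= 0)]).
        exact: suslin_rect.
      by apply/seteqP; split => z //= [].
    rewrite (_ : ~` (@set0 (T * R)) = \bigcup_n [set z : T * R | setT z.1 /\ (- n%:R <= z.2 <= n%:R)]).
      by apply: suslin_bigcup => n; exact: suslin_rect.
    apply/seteqP; split => z; last by move=> _ [].
    move=> _.
    have [n nz] : exists n : nat, `|z.2| <= n%:R.
      by exists (Num.bound `|z.2|); apply/ltW/archi_boundP.
    by exists n => //; split => //=; rewrite -ler_norml.
  - move=> A [sA sA']; split; rewrite ?setTD//; last by rewrite setCK.
  - move=> F sF; split; first by apply: suslin_bigcup => n; have [] := sF n.
    by rewrite setC_bigcup; apply: suslin_bigcap => n; have [] := sF n.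
have rayC (r : R) : suslin [set z : T * R | r <= z.2].
  rewrite (_ : mkset _ = \bigcup_n [set z : T * R | setT z.1 /\ (r <= z.2 <= n%:R)]).
    by apply: suslin_bigcup => n; exact: suslin_rect.
  apply/seteqP; split => z.
    move=> rz; exists (Num.bound `|z.2|) => //; split => //=; rewrite rz /=.
    by apply: le_trans (ler_norm _) _; apply/ltW/archi_boundP.
  by move=> [n _ [_ /andP[]]].
have rayO (r : R) : suslin [set z : T * R | z.2 < r].
  rewrite (_ : mkset _ = \bigcup_n [set z : T * R | setT z.1 /\
     (- n%:R <= z.2 <= r - n.+1%:R^-1)]).
    by apply: suslin_bigcup => n; exact: suslin_rect.
  apply/seteqP; split => z.
    move=> zr; have [n hn] := ltr_add_invr zr.
    exists (maxn n (Num.bound `|z.2|)) => //; split => //=; apply/andP; split.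
      rewrite lerNl; apply: (@le_trans _ _ (Num.bound `|z.2|)%:R).
        rewrite -normrN; apply: le_trans (ler_norm _) _.
        by rewrite normrN; apply/ltW/archi_boundP.
      by rewrite ler_nat leq_maxr.
    rewrite lerBrDr; apply: le_trans (ltW hn); rewrite lerD2l.
    by rewrite lef_pV2 ?posrE// ler_nat ltnS leq_maxl.
  move=> [n _ [_ /andP[_]]] /le_lt_trans; apply.
  by rewrite ltrBlDr ltrDl invr_gt0.
have prod1 (A : set T) : measurable A -> suslin2 (fst @^-1` A).
  have h (A' : set T) : measurable A' -> suslin (fst @^-1` A').
    move=> mA; rewrite (_ : _ @^-1` _ = \bigcup_n [set z : T * R | A' z.1 /\
       (- n%:R <= z.2 <= n%:R)]).
      by apply: suslin_bigcup => n; exact: suslin_rect.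
    apply/seteqP; split => z; last by move=> [n _ []].
    move=> Az; exists (Num.bound `|z.2|) => //; split => //=.
    by rewrite -ler_norml; apply/ltW/archi_boundP.
  by move=> mA; split; [exact: h|rewrite preimage_setC; apply/h/measurableC].
have prod2 (A : set R) : measurable A -> suslin2 (snd @^-1` A).
  move=> mA; have {mA} : (@RGenCInfty.G R).-sigma.-measurable A by rewrite -RGenCInfty.measurableE.
  move=> mA.
  have saR : sigma_algebra setT [set A : set R | suslin2 (snd @^-1` A : set (T * R))].
    have [h1 h2 h3] := sa; split.
    - by rewrite /= preimage_set0.
    - by move=> A' /= /h2; rewrite !setTD preimage_setC.
    - by move=> F /= /h3; rewrite preimage_bigcup.
  apply: (@smallest_sub _ _ _ _ saR _ A mA).
  move=> _ [r ->] /=; split.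
    rewrite (_ : _ @^-1` _ = [set z : T * R | r <= z.2])//.
    by apply/seteqP; split => z /=; rewrite in_itv/= andbT.
  rewrite preimage_setC.
  rewrite (_ : _ @^-1` _ = [set z : T * R | z.2 < r])//.
  by apply/seteqP; split => z /=; rewrite in_itv/= andbT real_ltNge ?num_real// => /negP.
move=> mB; have : suslin2 B.
  apply: (@smallest_sub _ _ _ _ sa _ B mB).
  by move=> _ [|] [A mA <-]; rewrite setTI; [exact: prod1|exact: prod2].
by case.
Qed.

End suslin_sets.

(** The label [f] moves the second factor into the real line, where compact intervals are available;
    since [f] is injective with measurable images, the transported set [tld B] stays measurable and
    has the same projection. *)
Lemma proj_ae_measurable (R : realType) (d : measure_display)
    (J : measurableType d) (mu : probability J R) (B : set (J * J)) :
  standard_borel J R -> measurable B ->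
  ae_measurable mu [set x | exists y, B (x, y)].
Proof.
move=> [f [mf [finj fim]]] mB.
pose tld (B : set (J * J)) : set (J * R) := [set z | exists2 y, f y = z.2 & B (z.1, y)].
have mtld : measurable (tld B).
  have mT : measurable (tld setT).
    rewrite (_ : tld setT = snd @^-1` (range f)).
      by rewrite -[X in measurable X]setTI; apply: measurable_snd => //; exact: fim.
    by apply/seteqP; split => -[x r] /= [y ? ?]; exists y.
  have sa : sigma_algebra setT [set B : set (J * J) | measurable (tld B)].
    split.
    - by rewrite /= (_ : tld set0 = set0)//; apply/seteqP; split => z // [].
    - move=> A mA /=; rewrite (_ : tld _ = tld setT `\` tld A); first exact: measurableD.
      apply/seteqP; split => z.
        move=> [y fy [_ nA]]; split; first by exists y.
        by move=> [y' fy' A']; apply: nA; rewrite (finj y y')// fy.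
      by move=> [[y fy _] nA]; exists y => //; split => // Ay; apply: nA; exists y.
    - move=> F mF /=; rewrite (_ : tld _ = \bigcup_n tld (F n)).
        exact: bigcupT_measurable.
      apply/seteqP; split => z; first by move=> [y fy [n _ ?]]; exists n => //; exists y.
      by move=> [n _ [y fy ?]]; exists y => //; exists n.
  apply: (@smallest_sub _ _ _ _ sa _ B mB).
  move=> _ [|] [A mA <-]; rewrite setTI /=.
    rewrite (_ : tld _ = tld setT `&` fst @^-1` A).
      apply: measurableI => //.
      by rewrite -[X in measurable X]setTI; exact: measurable_fst.
    apply/seteqP; split => -[x r] /=; first by move=> [y ? ?]; split => //; exists y.
    by move=> [[y ? _] ?]; exists y.
  rewrite (_ : tld _ = snd @^-1` (f @` A)).
    by rewrite -[X in measurable X]setTI; apply: measurable_snd => //; exact: fim.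
  by apply/seteqP; split => -[x r] /= [y ? ?]; exists y.
have := suslin_proj_ae_measurable mu (suslin_measurable mtld).
rewrite (_ : [set x | _] = [set x | exists y, B (x, y)])//.
apply/seteqP; split => x; first by move=> [r [y _ ?]]; exists y.
by move=> [y ?]; exists (f y), y.
Qed.

(** * Measurability of sets described by formulas *)

Section set_comprehensions.
Context (R : realType) (d : measure_display) (T : measurableType d).
Implicit Types (P Q : T -> Prop).

Lemma measurable_preim (d' : measure_display) (T' : measurableType d')
    (h : T -> T') (A : set T') : measurable_fun setT h -> measurable A ->
  measurable [set t | A (h t)].
Proof. by move=> mh mA; rewrite -[X in measurable X]setTI; exact: mh. Qed.

Lemma measurable_lt_set (f g : T -> R) : measurable_fun setT f ->
  measurable_fun setT g -> measurable [set t | f t < g t].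
Proof.
move=> mf mg.
exact: (measurable_preim (measurable_fun_ltr mf mg)
  (A := [set true])).
Qed.

Lemma measurable_le_comp (f g : T -> R) : measurable_fun setT f ->
  measurable_fun setT g -> measurable [set t | f t <= g t].
Proof.
move=> mf mg.
exact: (measurable_preim (measurable_fun_ler mf mg)
  (A := [set true])).
Qed.

Lemma measurable_eq_set (f g : T -> R) : measurable_fun setT f ->
  measurable_fun setT g -> measurable [set t | f t = g t].
Proof.
move=> mf mg.
rewrite (_ : mkset _ = [set t | f t == g t]); last first.
  by apply/seteqP; split => t /= /eqP.
exact: (measurable_preim (measurable_fun_eqr mf mg)
  (A := [set true])).
Qed.

Lemma measurable_Pand P Q : measurable [set t | P t] ->
  measurable [set t | Q t] -> measurable [set t | P t /\ Q t].
Proof. exact: measurableI. Qed.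

Lemma measurable_Por P Q : measurable [set t | P t] ->
  measurable [set t | Q t] -> measurable [set t | P t \/ Q t].
Proof. exact: measurableU. Qed.

Lemma measurable_Pnot P : measurable [set t | P t] -> measurable [set t | ~ P t].
Proof. exact: measurableC. Qed.

Lemma measurable_Pimply P Q : measurable [set t | P t] ->
  measurable [set t | Q t] -> measurable [set t | P t -> Q t].
Proof.
move=> mP mQ; rewrite (_ : mkset _ = [set t | ~ P t \/ Q t]).
  by apply: measurable_Por => //; exact: measurable_Pnot.
apply/seteqP; split => t /=; last by move=> [|].
by move=> PQ; have [/PQ|] := pselect (P t); [right|left].
Qed.

Lemma measurable_Pex (I : countType) (P : I -> T -> Prop) :
  (forall i, measurable [set t | P i t]) -> measurable [set t | exists i, P i t].
Proof.
move=> mP; rewrite (_ : mkset _ = \bigcup_i [set t | P i t]).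
  exact: countable_bigcupT_measurable.
by apply/seteqP; split => t /= [i]; exists i.
Qed.

Lemma measurable_Pall (I : countType) (P : I -> T -> Prop) :
  (forall i, measurable [set t | P i t]) -> measurable [set t | forall i, P i t].
Proof.
move=> mP; rewrite (_ : mkset _ = [set t | ~ exists i, ~ P i t]).
  by apply/measurable_Pnot/measurable_Pex => i; exact: measurable_Pnot.
apply/seteqP; split => t /=; first by move=> Pt [i]; apply.
by move=> nex i; apply: contrapT => nP; apply: nex; exists i.
Qed.

Lemma measurable_constP (P : Prop) : measurable [set _ : T | P].
Proof.
have [p|np] := pselect P.
  by rewrite (_ : mkset _ = setT)//; apply/seteqP; split.
by rewrite (_ : mkset _ = set0)//; apply/seteqP; split.
Qed.

End set_comprehensions.

Lemma measurable_fun_fst_comp (d d1 d2 : measure_display) (T : measurableType d)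
    (T1 : measurableType d1) (T2 : measurableType d2) (h : T -> T1 * T2) :
  measurable_fun setT h -> measurable_fun setT (fun t => (h t).1).
Proof. by move=> mh; apply: measurableT_comp mh. Qed.

Lemma measurable_fun_snd_comp (d d1 d2 : measure_display) (T : measurableType d)
    (T1 : measurableType d1) (T2 : measurableType d2) (h : T -> T1 * T2) :
  measurable_fun setT h -> measurable_fun setT (fun t => (h t).2).
Proof. by move=> mh; apply: measurableT_comp mh. Qed.

Lemma measurable_fun_applied (d d1 d2 : measure_display) (T : measurableType d)
    (T1 : measurableType d1) (T2 : measurableType d2) (g : T1 -> T2) (h : T -> T1) :
  measurable_fun setT g -> measurable_fun setT h ->
  measurable_fun setT (fun t => g (h t)).
Proof. by move=> mg mh; exact: measurableT_comp mg mh. Qed.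

Ltac mfun := repeat first
  [ assumption | exact: measurable_id | exact: measurable_cst
  | apply: measurable_fun_pair | apply: measurable_fun_fst_comp
  | apply: measurable_fun_snd_comp
  | match goal with H : forall i, measurable_fun setT _ |- _ => exact: H end
  | match goal with H : measurable_fun setT ?g |- measurable_fun setT (fun t => ?g _) =>
      apply: (measurable_fun_applied H) end
  | match goal with H : forall i, measurable_fun setT (?g i) |- measurable_fun setT (fun t => ?g ?i _) =>
      apply: (measurable_fun_applied (H i)) end ].

Ltac mset := repeat first
  [ assumption
  | apply: measurable_Pand | apply: measurable_Por | apply: measurable_Pnot
  | apply: measurable_lt_set; solve [mfun] | apply: measurable_le_comp; solve [mfun]
  | apply: measurable_eq_set; solve [mfun]
  | match goal with H : measurable ?A |- measurable [set t | ?A _] =>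
      apply: (measurable_preim _ H); solve [mfun] end ].

Section integrals_without_measurability.
Import HBNNSimple.
Context (R : realType) (d : measure_display) (T : measurableType d).
Context (mu : {measure set T -> \bar R}).
Local Open Scope ereal_scope.

(** The integral of a nonnegative function is a supremum over the simple functions below it, so
    monotonicity is immediate for arbitrary functions. This serves degree functions, which are
    integrated as they stand. *)
Lemma le_integral_ge0 (g h : T -> \bar R) :
  (forall x, 0 <= g x) -> (forall x, g x <= h x) ->
  \int[mu]_x g x <= \int[mu]_x h x.
Proof.
move=> g0 gh; rewrite !ge0_integralTE//; last first.
  by move=> x; exact: le_trans (gh x).
apply: le_ereal_sup => _ [k kg <-]; exists k => // x.
exact: le_trans (kg x) (gh x).
Qed.

(** A simple function below one integrand, cut off on [Z], lies below the other integrand and keeps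
    its integral. *)
Lemma integral_ge0_null (Z : set T) (g h : T -> \bar R) :
  measurable Z -> mu Z = 0 -> (forall x, 0 <= g x) -> (forall x, 0 <= h x) ->
  (forall x, ~ Z x -> g x = h x) -> \int[mu]_x g x = \int[mu]_x h x.
Proof.
move=> mZ Z0.
suff H (g' h' : T -> \bar R) : (forall x, 0 <= g' x) -> (forall x, 0 <= h' x) ->
    (forall x, ~ Z x -> g' x = h' x) -> \int[mu]_x g' x <= \int[mu]_x h' x.
  move=> g0 h0 gh; apply/eqP; rewrite eq_le !H//.
  by move=> x /gh.
move=> g0 h0 gh; rewrite !ge0_integralTE//.
apply: ge_ereal_sup => _ [k kg <-]; apply: ereal_sup_ubound.
have mZc : measurable (~` Z) by exact: measurableC.
exists (mul_nnsfun k (indic_nnsfun R mZc)).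
  move=> x /=; rewrite /mindic indicE; have [Zx|nZx] := pselect (Z x).
    by rewrite memNset ?mulr0//; apply.
  by rewrite mem_set// mulr1 -gh//.
rewrite -!integralT_nnsfun; apply: ge0_ae_eq_integral => //.
- by apply: measurableT_comp => //; exact: measurable_funPT.
- by apply: measurableT_comp => //; exact: measurable_funPT.
- by move=> x _; rewrite lee_fin.
- by move=> x _; rewrite lee_fin.
exists Z; split => // x /= nx; apply: contrapT => nZx; apply: nx => _ /=.
by rewrite /mindic indicE mem_set// mulr1.
Qed.

End integrals_without_measurability.

Section counting_lemmas.
Context (R : realType) (T : choiceType).
Local Open Scope ereal_scope.

Lemma countingE (X : set T) : finite_set X ->
  @counting T R X = (size (finmap.enum_fset (fset_set X)))%:R%:E.
Proof. by move=> fX; rewrite /counting asboolT. Qed.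

Lemma counting_ge0 (X : set T) : 0 <= @counting T R X.
Proof. by rewrite /counting; case: ifPn; rewrite ?lee_fin// leey. Qed.

Lemma counting_infinite (X : set T) : ~ finite_set X -> @counting T R X = +oo.
Proof. by move=> fX; rewrite /counting asboolF. Qed.

Lemma counting_set0 : @counting T R set0 = 0.
Proof. by rewrite countingE// fset_set0. Qed.

Lemma counting_set1 (x : T) : @counting T R [set x] = 1.
Proof. by rewrite countingE// fset_set1 finmap.cardfs1. Qed.

Lemma le_counting (X Y : set T) : X `<=` Y ->
  @counting T R X <= @counting T R Y.
Proof.
move=> XY; have [fY|nY] := pselect (finite_set Y); last first.
  by rewrite (counting_infinite nY) leey.
have fX := sub_finite_set XY fY.
rewrite !countingE// lee_fin ler_nat; apply: finmap.fsubset_leq_card.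
by rewrite -fset_set_sub.
Qed.

Lemma counting_ge1 (X : set T) (x : T) : X x -> 1 <= @counting T R X.
Proof. by move=> Xx; rewrite -(counting_set1 x); apply: le_counting => _ ->. Qed.

Lemma counting_finite (X : set T) : @counting T R X < +oo -> finite_set X.
Proof. by move=> h; apply: contrapT => nX; rewrite counting_infinite in h. Qed.

End counting_lemmas.

(** * Generating involutions *)

Section edge_measure.
Context (R : realType) (d : measure_display) (J : measurableType d).
Context (mu : probability J R) (E : set (J * J)).
Context (eta : {measure set (J * J)%type -> \bar R}).
Context (gE : graphing mu E) (eE : is_edge_measure mu E eta).
Local Open Scope ereal_scope.

Lemma edge_measure_inj (a b : \bar R) :
  (2%:R^-1)%:E * a = (2%:R^-1)%:E * b -> a = b.
Proof.
move=> /(congr1 (fun z => 2%:E * z)); rewrite !muleA -!EFinM divff//.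
by rewrite !mul1e.
Qed.

Lemma edge_measure_finite : eta setT < +oo.
Proof.
have [_ _ _ [D degD] _] := gE.
rewrite eE// setTI; apply: (@le_lt_trans _ _ ((2%:R^-1)%:E * D%:R%:E)).
  rewrite lee_pmul2l//.
  apply: (@le_trans _ _ (\int[mu]_x (cst D%:R%:E) x)).
    by apply: le_integral_ge0 => x; [exact: counting_ge0|exact: degD].
  by rewrite integral_cst// [X in _ * X](probability_setT mu) mule1.
by rewrite -EFinM ltry.
Qed.

(** On rectangles this is the balance equation of a graphing. Rectangles form a generating pi-system
    and [eta] is finite, so uniqueness of measures extends it. *)
Lemma edge_measure_swap (A : set (J * J)) : measurable A ->
  eta [set z | A (z.2, z.1)] = eta A.
Proof.
move=> mA.
have msw : measurable_fun setT (fun z : J * J => (z.2, z.1)) by mfun.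
pose m2 := measure_function_pushforward__canonical__measure_function_Measure eta msw.
suff : eta A = m2 A by move->.
pose G := [set A `*` B | A in @measurable _ J & B in @measurable _ J].
apply: (@measure_unique _ _ _ G (fun=> setT)) => //.
- exact: measurable_prod_measurableType.
- move=> _ _ [A1 mA1 [B1 mB1 <-]] [A2 mA2 [B2 mB2 <-]].
  exists (A1 `&` A2); first exact: measurableI.
  by exists (B1 `&` B2); [exact: measurableI|rewrite setXI].
- by move=> _; exists setT => //; exists setT => //; rewrite setXTT.
- by rewrite bigcup_const.
- move=> _ [A1 mA1 [B1 mB1 <-]]; rewrite /m2 /= /pushforward.
  have [_ _ _ _ symE] := gE.
  rewrite (_ : _ @^-1` _ = B1 `*` A1); last first.
    by apply/seteqP; split => z [].
  rewrite !eE; try exact: measurableX.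
  have eq (A' B' : set J) : \int[mu]_x deg R ((A' `*` B') `&` E) x =
      \int[mu]_(x in A') deg R (E `&` [set z | B' z.2]) x.
    rewrite [RHS]integral_mkcond; apply: eq_integral => x _.
    rewrite patchE; case: ifPn => [/set_mem Ax|/negP nAx].
      by congr counting; apply/seteqP; split => y /= [] // [].
    transitivity (@counting J R set0); last by rewrite counting_set0.
    congr counting.
    by apply/seteqP; split => y //= [[A'x _] _]; apply: nAx; rewrite inE.
  by rewrite !eq symE.
- by move=> _; exact: edge_measure_finite.
Qed.

Lemma edge_measure_null_vertices (Z : set J) : measurable Z -> mu Z = 0 ->
  eta [set z | Z z.1] = 0 /\ eta [set z | Z z.2] = 0.
Proof.
move=> mZ Z0.
have mZ1 : measurable [set z : J * J | Z z.1] by mset.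
have h : eta [set z | Z z.1] = 0.
  rewrite eE//; transitivity ((2%:R^-1)%:E * \int[mu]_x (cst 0 : J -> \bar R) x).
    congr (_ * _); apply: (integral_ge0_null mZ Z0) => [x|x|x nZx].
    - exact: counting_ge0.
    - by [].
    - transitivity (@counting J R set0); last by rewrite counting_set0.
      by congr counting; apply/seteqP; split => y //= [].
  by rewrite integral_cst// mul0e mule0.
by split => //; rewrite -[RHS]h -[RHS]edge_measure_swap.
Qed.

Lemma edge_measure_setI (F : set (J * J)) : measurable F -> eta F = eta (F `&` E).
Proof.
move=> mF; have [mE _ _ _ _] := gE.
by rewrite !eE//; [rewrite -setIA setIid|exact: measurableI].
Qed.

(** The graph of [phi] over [B] consists of edges. Its degree function is the indicator of the
    left-hand set, that of its reversal the indicator of the right-hand one, and reversal preserves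
    [eta]. *)
Lemma edge_injection_preserves (X Y : set J) (phi psi : J -> J) :
  measurable X -> measurable Y ->
  measurable_fun setT phi -> measurable_fun setT psi ->
  (exists2 f : J -> R, measurable_fun setT f & injective f) ->
  (forall x, X x -> [/\ E (x, phi x), Y (phi x) & psi (phi x) = x]) ->
  (forall y, Y y -> X (psi y) /\ phi (psi y) = y) ->
  forall B, measurable B -> mu (X `&` phi @^-1` B) = mu (Y `&` B).
Proof.
move=> mX mY mphi mpsi [f mf finj] XY YX B mB.
have [mE symE _ _ _] := gE.
(* Equality of vertices is tested on their real labels, which makes the graph measurable. *)
pose Gr := [set z : J * J | (X z.1 /\ f z.2 = f (phi z.1)) /\ B z.2].
have mGr : measurable Gr by rewrite /Gr; mset.
have GrE z : Gr z -> z.2 = phi z.1 by move=> [[_ /finj]].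
have mXB : measurable (X `&` phi @^-1` B).
  by rewrite (_ : _ `&` _ = [set x | X x /\ B (phi x)])//; mset.
have mYB : measurable (Y `&` B) by exact: measurableI.
have e1 : eta Gr = (2%:R^-1)%:E * mu (X `&` phi @^-1` B).
  rewrite eE// -[in RHS](setIT (X `&` _)) -integral_indic//; congr (_ * _).
  apply: eq_integral => x _; rewrite indicE /deg.
  have [[Xx Bx]|nXB] := pselect ((X `&` phi @^-1` B) x).
    rewrite mem_set//= -(counting_set1 R (phi x)); congr counting.
    apply/seteqP; split => y /=; first by move=> [/GrE].
    by move=> ->; split; [split|have [] := XY _ Xx].
  rewrite memNset//=; transitivity (@counting J R set0);
    last by rewrite counting_set0.
  congr counting.
  apply/seteqP; split => y //= [[[Xx /finj yE] By] _]; apply: nXB.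
  by split => //=; rewrite -yE.
have e2 : eta [set z | Gr (z.2, z.1)] = (2%:R^-1)%:E * mu (Y `&` B).
  rewrite eE; last by mset.
  rewrite -[in RHS](setIT (Y `&` _)) -integral_indic//; congr (_ * _).
  apply: eq_integral => y _; rewrite indicE /deg.
  have [[Yy By]|nXB] := pselect ((Y `&` B) y).
    have [Xy yE] := YX _ Yy.
    rewrite mem_set//= -(counting_set1 R (psi y)); congr counting.
    apply/seteqP; split => x /=.
      by move=> [[[/= Xx /finj -> _] _]]; have [_ _ ->] := XY _ Xx.
    move=> ->; split; first by split => //; split => //=; rewrite yE.
    by apply: symE; rewrite -[X in E (_, X)]yE; have [] := XY _ Xy.
  rewrite memNset//=; transitivity (@counting J R set0);
    last by rewrite counting_set0.
  congr counting.
  apply/seteqP; split => x //= [[[Xx /= /finj yE] By] _]; apply: nXB.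
  by split => //=; rewrite yE; have [] := XY _ Xx.
by apply: edge_measure_inj; rewrite -e1 -e2 edge_measure_swap.
Qed.

End edge_measure.

Lemma seq_gap_below (R : realType) (s : seq R) (r : R) :
  exists b : R, b < r /\ forall t, t \in s -> t < r -> t <= b.
Proof.
elim: s => [|t s [b [br Hb]]]; first by exists (r - 1); rewrite ltrBlDr ltrDl.
exists (if t < r then Num.max b t else b); split.
  by case: ifPn => // tr; rewrite gt_max br.
move=> t'; rewrite inE => /predU1P[->|ts] tr.
  by rewrite tr le_max lexx orbT.
by case: ifPn => // _; rewrite ?le_max Hb.
Qed.

Section involutions.
Context (R : realType) (d : measure_display) (J : measurableType d).
Context (mu : probability J R) (E : set (J * J)).
Context (eta : {measure set (J * J)%type -> \bar R}).
Context (gE : graphing mu E) (eE : is_edge_measure mu E eta).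
Context (f : J -> R) (mf : measurable_fun setT f) (finj : injective f).
Context (fim : forall A : set J, measurable A -> measurable (f @` A)).
Local Open Scope ereal_scope.

Lemma finite_nbhd (x : J) : finite_set [set y | E (x, y)].
Proof.
have [_ _ _ [D /(_ x) degD] _] := gE.
by apply: (@counting_finite R); apply: le_lt_trans degD _; rewrite ltry.
Qed.

(* [phi a x] is the neighbour of [x] with least label above [a]. *)
Lemma neighbour_functions : exists (phi : rat -> J -> J) (Z : set J),
  [/\ forall a, measurable_fun setT (phi a), measurable Z, mu Z = 0 &
      forall x y, ~ Z x -> E (x, y) -> exists a, y = phi a x].
Proof.
have [mE symE _ _ _] := gE.
pose B (p : rat * rat) :=
  [set z : J * J | E z /\ ((ratr p.1 < f z.2)%R /\ (f z.2 < ratr p.2)%R)].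
have mB p : measurable (B p) by rewrite /B; mset.
have sb : standard_borel J R by exists f.
have /choice[P HP] : forall p, exists P : set J, measurable P /\
    mu.-negligible [set x | ~ (P x <-> exists y, B p (x, y))].
  by move=> p; exact: (proj_ae_measurable mu sb (mB p)).
have mP p : measurable (P p) by case: (HP p).
have [Z [mZ Z0 HZ]] : mu.-negligible
    (\bigcup_p [set x | ~ (P p x <-> exists y, B p (x, y))]).
  by apply: negligible_bigcup_count => p; case: (HP p).
(* A rational [q] is a candidate when, up to the null set, [x] has a neighbour with label strictly
   between [a] and [q]. The infimum of the candidates is then the least neighbour label above [a],
   attained because neighbourhoods are finite. *)
pose u (a : rat) (n : nat) (x : J) : \bar R :=
  if unpickle n is Some q then (if x \in P (a, q) then (ratr q)%:E else +oo) else +oo.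
have mu_ a n : measurable_fun setT (u a n).
  rewrite /u; case: (unpickle n) => [q|]; last exact: measurable_cst.
  apply: measurable_fun_ifT => //.
  apply: (measurable_fun_bool true); rewrite setTI.
  rewrite (_ : _ @^-1` _ = P (a, q))//.
  by apply/seteqP; split => x /=; [move/set_mem|move/mem_set].
pose m a x := einfs (u a ^~ x) 0%N.
have mm a : measurable_fun setT (m a) by exact: measurable_fun_einfs.
(* Where the infimum is not a label, for instance when it is +oo, the default value is [x]
   itself. *)
have /choice[phi Hphi] : forall p : rat * J, exists y,
    (forall y', (f y')%:E = m p.1 p.2 -> y = y') /\
    ((forall y', (f y')%:E <> m p.1 p.2) -> y = p.2).
  move=> [a x] /=; have [[y ym]|nex] := pselect (exists y, (f y)%:E = m a x).
    exists y; split; last by move=> /(_ y).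
    by move=> y' y'm; apply: finj; apply: EFin_inj; rewrite ym y'm.
  by exists x; split => // y' y'm; case: nex; exists y'.
exists (fun a x => phi (a, x)), Z; split => //.
  move=> a _ A mA; rewrite setTI.
  rewrite (_ : _ @^-1` A = [set x | [set t%:E | t in f @` A] (m a x)] `|`
      (A `\` [set x | [set t%:E | t in range f] (m a x)])).
    apply: measurableU; last apply: measurableD => //.
      by apply: measurable_preim (mm a) _; apply: measurable_image_EFin; exact: fim.
    by apply: measurable_preim (mm a) _; apply: measurable_image_EFin; exact: fim.
  apply/seteqP; split => x /=; have /= [h1 h2] := Hphi (a, x).
    move=> Ax; have [[y ym]|nex] := pselect (exists y, (f y)%:E = m a x).
      by left; exists (f y) => //; exists y => //; rewrite -(h1 _ ym).
    right; split; first by rewrite -h2// => y' y'm; apply: nex; exists y'.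
    by move=> [_ [y _ <-]] ym; apply: nex; exists y.
  move=> [[_ [y Ay <-]] ym|[Ax nx]]; first by rewrite (h1 _ ym).
  by rewrite h2// => y' ym; apply: nx; exists (f y') => //; exists y'.
move=> x y nZx Exy.
have PB p : P p x <-> exists y, B p (x, y).
  by apply: contrapT => nP; apply/nZx/HZ; exists p.
have [s sE] : exists s : seq R, [set f y' | y' in [set y' | E (x, y')]] = [set` s].
  exact/finite_seqP/finite_image/finite_nbhd.
(* Below [f y] there is a gap free of neighbour labels; a rational [a] in it makes [y] the least
   neighbour above [a]. *)
have [b [by_ Hb]] := seq_gap_below s (f y).
have [a] := rat_in_itvoo by_; rewrite in_itv/= => /andP[ba ay].
have minP y' : E (x, y') -> (ratr a < f y')%R -> (f y <= f y')%R.
  move=> Exy' ay'; rewrite leNgt; apply/negP => lt.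
  have : (f y' <= b)%R by apply: Hb => //; have : [set` s] (f y') by rewrite -sE; exists y'.
  by rewrite leNgt (lt_trans ba ay').
exists a; have [h1 _] := Hphi (a, x); rewrite (h1 y)//=.
apply/eqP; rewrite eq_le; apply/andP; split.
  apply: le_ereal_inf_tmp => _ [n _ <-]; rewrite /u.
  case: (unpickle n) => [q|]; last by rewrite leey.
  case: ifPn => [/set_mem /PB[y' [/= Ey' [ay' y'q]]]|_]; last by rewrite leey.
  by rewrite lee_fin; apply: le_trans (ltW y'q); exact: minP.
apply/lee_addgt0Pr => e e0.
have [q] : exists q, (ratr q \in `]f y, (f y + e)%R[) by apply: rat_in_itvoo; rewrite ltrDl.
rewrite in_itv/= => /andP[yq qe].
apply: (@le_trans _ _ (ratr q)%:E); last by rewrite -EFinD lee_fin ltW.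
apply: ereal_inf_lbound; exists (pickle q) => //; rewrite /u pickleK.
by rewrite mem_set//; apply/PB; exists y.
Qed.

(** The exceptional set is enlarged again and again by the vertices adjacent to it. Edges ending in
    a null set have measure 0, by reversal, so each enlargement is null. Invariance allows [Z] to be
    removed without cutting any other component. *)
Lemma invariant_null_set : exists (phi : rat -> J -> J) (Z : set J),
  [/\ forall a, measurable_fun setT (phi a), measurable Z, mu Z = 0,
      forall x y, E (x, y) -> Z y -> Z x &
      forall x y, ~ Z x -> E (x, y) -> exists a, y = phi a x].
Proof.
have [mE symE _ _ _] := gE.
have [phi [Z0 [mphi mZ0 Z00 phiE]]] := neighbour_functions.
pose step (N : set J) := N `|`
  [set x | ~ Z0 x /\ exists a, E (x, phi a x) /\ N (phi a x)].
pose Zn n := iter n step Z0.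
have HZ n : measurable (Zn n) /\ mu (Zn n) = 0.
  elim: n => // n [mN N0].
  pose M := [set x | ~ Z0 x /\ exists a, E (x, phi a x) /\ Zn n (phi a x)].
  have mM : measurable M.
    rewrite /M; apply: measurable_Pand; first exact: measurable_Pnot.
    by apply: measurable_Pex => a; mset.
  split; first exact: measurableU.
  suff M0 : mu M = 0.
    by rewrite (_ : Zn n.+1 = Zn n `|` M)// null_set_setU.
  have [_] := edge_measure_null_vertices gE eE mN N0.
  rewrite eE; last by mset.
  rewrite -[RHS](mule0 (2%:R^-1)%:E) => /edge_measure_inj h.
  apply/eqP; rewrite eq_le measure_ge0 andbT -h -(setIT M) -integral_indic//.
  apply: le_integral_ge0 => x; first by rewrite lee_fin.
  rewrite indicE; have [[nZx [a [Ex Nx]]]|nM] := pselect (M x).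
    rewrite mem_set; last by split => //; exists a.
    exact: (@counting_ge1 R J
      [set y | ([set z | Zn n z.2] `&` E) (x, y)] (phi a x)).
  by rewrite memNset//; exact: counting_ge0.
exists phi, (\bigcup_n Zn n); split => //.
- by apply: bigcupT_measurable => n; case: (HZ n).
- apply/negligibleP; first by apply: bigcupT_measurable => n; case: (HZ n).
  by apply: negligible_bigcup => n; apply/negligibleP; case: (HZ n).
- move=> x y Exy [n _ Zy]; have [Zx|nZx] := pselect (Z0 x); first by exists 0%N.
  exists n.+1 => //; right; split => //; have [a ya] := phiE _ _ nZx Exy.
  by exists a; rewrite -ya.
- by move=> x y nZx; apply: phiE => Zx; apply: nZx; exists 0%N.
Qed.

(** For a triple [(i, j, q)] the two ends of an edge are exchanged when [phi i] leads from the lower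
    end to the upper, [phi j] leads back, and [q] separates their labels. The separation makes [X]
    and [Y] disjoint, so the exchange is an involution; [edge_injection_preserves] shows that it
    preserves the measure. *)
Lemma generating_involutions : exists (Z : set J) (sg : nat -> J -> J),
  [/\ measurable Z, mu Z = 0 & forall x y, E (x, y) -> Z y -> Z x] /\
  [/\ forall i, measurable_fun setT (sg i), forall i, involutive (sg i),
      forall i B, measurable B -> mu (sg i @^-1` B) = mu B &
      forall x y, ~ Z x -> E (x, y) -> exists i, y = sg i x].
Proof.
have [mE symE irrE _ _] := gE.
have [phi [Z [mphi mZ Z0 invZ phiE]]] := invariant_null_set.
pose X (p : rat * rat * rat) := [set x | (~ Z x /\ E (x, phi p.1.1 x)) /\
  ((f (phi p.1.2 (phi p.1.1 x)) = f x) /\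
   ((f x < ratr p.2)%R /\ (ratr p.2 < f (phi p.1.1 x))%R))].
pose Y (p : rat * rat * rat) := [set x | (~ Z x /\ E (x, phi p.1.2 x)) /\
  ((f (phi p.1.1 (phi p.1.2 x)) = f x) /\
   ((f (phi p.1.2 x) < ratr p.2)%R /\ (ratr p.2 < f x)%R))].
have mX p : measurable (X p) by rewrite /X; mset.
have mY p : measurable (Y p) by rewrite /Y; mset.
have XY p x : X p x -> [/\ E (x, phi p.1.1 x), Y p (phi p.1.1 x) &
    phi p.1.2 (phi p.1.1 x) = x].
  move=> [[nZ Ex] [/finj phix [lt1 lt2]]]; split => //.
  split; rewrite phix //; split; last exact: symE.
  by move=> Zp; apply: nZ; exact: invZ Ex Zp.
have YX p x : Y p x -> [/\ E (x, phi p.1.2 x), X p (phi p.1.2 x) &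
    phi p.1.1 (phi p.1.2 x) = x].
  move=> [[nZ Ex] [/finj phix [lt1 lt2]]]; split => //.
  split; rewrite phix //; split; last exact: symE.
  by move=> Zp; apply: nZ; exact: invZ Ex Zp.
have disj p x : X p x -> Y p x -> False.
  move=> [_ [_ [lt1 _]]] [_ [_ [_ lt2]]].
  by have := lt_trans lt1 lt2; rewrite ltxx.
pose s (p : rat * rat * rat) x := if x \in X p then phi p.1.1 x
  else if x \in Y p then phi p.1.2 x else x.
have sX p x : X p x -> s p x = phi p.1.1 x by move=> h; rewrite /s mem_set.
have sY p x : Y p x -> s p x = phi p.1.2 x.
  by move=> h; rewrite /s memNset ?mem_set// => /disj; exact.
have sN p x : ~ X p x -> ~ Y p x -> s p x = x.
  by move=> ? ?; rewrite /s !memNset.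
have sK p : involutive (s p).
  move=> x; have [Xx|nX] := pselect (X p x).
    by rewrite (sX _ _ Xx); have [_ Yx xE] := XY _ _ Xx; rewrite (sY _ _ Yx).
  have [Yx|nY] := pselect (Y p x); last by rewrite !sN.
  by rewrite (sY _ _ Yx); have [_ Xx xE] := YX _ _ Yx; rewrite (sX _ _ Xx).
have preE p (B : set J) : s p @^-1` B =
    ((X p `&` phi p.1.1 @^-1` B) `|` (Y p `&` phi p.1.2 @^-1` B)) `|`
    (B `\` (X p `|` Y p)).
  apply/seteqP; split => x /=.
    have [Xx|nX] := pselect (X p x); first by rewrite sX//; left; left.
    have [Yx|nY] := pselect (Y p x); first by rewrite sY//; left; right.
    by rewrite sN//; right; split => // -[].
  move=> [[[Xx Bx]|[Yx Bx]]|[Bx /not_orP[nX nY]]]; last by rewrite sN.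
    by rewrite sX.
  by rewrite sY.
have mpre p a (B A : set J) : measurable A -> measurable B ->
    measurable (A `&` phi a @^-1` B).
  by move=> mA mB; apply: measurableI => //; exact: measurable_preim (mphi a) mB.
have ms p : measurable_fun setT (s p).
  move=> _ B mB; rewrite setTI preE; apply: measurableU.
    by apply: measurableU; exact: mpre.
  by apply: measurableD => //; exact: measurableU.
have sP p (B : set J) : measurable B -> mu (s p @^-1` B) = mu B.
  move=> mB; rewrite preE measureU; [|by apply: measurableU; exact: mpre|
      by apply: measurableD => //; exact: measurableU|]; last first.
    by apply/seteqP; split => x //= [[[Xx _]|[Xx _]] [_]]; apply; [left|right].
  rewrite measureU; [|exact: mpre|exact: mpre|]; last first.
    by apply/seteqP; split => x //= [[/disj + _] [+ _]]; apply.
  have fex : exists2 f : J -> R, measurable_fun setT f & injective f by exists f.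
  transitivity (mu (Y p `&` B) + mu (X p `&` B) + mu (B `\` (X p `|` Y p))).
    congr (_ + _ + _).
      apply: (edge_injection_preserves gE eE (mX p) (mY p) (mphi p.1.1)
        (mphi p.1.2) fex (@XY p)) => //; first by move=> y /YX[].
    apply: (edge_injection_preserves gE eE (mY p) (mX p) (mphi p.1.2)
      (mphi p.1.1) fex (@YX p)) => //; first by move=> y /XY[].
  rewrite -measureU; [|exact: measurableI|exact: measurableI|]; last first.
    by apply/seteqP; split => x //= [[Yx _] [/disj]]; exact.
  rewrite -measureU; [|by apply: measurableU; exact: measurableI|
     by apply: measurableD => //; exact: measurableU|]; last first.
    by apply/seteqP; split => x //= [[[Xx _]|[Xx _]] [_]]; apply; [right|left].
  congr (mu _); apply/seteqP; split => x /=.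
    by move=> [[[_ Bx]|[_ Bx]]|[Bx _]].
  move=> Bx; have [Xx|nX] := pselect (X p x); first by left; right.
  have [Yx|nY] := pselect (Y p x); first by left; left.
  by right; split => // -[].
exists Z, (fun n => if unpickle n is Some p then s p else id); split; first by split.
split.
- by move=> n; case: (unpickle n) => [p|]; [exact: ms|exact: measurable_id].
- by move=> n; case: (unpickle n) => [p|//]; exact: sK.
- by move=> n B mB; case: (unpickle n) => [p|//]; exact: sP.
move=> x y nZx Exy.
have nZy : ~ Z y by move=> Zy; apply: nZx; exact: invZ Exy Zy.
have [i yE] := phiE _ _ nZx Exy; have [j xE] := phiE _ _ nZy (symE _ _ Exy).
have : f x != f y.
  by apply/eqP => /finj xy; apply: (irrE x); rewrite [X in E (_, X)]xy.
(* Any rational between the two labels serves as [q]; the order of [i] and [j] depends on which end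
   has the smaller label. *)
rewrite neq_lt => /orP[|] lt; have [q] := rat_in_itvoo lt;
    rewrite in_itv/= => /andP[xq qy].
  exists (pickle (i, j, q)); rewrite pickleK sX// /X /= -yE -xE.
  by split.
exists (pickle (j, i, q)); rewrite pickleK sY// /Y /= -yE -xE.
by split.
Qed.

End involutions.

(** * Mass transport and rank *)

Section counting_series.
Context (R : realType).
Local Open Scope ereal_scope.

Lemma card_eq_counting (S T : choiceType) (A : set S) (B : set T) :
  (A #= B)%card -> @counting S R A = @counting T R B.
Proof.
move=> AB; have [fB|nB] := pselect (finite_set B); last first.
  by rewrite !counting_infinite// (eq_finite_set AB).
have fA : finite_set A by rewrite (eq_finite_set AB).
rewrite !countingE//; case/finite_setP: fB => n Bn.
by rewrite (card_fset_set Bn) (card_fset_set (card_eq_trans AB Bn)).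
Qed.

Lemma counting_image_series (T : choiceType) (S : set T) (h : nat -> T)
    (A : set nat) : {in A &, injective h} -> h @` A = S ->
  @counting T R S = \sum_(0 <= k <oo) (\1_A k)%:E.
Proof.
move=> hinj <-; rewrite (card_eq_counting (inj_card_eq hinj)) counting_dirac.
by apply: eq_eseriesr => k _; rewrite diracE indicE.
Qed.

End counting_series.

Section components.
Context (d : measure_display) (J : measurableType d).
Implicit Types (A B : set (J * J)).

Lemma comp_refl A x : comp A x x. Proof. exact: rt_refl. Qed.

Lemma comp_trans A x y z : comp A x y -> comp A y z -> comp A x z.
Proof. exact: rt_trans. Qed.

Lemma comp_edge A x y : A (x, y) -> comp A x y. Proof. exact: rt_step. Qed.

Lemma comp_sym A x y : sym_set A -> comp A x y -> comp A y x.
Proof.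
move=> sA; elim=> [a b Aab|a|a b c _ IH1 _ IH2]; first exact/rt_step/sA.
  exact: rt_refl.
exact: rt_trans IH2 IH1.
Qed.

Lemma sub_comp A B x y : A `<=` B -> comp A x y -> comp B x y.
Proof.
move=> AB; elim=> [a b Aab|a|a b c _ IH1 _ IH2]; first exact/rt_step/AB.
  exact: rt_refl.
exact: rt_trans IH1 IH2.
Qed.

Lemma comp_closed A (S : set J) x : S x ->
  (forall a b, S a -> A (a, b) -> S b) -> comp A x `<=` S.
Proof.
move=> Sx clS y xy; elim: xy Sx => // [a b Aab /clS|a b c _ IH1 _ IH2 Sa].
  exact.
exact/IH2/IH1.
Qed.

Lemma comp_eq A x y : sym_set A -> comp A x y -> comp A x = comp A y.
Proof.
move=> sA xy; apply/seteqP; split => z; last exact: comp_trans xy.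
exact/comp_trans/comp_sym.
Qed.

Lemma comp_bigcup (A : nat -> set (J * J)) x y :
  (forall i j, (i <= j)%N -> A i `<=` A j) ->
  comp (\bigcup_i A i) x y -> exists i, comp (A i) x y.
Proof.
move=> mA; elim=> [a b [i _ Aab]|a|a b c _ [i hi] _ [j hj]].
- by exists i; exact: rt_step.
- by exists 0%N; exact: rt_refl.
exists (maxn i j); apply: (@rt_trans _ _ _ b).
  by apply: sub_comp hi; apply: mA; exact: leq_maxl.
by apply: sub_comp hj; apply: mA; exact: leq_maxr.
Qed.

End components.

Section orbits.
Context (R : realType) (d : measure_display) (J : measurableType d).
Context (mu : probability J R) (E : set (J * J)).
Context (f : J -> R) (mf : measurable_fun setT f) (finj : injective f).
Context (sg : nat -> J -> J) (msg : forall i, measurable_fun setT (sg i)).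
Context (sgK : forall i, involutive (sg i)).
Context (sgP : forall i B, measurable B -> mu (sg i @^-1` B) = mu B).
Context (sgE : forall x y, E (x, y) -> exists i, y = sg i x).
Local Open Scope ereal_scope.

Fixpoint word (s : seq nat) (x : J) : J :=
  if s is i :: s' then word s' (sg i x) else x.

Lemma word_cat s t x : word (s ++ t) x = word t (word s x).
Proof. by elim: s x => //= i s IH x. Qed.

Lemma word_rev s x : word (rev s) (word s x) = x.
Proof.
elim: s x => //= i s IH x; rewrite rev_cons -cats1 word_cat IH /=.
exact: sgK.
Qed.

Lemma measurable_word s : measurable_fun setT (word s).
Proof.
elim: s => [|i s IH] /=; first exact: measurable_id.
exact: measurable_fun_applied IH (msg i).
Qed.

Lemma word_preserves s (B : set J) : measurable B -> mu (word s @^-1` B) = mu B.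
Proof.
elim: s => //= i s IH mB; rewrite -[in RHS]IH//.
rewrite -[in RHS](sgP i)//.
by rewrite -[X in measurable X]setTI; exact: measurable_word.
Qed.

(** Orbits contain the components of all subgraphs of [E]. A quantifier over an orbit is one over
    the countably many words and so preserves measurability. *)
Definition orb (x y : J) := exists s, y = word s x.

Lemma orb_sym x y : orb x y -> orb y x.
Proof. by move=> [s ->]; exists (rev s); rewrite word_rev. Qed.

Lemma orb_trans x y z : orb x y -> orb y z -> orb x z.
Proof. by move=> [s ->] [t ->]; exists (s ++ t); rewrite word_cat. Qed.

Fixpoint walk (A : set (J * J)) (s : seq nat) (x : J) : Prop :=
  if s is i :: s' then A (x, sg i x) /\ walk A s' (sg i x) else True.

Lemma comp_walk (A : set (J * J)) x y : A `<=` E ->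
  comp A x y <-> exists s, walk A s x /\ y = word s x.
Proof.
move=> AE; split.
  move=> xy; elim: (clos_rt_rt1n _ _ _ _ xy) => {xy} [a|a b c Aab _ [s [ws ->]]]; first by exists [::].
  by have [i bE] := sgE (AE _ Aab); exists (i :: s); rewrite /= -bE.
move=> [s [+ ->]]; elim: s x => [x _|i s IH x /= [Ax ws]]; first exact: comp_refl.
by apply: comp_trans (comp_edge Ax) _; exact: IH.
Qed.

Lemma comp_orb (A : set (J * J)) x y : A `<=` E -> comp A x y -> orb x y.
Proof. by move=> AE /(comp_walk _ _ AE)[s [_ ->]]; exists s. Qed.

Let gk (k : nat) : J -> J := word (odflt [::] (unpickle k)).

(** Different words may lead to the same point; keeping only the least code counts each point of the
    orbit once. *)
Let first (k : nat) (x : J) := forall j : 'I_k, gk j x <> gk k x.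

Let first_ex x y : orb x y -> exists k, y = gk k x /\ first k x.
Proof.
move=> [s yE].
have ex : exists k, `[< y = gk k x >].
  by exists (pickle s); apply/asboolP; rewrite /gk pickleK.
exists (ex_minn ex); case: ex_minnP => k /asboolP yk kmin; split => // j jk.
have : (k <= j)%N by apply: kmin; apply/asboolP; rewrite yk.
by rewrite leqNgt ltn_ord.
Qed.

Let first_uniq k l x : first k x -> first l x -> gk k x = gk l x -> k = l.
Proof.
move=> fk fl e; case: (ltngtP k l) => // lt.
  by have := fl (Ordinal lt); rewrite /= e.
by have := fk (Ordinal lt); rewrite /= e.
Qed.

Section measurable_families.
Context (dU : measure_display) (U : measurableType dU).

(** Measurability along every measurable choice of the vertex. This form is stable under
    substituting words, hence under quantification over orbits; the parameter [u] may be a vertex,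
    an edge, or a pair of vertices. *)
Definition mrel (P : U -> J -> Prop) := forall h : U -> J,
  measurable_fun setT h -> measurable [set u | P u (h u)].

Definition mrel2 (A : U -> set (J * J)) := forall a b : U -> J,
  measurable_fun setT a -> measurable_fun setT b ->
  measurable [set u | A u (a u, b u)].

Lemma measurable_eqJ (a b : U -> J) : measurable_fun setT a ->
  measurable_fun setT b -> measurable [set u | a u = b u].
Proof.
move=> ma mb; rewrite (_ : mkset _ = [set u | f (a u) = f (b u)]).
  by apply: measurable_eq_set; mfun.
by apply/seteqP; split => u /=; [move=> ->|exact: finj].
Qed.

Lemma measurable_orb_ex (x : U -> J) (P : U -> J -> Prop) :
  measurable_fun setT x -> mrel P ->
  measurable [set u | exists y, orb (x u) y /\ P u y].
Proof.
move=> mx mP.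
rewrite (_ : mkset _ = [set u | exists s : seq nat, P u (word s (x u))]).
  apply: measurable_Pex => s; apply: mP.
  exact: measurable_fun_applied (measurable_word s) mx.
apply/seteqP; split => u /=; first by move=> [_ [[s ->] Pu]]; exists s.
by move=> [s Pu]; exists (word s (x u)); split => //; exists s.
Qed.

Lemma measurable_orb_all (x : U -> J) (P : U -> J -> Prop) :
  measurable_fun setT x -> mrel P ->
  measurable [set u | forall y, orb (x u) y -> P u y].
Proof.
move=> mx mP.
rewrite (_ : mkset _ = [set u | forall s : seq nat, P u (word s (x u))]).
  apply: measurable_Pall => s; apply: mP.
  exact: measurable_fun_applied (measurable_word s) mx.
apply/seteqP; split => u /=; first by move=> + s; apply; exists s.
by move=> Pu _ [s ->].
Qed.

Lemma measurable_walk (A : U -> set (J * J)) (x : U -> J) s : mrel2 A ->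
  measurable_fun setT x -> measurable [set u | walk (A u) s (x u)].
Proof.
move=> mA; elim: s x => [x _|i s IH x mx] /=; first exact: measurable_constP.
have msx := measurable_fun_applied (msg i) mx.
by apply: measurable_Pand; [exact: mA|exact: IH].
Qed.

Lemma measurable_comp (A : U -> set (J * J)) (x y : U -> J) : mrel2 A ->
  (forall u, A u `<=` E) -> measurable_fun setT x -> measurable_fun setT y ->
  measurable [set u | comp (A u) (x u) (y u)].
Proof.
move=> mA AE mx my.
rewrite (_ : mkset _ = [set u | exists s : seq nat,
    walk (A u) s (x u) /\ y u = word s (x u)]).
  apply: measurable_Pex => s; apply: measurable_Pand.
    exact: measurable_walk.
  apply: measurable_eqJ => //.
  exact: measurable_fun_applied (measurable_word s) mx.
by apply/seteqP; split => u /= /(comp_walk _ _ (AE u)).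
Qed.

Lemma measurable_counting (x : U -> J) (Q : U -> J -> Prop) :
  measurable_fun setT x -> mrel Q -> (forall u y, Q u y -> orb (x u) y) ->
  measurable_fun setT (fun u => @counting J R [set y | Q u y]).
Proof.
move=> mx mQ Qorb.
pose A k := [set u | Q u (gk k (x u)) /\ first k (x u)].
have mA k : measurable (A k).
  apply: measurable_Pand.
    by apply: mQ; exact: measurable_fun_applied (measurable_word _) mx.
  apply: measurable_Pall => j; apply: measurable_Pnot; apply: measurable_eqJ.
    exact: measurable_fun_applied (measurable_word _) mx.
  exact: measurable_fun_applied (measurable_word _) mx.
rewrite (_ : (fun u => _) = fun u => \sum_(0 <= k <oo) (\1_(A k) u)%:E).
  apply: (@ge0_emeasurable_sum _ _ _ _ _ predT) => //.
  by move=> k _; apply: measurableT_comp.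
apply/funext => u.
rewrite (@counting_image_series R J _ (fun k => gk k (x u)) [set k | A k u]).
- by apply: eq_eseriesr => k _; rewrite !indicE; congr (_%:R%:E).
- by move=> k l /set_mem[_ fk] /set_mem[_ fl]; exact: first_uniq.
apply/seteqP; split => y /=; first by move=> [k [Qk _] <-].
move=> Qy; have [k [yE fk]] := first_ex (Qorb _ _ Qy).
by exists k => //; split => //; rewrite -yE.
Qed.

Lemma measurable_finite (x : U -> J) (Q : U -> J -> Prop) :
  measurable_fun setT x -> mrel Q -> (forall u y, Q u y -> orb (x u) y) ->
  measurable [set u | finite_set [set y | Q u y]].
Proof.
move=> mx mQ Qorb; have mc := measurable_counting mx mQ Qorb.
rewrite (_ : mkset _ = [set u | @counting J R [set y | Q u y] < +oo]).
  by rewrite -[X in measurable X]setTI; exact: emeasurable_fun_infty_o.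
apply/seteqP; split => u /=; last exact: counting_finite.
by move=> fQ; rewrite countingE// ltry.
Qed.

End measurable_families.

Let gi (k : nat) : J -> J := word (rev (odflt [::] (unpickle k))).
Let giK k x : gi k (gk k x) = x. Proof. exact: word_rev. Qed.
Let gkK k x : gk k (gi k x) = x.
Proof. by rewrite /gk /gi -[X in word X (word _ _)]revK word_rev. Qed.

(** [Q] splits into the graphs of the measure-preserving bijections [gk k] restricted to [D k], each
    pair being listed at its first code. Both integrals are the sum of the measures of these pieces,
    seen from the source or from the target. *)
Lemma mass_transport (Q : set (J * J)) : measurable Q ->
  (forall x y, Q (x, y) -> orb x y) ->
  \int[mu]_x deg R Q x = \int[mu]_x deg R [set z | Q (z.2, z.1)] x.
Proof.
move=> mQ Qorb.
pose D k := [set x | Q (x, gk k x) /\ first k x].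
have mgk k : measurable_fun setT (gk k) by exact: measurable_word.
have mgi k : measurable_fun setT (gi k) by exact: measurable_word.
have mD k : measurable (D k).
  apply: measurable_Pand; first by apply: (measurable_preim _ mQ); mfun.
  by apply: measurable_Pall => j; apply: measurable_Pnot; exact: measurable_eqJ.
have mD' k : measurable (gi k @^-1` D k).
  by rewrite -[X in measurable X]setTI; exact: mgi.
transitivity (\int[mu]_x \sum_(0 <= k <oo) (\1_(D k) x)%:E).
  apply: eq_integral => x _; rewrite /deg.
  rewrite (@counting_image_series R J _ (fun k => gk k x) [set k | D k x]).
  - by apply: eq_eseriesr => k _; rewrite !indicE; congr (_%:R%:E).
  - by move=> k l /set_mem[_ Dk] /set_mem[_ Dl]; exact: first_uniq.
  apply/seteqP; split => y /=; first by move=> [k [Qk _] <-].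
  move=> Qy; have [k [yE fk]] := first_ex (Qorb _ _ Qy).
  by exists k => //; split => //; rewrite -yE.
transitivity (\int[mu]_x \sum_(0 <= k <oo) (\1_(gi k @^-1` D k) x)%:E); last first.
  apply: eq_integral => y _; rewrite /deg.
  rewrite (@counting_image_series R J _ (fun k => gi k y) [set k | D k (gi k y)]).
  - by apply: eq_eseriesr => k _; rewrite !indicE; congr (_%:R%:E).
  - move=> k l /set_mem[/= _ fk] /set_mem[/= _ fl] e.
    by apply: (first_uniq fk); [rewrite e|rewrite [in RHS]e !gkK].
  apply/seteqP; split => x /=; first by move=> [k [+ _] <-]; rewrite gkK.
  move=> Qx; have [k [yE fk]] := first_ex (Qorb _ _ Qx).
  by exists k => //=; rewrite yE giK//; split => //; rewrite -yE.
rewrite !integral_nneseries//; last 2 first.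
- by move=> k; apply: measurableT_comp.
- by move=> k; apply: measurableT_comp.
apply: eq_eseriesr => k _; rewrite !integral_indic// !setIT.
exact/esym/word_preserves.
Qed.

End orbits.

Lemma finite_argmin (disp : Order.disp_t) (O : orderType disp) (T : choiceType)
    (S : set T) (h : T -> O) (x : T) : finite_set S -> S x ->
  exists2 m, S m & forall z, S z -> (h m <= h z)%O.
Proof.
move=> /finite_seqP[s ->]; elim: s x => // a s IH x _.
have [[y ys]|nex] := pselect (exists y, y \in s); last first.
  exists a => /=; first by rewrite inE eqxx.
  move=> z; rewrite /= inE => /predU1P[->|zs]; first exact: lexx.
  by case: nex; exists z.
have [m /= ms Hm] := IH y ys.
have [am|ma] := leP (h a) (h m).
  exists a => /=; first by rewrite inE eqxx.
  move=> z; rewrite /= inE => /predU1P[->|zs]; first exact: lexx.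
  by apply: le_trans am _; exact: Hm.
exists m => /=; first by rewrite inE ms orbT.
by move=> z; rewrite /= inE => /predU1P[->|/Hm//]; exact: ltW.
Qed.

Section rank.
Context (R : realType) (d : measure_display) (J : measurableType d).
Context (mu : probability J R) (E : set (J * J)).
Context (eta : {measure set (J * J)%type -> \bar R}).
Context (eE : is_edge_measure mu E eta).
Context (etaS : forall A, measurable A -> eta [set z | A (z.2, z.1)] = eta A).
Context (f : J -> R) (mf : measurable_fun setT f) (finj : injective f).
Context (sg : nat -> J -> J) (msg : forall i, measurable_fun setT (sg i)).
Context (sgK : forall i, involutive (sg i)).
Context (sgP : forall i B, measurable B -> mu (sg i @^-1` B) = mu B).
Context (sgE : forall x y, E (x, y) -> exists i, y = sg i x).
Local Open Scope ereal_scope.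
Local Notation orb := (orb sg).
Implicit Types A : set (J * J).

(** An infinite component may also have a vertex of least label; [infinite_comp_fmin_null] shows
    that this happens only on a null set of such vertices. *)
Definition fmin A (x r : J) :=
  comp A x r /\ forall z, comp A x z -> (f r <= f z)%R.

Definition roots A : set J :=
  [set r | finite_set (comp A r) /\ forall z, comp A r z -> (f r <= f z)%R].

Lemma fmin_ex A x : finite_set (comp A x) -> exists r, fmin A x r.
Proof.
move=> /(@finite_argmin _ _ _ _ f x)[|r xr rmin]; first exact: comp_refl.
by exists r.
Qed.

Lemma fmin_uniq A x r r' : fmin A x r -> fmin A x r' -> r = r'.
Proof.
by move=> [xr rm] [xr' r'm]; apply: finj; apply/eqP; rewrite eq_le rm// r'm.
Qed.

Lemma fmin_comp A x y r : sym_set A -> comp A x y -> fmin A x r -> fmin A y r.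
Proof. by move=> sA xy; rewrite /fmin (comp_eq sA xy). Qed.

Lemma roots_fmin A r : roots A r -> fmin A r r.
Proof. by move=> [_ h]; split => //; exact: comp_refl. Qed.

Lemma sub_roots A B : A `<=` B -> roots B `<=` roots A.
Proof.
move=> AB r [fr rm]; split => [|z rz]; last exact/rm/(sub_comp AB).
by apply: sub_finite_set fr => z; exact: sub_comp.
Qed.

Section families.
Context (dU : measure_display) (U : measurableType dU).

Lemma mrel2_cst A : measurable A -> mrel2 (fun _ : U => A).
Proof. by move=> mA a b ma mb; apply: (measurable_preim _ mA); mfun. Qed.

Lemma measurable_fmin (A : U -> set (J * J)) (x r : U -> J) : mrel2 A ->
  (forall u, A u `<=` E) -> measurable_fun setT x -> measurable_fun setT r ->
  measurable [set u | fmin (A u) (x u) (r u)].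
Proof.
move=> mA AE mx mr.
apply: measurable_Pand; first exact: (measurable_comp mf finj msg sgE).
rewrite (_ : mkset _ = [set u | forall z, orb (x u) z ->
    comp (A u) (x u) z -> (f (r u) <= f z)%R]).
  apply: (measurable_orb_all msg mx) => h mh; apply: measurable_Pimply.
    exact: (measurable_comp mf finj msg sgE).
  by apply: measurable_le_comp; mfun.
apply/seteqP; split => u /=; first by move=> + z _; apply.
by move=> h z xz; apply: h => //; exact: (comp_orb sgE (AE u)).
Qed.

Lemma measurable_finite_comp (A : U -> set (J * J)) (x : U -> J) : mrel2 A ->
  (forall u, A u `<=` E) -> measurable_fun setT x ->
  measurable [set u | finite_set (comp (A u) (x u))].
Proof.
move=> mA AE mx.
apply: (@measurable_finite R _ _ _ mf finj _ msg _ _ x (fun u => comp (A u) (x u))) => //.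
  by move=> h mh; exact: (measurable_comp mf finj msg sgE).
by move=> u y; exact: (comp_orb sgE (AE u)).
Qed.

End families.

Lemma measurable_roots A : measurable A -> A `<=` E -> measurable (roots A).
Proof.
move=> mA AE; rewrite (_ : roots A = [set r | finite_set (comp A r) /\ fmin A r r]).
  apply: measurable_Pand.
    by apply: (@measurable_finite_comp _ J (fun=> A) id) => //; exact: mrel2_cst.
  by apply: (@measurable_fmin _ J (fun=> A) id id) => //; exact: mrel2_cst.
apply/seteqP; split => r /= [h1 h2]; split => //; last by case: h2.
by split => //; exact: comp_refl.
Qed.

Let size_comp A (n : nat) := [set x | @counting J R (comp A x) = n%:R%:E].

Let measurable_size A n : measurable A -> A `<=` E -> measurable (size_comp A n).
Proof.
move=> mA AE; rewrite /size_comp.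
have mc : measurable_fun setT (fun x => @counting J R (comp A x)).
  apply: (@measurable_counting R _ _ _ mf finj _ msg _ J id (fun x => comp A x)) => //.
    move=> h mh; apply: (@measurable_comp _ _ _ _ _ mf finj _ msg sgE _ J (fun=> A) id h) => //.
    exact: mrel2_cst.
  by move=> x y; exact: (comp_orb sgE AE).
by rewrite -[X in measurable X]setTI; exact: (mc measurableT [set n%:R%:E]).
Qed.

Let finite_size A x : finite_set (comp A x) <-> exists n, size_comp A n x.
Proof.
split; first by move=> fx; exists (size (finmap.enum_fset (fset_set (comp A x))));
  rewrite /size_comp /= countingE.
by move=> [n xn]; apply: (@counting_finite R); rewrite [counting _]xn ltry.
Qed.

(** Mass transport: each vertex in a component of size [n] sends unit mass to its root, which
    receives [n]. *)
Lemma size_comp_roots A n : measurable A -> A `<=` E -> sym_set A ->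
  mu (size_comp A n) = n%:R%:E * mu (roots A `&` size_comp A n).
Proof.
move=> mA AE sA.
have mS := measurable_size n mA AE.
have mrS : measurable (roots A `&` size_comp A n).
  by apply: measurableI => //; exact: measurable_roots.
pose Q := [set z : J * J | size_comp A n z.1 /\ fmin A z.1 z.2].
have mQ : measurable Q.
  apply: measurable_Pand; first by apply: (measurable_preim _ mS); mfun.
  apply: (@measurable_fmin _ _ (fun=> A) fst snd) => //.
  exact: mrel2_cst.
have QE x y : Q (x, y) -> orb x y by move=> [_ [/= xy _]]; exact: (comp_orb sgE AE xy).
have := mass_transport mf finj msg sgK sgP mQ QE.
rewrite (_ : \int[mu]_x deg R Q x = mu (size_comp A n)); last first.
  rewrite -[in RHS](setIT (size_comp A n)) -integral_indic//.
  apply: eq_integral => x _; rewrite indicE.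
  have [Sx|nSx] := pselect (size_comp A n x).
    have /fmin_ex[r xr] : finite_set (comp A x) by apply/finite_size; exists n.
    rewrite mem_set//= -(counting_set1 R r); congr counting.
    apply/seteqP; split => y /=; last by move=> ->.
    by move=> [_ /= /fmin_uniq]; exact.
  rewrite memNset//=; transitivity (@counting J R set0);
    last by rewrite counting_set0.
  by congr counting; apply/seteqP; split => y //= [].
move=> ->.
rewrite -[in RHS](setIT (roots A `&` _)) -integral_indic//.
rewrite -ge0_integralZl; [|exact: measurableT|by apply: measurableT_comp|
  by move=> x _; rewrite lee_fin|by rewrite lee_fin].
apply: eq_integral => r _; rewrite indicE /deg.
have [[rr Sr]|nr] := pselect ((roots A `&` size_comp A n) r).
  rewrite mem_set//= mule1 -[RHS]Sr; congr counting.
  apply/seteqP; split => x /=.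
    by move=> [_ [/= + _]]; exact: comp_sym.
  move=> rx; split; first by rewrite /size_comp /= -(comp_eq sA rx).
  by apply: (fmin_comp sA rx); exact: roots_fmin.
rewrite memNset//= mule0; transitivity (@counting J R set0);
  last by rewrite counting_set0.
congr counting; apply/seteqP; split => x //= [/= Sx xr]; apply: nr.
have xr' : comp A x r by case: xr.
have Sr : size_comp A n r by rewrite /size_comp /= -(comp_eq sA xr').
split => //; have [_ h] := fmin_comp sA xr' xr; split => //.
by apply/finite_size; exists n.
Qed.

(** On components of size [n] the integrand is [1/n], and [size_comp_roots] turns the integral there
    into the measure of the roots. Infinite components contribute 0 and have no roots. *)
Lemma rankE A : measurable A -> A `<=` E -> sym_set A ->
  rank mu A = 1 - mu (roots A).
Proof.
move=> mA AE sA; rewrite /rank; congr (_ - _).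
pose S n := size_comp A n.
have mS n : measurable (S n) by exact: measurable_size.
have trS : trivIset setT S.
  apply/trivIsetP => i j _ _ ij; apply/seteqP; split => x //= [].
  rewrite /S /size_comp /= => -> [] /eqP; rewrite eqr_nat => /eqP ij'.
  by rewrite ij' eqxx in ij.
have SE : \bigcup_n S n = [set x | finite_set (comp A x)].
  apply/seteqP; split => x /=; first by move=> [n _ Sx]; apply/finite_size; exists n.
  by move=> /finite_size[n Sx]; exists n.
pose c x : \bar R := inv_card R (comp A x).
have cS n x : S n x -> c x = (n%:R^-1)%:E by rewrite /S /size_comp /c /inv_card /= => ->.
have cinf x : ~ (\bigcup_n S n) x -> c x = 0.
  by rewrite SE /= => nx; rewrite /c /inv_card counting_infinite.
have c0 x : 0 <= c x.
  have [[n _ Sx]|nS] := pselect ((\bigcup_n S n) x); last by rewrite cinf.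
  by rewrite (cS n)// lee_fin invr_ge0.
have mc : measurable_fun setT c.
  move=> _ B mB; rewrite setTI.
  rewrite (_ : _ @^-1` _ = [set x | (exists n, S n x /\ B (n%:R^-1)%:E) \/
      ((~ exists n, S n x) /\ B 0)]).
    apply: measurable_Por.
      by apply: measurable_Pex => n; apply: measurable_Pand; [exact: mS|exact: measurable_constP].
    apply: measurable_Pand; last exact: measurable_constP.
    by apply: measurable_Pnot; apply: measurable_Pex => n; exact: mS.
  apply/seteqP; split => x /=.
    have [[n Sx]|nS] := pselect (exists n, S n x).
      by rewrite (cS n)// => Bn; left; exists n.
    by rewrite cinf; [move=> ?; right|move=> [n _ Sx]; apply: nS; exists n].
  move=> [[n [Sx Bn]]|[nS B0]]; first by rewrite (cS n).
  by rewrite cinf// => -[n _ Sx]; apply: nS; exists n.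
transitivity (\int[mu]_(x in \bigcup_n S n) c x).
  rewrite [RHS]integral_mkcond; apply: eq_integral => x _; rewrite patchE.
  by case: ifPn => // /negP nS; apply: cinf => Sx; apply: nS; rewrite inE.
rewrite ge0_integral_bigcup//; last exact: measurable_funTS.
rewrite (_ : roots A = \bigcup_n (roots A `&` S n)); last first.
  rewrite -setI_bigcupr SE; apply/seteqP; split => x; last by case.
  by move=> rx; split => //; case: rx.
have mr := measurable_roots mA AE.
rewrite measure_bigcup//; last 2 first.
- by move=> n _; exact: measurableI.
- by apply/trivIsetP => i j _ _ ij; rewrite setIACA ((iffLR trivIsetP trS) i j)// setI0.
under [RHS]eq_eseriesl do rewrite in_setT.
apply: eq_eseriesr => n _.
transitivity (\int[mu]_(x in S n) (n%:R^-1)%:E).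
  by apply: eq_integral => x /set_mem; exact: cS.
rewrite integral_cst//.
transitivity ((n%:R^-1)%:E * (n%:R%:E * mu (roots A `&` S n))).
  by congr (_ * _); exact: (size_comp_roots n mA AE sA).
rewrite muleA -EFinM.
(* Size 0 does not occur, as a component contains its starting vertex. *)
have [->|n0] := eqVneq n 0%N; last by rewrite mulVf ?mul1e ?pnatr_eq0.
rewrite mulr0 mul0e; apply/esym/eqP; rewrite eq_le measure_ge0 andbT.
rewrite (_ : roots A `&` S 0%N = set0) ?measure0//; apply/seteqP; split => x //= [_].
move=> Sx; have := counting_ge1 R (comp_refl A x).
by rewrite [counting _]Sx lee_fin ler10.
Qed.

(** Every vertex sends unit mass to the vertex of least label in its component, if there is one. In
    an infinite component that vertex would receive infinite mass, whereas the total mass sent is at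
    most 1. *)
Lemma infinite_comp_fmin_null A : measurable A -> A `<=` E -> sym_set A ->
  mu [set r | ~ finite_set (comp A r) /\ fmin A r r] = 0.
Proof.
move=> mA AE sA; set X := mkset _.
have mX : measurable X.
  apply: measurable_Pand.
    apply: measurable_Pnot.
    by apply: (@measurable_finite_comp _ J (fun=> A) id) => //; exact: mrel2_cst.
  by apply: (@measurable_fmin _ J (fun=> A) id id) => //; exact: mrel2_cst.
pose Q := [set z : J * J | fmin A z.1 z.2].
have mQ : measurable Q.
  by apply: (@measurable_fmin _ _ (fun=> A) fst snd) => //; exact: mrel2_cst.
have QE x y : Q (x, y) -> orb x y by move=> [/= xy _]; exact: (comp_orb sgE AE xy).
have mt := mass_transport mf finj msg sgK sgP mQ QE.
have le1 : \int[mu]_x deg R Q x <= 1.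
  apply: (@le_trans _ _ (\int[mu]_x (cst 1 : J -> \bar R) x)).
    apply: le_integral_ge0 => x; first exact: counting_ge0.
    have [[r xr]|nex] := pselect (exists r, fmin A x r).
      rewrite /= -(counting_set1 R r); apply: le_counting => y /=.
      by move=> /fmin_uniq; exact.
    rewrite /deg (_ : mkset _ = set0) ?counting_set0//.
    by apply/seteqP; split => y //= xy; apply: nex; exists y.
  by rewrite integral_cst// mul1e [X in X <= _](probability_setT mu).
have len n : n%:R%:E * mu X <= 1.
  apply: le_trans le1; rewrite mt -[X in mu X](setIT X) -integral_indic//.
  rewrite -ge0_integralZl; [|exact: measurableT|by apply: measurableT_comp|
    by move=> x _; rewrite lee_fin|by rewrite lee_fin].
  apply: le_integral_ge0 => r; first by rewrite mule_ge0// lee_fin.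
  rewrite indicE; have [[nf rr]|nX] := pselect (X r); last first.
    by rewrite memNset//= mule0; exact: counting_ge0.
  rewrite /deg counting_infinite ?leey//; apply: contra_not nf.
  apply: sub_finite_set => x rx; exact: (fmin_comp sA rx rr).
apply/eqP; rewrite eq_le measure_ge0 andbT leNgt; apply/negP => X0.
have fX : mu X \is a fin_num by exact: fin_num_measure.
rewrite -(fineK fX) lte_fin in X0.
have := len (Num.bound ((fine (mu X))^-1)).
rewrite -(fineK fX) -EFinM lee_fin leNgt => /negP; apply.
rewrite -ltr_pdivrMr// div1r; apply: archi_boundP.
by rewrite invr_ge0 ltW.
Qed.

Definition cball A n x y := exists s : seq nat,
  (size s <= n)%N /\ (walk sg A s x /\ y = word sg s x).

Let measurable_cball (dU : measure_display) (U : measurableType dU) A n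
    (x y : U -> J) : measurable A -> measurable_fun setT x ->
  measurable_fun setT y -> measurable [set u | cball A n (x u) (y u)].
Proof.
move=> mA mx my; apply: measurable_Pex => s; apply: measurable_Pand.
  exact: measurable_constP.
apply: measurable_Pand.
  by apply: (@measurable_walk _ J _ msg _ U (fun=> A)) => //; exact: mrel2_cst.
apply: (measurable_eqJ mf finj) => //.
exact: measurable_fun_applied (measurable_word msg s) mx.
Qed.

(* Every vertex that is not the root of its finite component has an edge
   decreasing the distance to the root. *)
Lemma rank_le_edge_measure_finite A : measurable A -> A `<=` E -> sym_set A ->
  (forall x, finite_set (comp A x)) -> rank mu A <= eta A.
Proof.
move=> mA AE sA fA; rewrite rankE//.
have mr := measurable_roots mA AE.
rewrite -probability_setC//.
(* The edge [z] leads towards the root: some radius reaches [r] from [z.2] but not from [z.1].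
   Comparing distances through a radius keeps the condition countable. *)
pose D (z : J * J) r := fmin A z.1 r /\
  exists n, cball A n z.2 r /\ ~ cball A n z.1 r.
pose Q := [set z : J * J | A z /\ exists r, orb z.1 r /\ D z r].
have mQ : measurable Q.
  apply: measurable_Pand => //; apply: (measurable_orb_ex msg); first by mfun.
  move=> h mh; apply: measurable_Pand.
    by apply: (@measurable_fmin _ _ (fun=> A) fst h) => //; exact: mrel2_cst.
  apply: measurable_Pex => n; apply: measurable_Pand.
    by apply: measurable_cball => //; mfun.
  by apply: measurable_Pnot; apply: measurable_cball => //; mfun.
pose Qt := [set z : J * J | Q (z.2, z.1)].
have mQt : measurable Qt by apply: (measurable_preim _ mQ); mfun.
have monob n m x r : (n <= m)%N -> cball A n x r -> cball A m x r.
  by move=> nm [s [sn h]]; exists s; split => //; exact: leq_trans nm.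
have disj : Q `&` Qt = set0.
  apply/seteqP; split => -[x y] //= [[Axy [r [_ [/= xr [n [h1 h2]]]]]]].
  move=> [_ [r' [_ [/= yr' [m [h3 h4]]]]]].
  have yr := fmin_comp sA (comp_edge Axy) xr.
  move: h3 h4; rewrite -(fmin_uniq yr yr') => h3 h4.
  by have [nm|/ltnW mn] := leqP n m; [apply/h4/(monob n)|apply/h2/(monob m)].
have QA : Q `|` Qt `<=` A.
  by move=> [x y] [[]|[/= /sA]].
have : eta (Q `|` Qt) <= eta A.
  by apply: le_measure => //; rewrite inE//; exact: measurableU.
(* No edge decreases the distance in both directions, so both orientations count in full and cancel
   the factor 1/2 of the edge measure. *)
have -> : eta (Q `|` Qt) = eta Q + eta Q.
  by rewrite -[X in _ = _ + X](etaS mQ); exact: measureU.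
apply: le_trans; rewrite eE// -ge0_muleDl ?lee_fin ?invr_ge0//.
rewrite -EFinD (_ : (2%:R^-1 + 2%:R^-1 = 1 :> R)%R) ?mul1e; last first.
  by rewrite -mulr2n -[(_ *+ 2)%R]mulr_natl mulfV// pnatr_eq0.
rewrite -(setIT (~` _)) -integral_indic//; last exact: measurableC.
apply: le_integral_ge0 => x; first by rewrite lee_fin.
rewrite indicE; have [rx|nrx] := pselect (roots A x).
  by rewrite memNset//=; exact: counting_ge0.
rewrite mem_set//.
have [r xr] := fmin_ex (fA x).
have ex : exists n, `[< cball A n x r >].
  have [xr' _] := xr; have [s [ws rE]] := (comp_walk sgE x r AE).1 xr'.
  by exists (size s); apply/asboolP; exists s.
case: (ex_minnP ex) => n /asboolP[[|i s] [sn [ws rE]]] nmin.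
  by case: nrx; move: xr; rewrite rE /= => -[_ h]; split.
have [Ax ws'] := ws.
suff Qx : (Q `&` E) (x, sg i x).
  exact: (@counting_ge1 R J [set y | (Q `&` E) (x, y)] (sg i x)).
split; last exact: AE.
split => //; exists r; split; first by case: xr => /(comp_orb sgE AE).
split => //=; exists n.-1; split.
  by exists s; split => //; rewrite -ltnS (leq_trans sn)// leqSpred.
move=> h; have := nmin _ (asboolT h); rewrite leqNgt => /negP; apply.
by rewrite ltn_predL (leq_trans _ sn).
Qed.

End rank.

(** * Subgraphs with finite components *)

Lemma seq_gap_around (R : realType) (s : seq R) (r : R) : r \notin s ->
  exists q : rat * rat, ratr q.1 < r < ratr q.2 /\
    forall t, t \in s -> ~~ (ratr q.1 < t < ratr q.2).
Proof.
move=> rs.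
have [b [br Hb]] := seq_gap_below s r.
have [c [cr Hc]] := seq_gap_below (map -%R s) (- r).
have [q1] := rat_in_itvoo br; rewrite in_itv/= => /andP[bq qr].
have [q2] : exists q2 : rat, (ratr q2 \in `]r, (- c)[).
  by apply: rat_in_itvoo; rewrite ltrNr.
rewrite in_itv/= => /andP[rq qc].
exists (q1, q2); rewrite /= qr rq; split => // t ts; apply/negP => /andP[h1 h2].
have : t != r by apply: contraNneq rs => <-.
rewrite neq_lt => /orP[tr|rt].
  by have := lt_le_trans (lt_trans bq h1) (Hb _ ts tr); rewrite ltxx.
have : - t <= c by apply: Hc; rewrite ?ltrN2// map_f.
by rewrite lerNl leNgt (lt_trans h2 qc).
Qed.

Lemma finite_comp_stage (d : measure_display) (J : measurableType d)
    (A : nat -> set (J * J)) (a : J) (S : set J) :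
  (forall i j, (i <= j)%N -> A i `<=` A j) -> finite_set S ->
  S `<=` comp (\bigcup_i A i) a -> exists i, S `<=` comp (A i) a.
Proof.
move=> mA /finite_seqP[s ->]; elim: s => [_|x s IH Hs]; first by exists 0%N.
have [i Hi] : exists i, [set` s] `<=` comp (A i) a.
  by apply: IH => z /= zs; apply: Hs; rewrite /= inE zs orbT.
have [j Hj] : exists j, comp (A j) a x.
  by apply: comp_bigcup mA _; apply: Hs; rewrite /= inE eqxx.
exists (maxn i j) => z /=; rewrite inE => /predU1P[->|zs].
  by apply: sub_comp Hj; apply: mA; exact: leq_maxr.
by apply: sub_comp (Hi _ zs); apply: mA; exact: leq_maxl.
Qed.

Section exhaustion.
Context (R : realType) (d : measure_display) (J : measurableType d).
Context (mu : probability J R) (E : set (J * J)).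
Context (eta : {measure set (J * J)%type -> \bar R}).
Context (symE : sym_set E).
Context (finE : forall x, finite_set [set y | E (x, y)]).
Context (eE : is_edge_measure mu E eta).
Context (etaS : forall A, measurable A -> eta [set z | A (z.2, z.1)] = eta A).
Context (etafin : (eta setT < +oo)%E).
Context (f : J -> R) (mf : measurable_fun setT f) (finj : injective f).
Context (sg : nat -> J -> J) (msg : forall i, measurable_fun setT (sg i)).
Context (sgK : forall i, involutive (sg i)).
Context (sgP : forall i B, measurable B -> mu (sg i @^-1` B) = mu B).
Context (sgE : forall x y, E (x, y) -> exists i, y = sg i x).
Context (disp : Order.disp_t) (O : orderType disp) (key : J * J -> O).
Context (key_inj : forall x y x' y', key (x, y) = key (x', y') ->
  (x, y) = (x', y') \/ (x, y) = (y', x')).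
Context (mkey : measurable
  [set w : (J * J) * (J * J) | (key w.1 < key w.2)%O]).
Local Open Scope ereal_scope.
Local Notation orb := (orb sg).
Local Notation roots := (roots f).

Definition finite_subgraph (H A : set (J * J)) :=
  [/\ measurable A, A `<=` H, sym_set A & forall x, finite_set (comp A x)].

Section one_graph.
Context (H : set (J * J)) (mH : measurable H) (HE : H `<=` E) (sH : sym_set H).

(* A component is red if it has at most [n] vertices and meets [B]; every red
   component with an edge of [H] to the blue vertices picks the least such. *)
Let red (A : set (J * J)) (n : nat) (B : set J) : set J :=
  [set x | @counting J R (comp A x) <= n%:R%:E /\
    exists z, orb x z /\ (comp A x z /\ B z)].

Let picked (A : set (J * J)) (W : set J) : set (J * J) :=
  [set z | (H z /\ (W z.1 /\ ~ W z.2)) /\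
     forall x', orb z.1 x' -> forall y', orb z.1 y' ->
       comp A z.1 x' -> H (x', y') -> ~ W y' -> ~ (key (x', y') < key z)%O].

Let step A n B := A `|` (picked A (red A n B) `|`
  [set z | picked A (red A n B) (z.2, z.1)]).

Let measurable_red A n (B : set J) : measurable A -> A `<=` E -> measurable B ->
  measurable (red A n B).
Proof.
move=> mA AE mB; apply: measurable_Pand.
  have mc : measurable_fun setT (fun x => @counting J R (comp A x)).
    apply: (@measurable_counting R _ _ _ mf finj _ msg _ J id (fun x => comp A x)) => //.
      move=> h mh; apply: (@measurable_comp _ _ _ _ _ mf finj _ msg sgE _ J (fun=> A) id h) => //.
      exact: mrel2_cst.
    by move=> x y; exact: (comp_orb sgE AE).
  by rewrite -[X in measurable X]setTI; exact: emeasurable_fun_infty_c.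
apply: (measurable_orb_ex msg) => // h mh; apply: measurable_Pand; last by mset.
apply: (@measurable_comp _ _ _ _ _ mf finj _ msg sgE _ J (fun=> A) id h) => //.
exact: mrel2_cst.
Qed.

Let measurable_picked A W : measurable A -> A `<=` E -> measurable W ->
  measurable (picked A W).
Proof.
move=> mA AE mW; apply: measurable_Pand; first by mset.
apply: (measurable_orb_all msg); first by mfun.
move=> h mh; apply: (measurable_orb_all msg); first by mfun.
move=> k mk; apply: measurable_Pimply.
  apply: (@measurable_comp _ _ _ _ _ mf finj _ msg sgE _ _ (fun=> A) fst h) => //.
  exact: mrel2_cst.
apply: measurable_Pimply; first by mset.
apply: measurable_Pimply; first by mset.
apply: measurable_Pnot.
apply: (@measurable_preim _ _ _ _ (fun z : J * J => ((h z, k z), z)) _ _ mkey).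
by mfun.
Qed.

Let red_comp A n B x y : sym_set A -> A `<=` E -> comp A x y ->
  red A n B x -> red A n B y.
Proof.
move=> sA AE xy [cx [z [xz [cxz Bz]]]].
split; first by rewrite -(comp_eq sA xy).
exists z; rewrite -(comp_eq sA xy); split => //.
by apply: orb_trans xz; apply: (orb_sym sgK); exact: (comp_orb sgE AE).
Qed.

Let picked_uniq A n B x y x' y' : sym_set A -> A `<=` E ->
  let P := picked A (red A n B) in
  P (x, y) -> P (x', y') -> comp A x x' -> (x, y) = (x', y').
Proof.
move=> sA AE P [[Hxy [/= Wx nWy]] mn] [[Hxy' [/= Wx' nWy']] mn'] xx'.
have oxx' := comp_orb sgE AE xx'.
have ox x1 y1 : H (x1, y1) -> orb x1 y1.
  by move=> /HE /comp_edge /(comp_orb sgE (@subset_refl _ E)).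
have x'x := comp_sym sA xx'.
have h1 := mn _ oxx' _ (orb_trans oxx' (ox _ _ Hxy')) xx' Hxy' nWy'.
have h2 := mn' _ (orb_sym sgK oxx') _
  (orb_trans (orb_sym sgK oxx') (ox _ _ Hxy)) x'x Hxy nWy.
have : key (x, y) = key (x', y').
  by apply/eqP; rewrite eq_le !leNgt; apply/andP; split; apply/negP.
move=> /key_inj[//|[xy' yx']].
by case: nWy'; rewrite -xy'.
Qed.

(** Each red component gains a single picked edge, and that edge ends at a blue vertex. A new
    component is thus at most one blue component with the red components attached to it, finitely
    many because its vertices have finite degree. *)
Let step_finite A n B : finite_subgraph H A -> measurable B ->
  finite_subgraph H (step A n B).
Proof.
move=> [mA AH sA fA] mB.
have AE : A `<=` E by exact: subset_trans HE.
set W := red A n B; set P := picked A W.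
have mW : measurable W by exact: measurable_red.
have mP : measurable P by exact: measurable_picked.
have mPt : measurable [set z | P (z.2, z.1)] by apply: (measurable_preim _ mP); mfun.
have PH : P `<=` H by move=> z [[]].
have sA' : sym_set (step A n B).
  by move=> x y [/sA|[Pxy|Pxy]]; [left|right; right|right; left].
have blue y : ~ W y -> finite_set (comp (step A n B) y).
  move=> nWy.
  pose S := comp A y `|` \bigcup_(y0 in comp A y)
    \bigcup_(x0 in [set x0 | P (x0, y0)]) comp A x0.
  apply: (@sub_finite_set _ _ S).
    apply: comp_closed; first by left; exact: comp_refl.
    move=> a b [ya|[y0 yy0 [x0 /= Px0 x0a]]].
      have nWa : ~ W a by apply: contra_not nWy; apply: red_comp => //; exact: comp_sym.
      move=> [Aab|[[[_ [/= Wa]]]//|Pba]].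
        by left; exact: comp_trans (comp_edge Aab).
      right; exists a => //; exists b => //.
      exact: comp_refl.
    have Wx0 : W x0 by case: Px0 => [[_ []]].
    have Wa : W a by apply: red_comp x0a Wx0.
    move=> [Aab|[Pab|[[_ [/= _ nWa]]]//]].
      by right; exists y0 => //; exists x0 => //; exact: comp_trans (comp_edge Aab).
    by have [_ <-] := picked_uniq sA AE Px0 Pab x0a; left.
  rewrite finite_setU; split => //.
  apply: bigcup_finite => // y0 _; apply: bigcup_finite => //.
  apply: sub_finite_set (finE y0) => x0 /= /PH /HE.
  exact: symE.
split => //.
- by apply: measurableU => //; exact: measurableU.
- by move=> [x y] [/AH//|[/PH//|/PH /sH]].
move=> x; have [Wx|] := pselect (W x); last exact: blue.
have [[[x0 y0] [xx0 Pxy]]|nP] := pselect (exists z, comp A x z.1 /\ P z).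
  have nWy0 : ~ W y0 by case: Pxy => [[_ []]].
  rewrite (@comp_eq _ _ _ _ y0)//; first exact: blue.
  apply: (@comp_trans _ _ _ _ x0); last by apply: comp_edge; right; left.
  by apply: sub_comp xx0 => z; left.
apply: (@sub_finite_set _ _ (comp A x)) => //.
apply: comp_closed; first exact: comp_refl.
move=> a b xa [Aab|[Pab|[[_ [/= _ nWa]]]]].
- exact: comp_trans (comp_edge Aab).
- by case: nP; exists (a, b).
by case: nWa; exact: red_comp xa Wx.
Qed.

Let step_picks A n B a b : finite_subgraph H A -> H (a, b) ->
  red A n B a -> ~ red A n B b ->
  exists x y, [/\ comp A a x, step A n B (x, y) & ~ red A n B y].
Proof.
move=> [mA AH sA fA] Hab Wa nWb.
have AE : A `<=` E by exact: subset_trans HE.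
pose S := [set z : J * J | [/\ comp A a z.1, H z & ~ red A n B z.2]].
have fS : finite_set S.
  apply: (@sub_finite_set _ _ (\bigcup_(x in comp A a)
      (pair x @` [set y | E (x, y)]))).
    by move=> [x y] [/= ax Hxy _]; exists x => //; exists y => //; exact: HE.
  by apply: bigcup_finite => // x _; exact: finite_image.
have Sab : S (a, b) by split => //; exact: comp_refl.
have [[x y] [/= ax Hxy nWy] xymin] := finite_argmin key fS Sab.
exists x, y; split => //; right; left; split.
  by split => //; split => //; exact: red_comp ax Wa.
move=> x' _ y' _ /= xx' Hxy' nWy'; apply/negP; rewrite -leNgt.
by apply: xymin; split => //; exact: comp_trans ax xx'.
Qed.

Let code : Type := (nat * (rat * rat))%type.
(** Each code is paired with a discarded integer, so it recurs at arbitrarily late stages. *)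
Let dec (i : nat) : code :=
  if (unpickle i : option (code * nat)) is Some c then c.1 else (0%N, (0%R, 0%R)).

Let dec_cofinal (c : code) N : exists2 i, (N <= i)%N & dec i = c.
Proof.
apply: contrapT => nex.
have lt (j : nat) : (pickle ((c, j) : code * nat) < N)%N.
  rewrite ltnNge; apply/negP => Nj; apply: nex.
  by exists (pickle ((c, j) : code * nat)) => //; rewrite /dec pickleK.
have inj : injective (fun j : 'I_N.+1 => Ordinal (lt j)).
  move=> i j /(congr1 val) /= /(pcan_inj pickleK) [] /val_inj//.
by have := leq_card _ inj; rewrite !card_ord ltnn.
Qed.

Let box (q : rat * rat) : set J :=
  [set z | (ratr q.1 < f z)%R /\ (f z < ratr q.2)%R].

Let stage := fix stage i :=
  if i is j.+1 then step (stage j) (dec j).1 (box (dec j).2) else set0.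

Let stage_finite i : finite_subgraph H (stage i).
Proof.
elim: i => [|i IH] /=; last first.
  by apply: step_finite => //; rewrite /box; mset.
split => // x; apply: (@sub_finite_set _ _ [set x]) => //.
exact: comp_closed.
Qed.

Let stage_mono i j : (i <= j)%N -> stage i `<=` stage j.
Proof.
move=> /subnKC <-; elim: (j - i)%N => [|k IH]; first by rewrite addn0.
by rewrite addnS => z /IH; left.
Qed.

Let limit := \bigcup_i stage i.

Let limit_sub : limit `<=` H.
Proof. by move=> z [i _]; have [_ + _ _] := stage_finite i; apply. Qed.

Let limit_sym : sym_set limit.
Proof.
by move=> x y [i _ h]; exists i => //; have [_ _ + _] := stage_finite i; apply.
Qed.

Let measurable_limit : measurable limit.
Proof. by apply: bigcupT_measurable => i; case: (stage_finite i). Qed.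

Let stage_limit i : stage i `<=` limit. Proof. by move=> z; exists i. Qed.

(** Suppose an edge of [H] leaves a finite component of the limit from [a] to [b]. From some stage
    on the component of [a] is complete, of size [n]. At a later stage with [a] red and [b] blue,
    the step would add an edge from it to a blue vertex, which by completeness lies in the same,
    red, component. *)
Let limit_saturated x : finite_set (comp limit x) -> comp limit x = comp H x.
Proof.
move=> fx; apply/seteqP; split => y; first exact: (sub_comp limit_sub).
apply: comp_closed; first exact: comp_refl.
move=> a b xa Hab; apply: contrapT => nxb.
have Ka := comp_eq limit_sym xa.
have fa : finite_set (comp limit a) by rewrite -Ka.
have [i0 Hi0] := finite_comp_stage stage_mono fa (@subset_refl _ _).
have Ki i : (i0 <= i)%N -> comp (stage i) a = comp limit a.
  move=> ii; apply/seteqP; split => z; first exact: (sub_comp (@stage_limit i)).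
  by move=> /Hi0; apply: sub_comp; exact: stage_mono.
pose n := size (finmap.enum_fset (fset_set (comp limit a))).
have cn : @counting J R (comp limit a) = n%:R%:E by rewrite countingE.
suff [i [ii [Wa nWb]]] : exists i, (i0 <= i)%N /\
    (red (stage i) (dec i).1 (box (dec i).2) a /\
     ~ red (stage i) (dec i).1 (box (dec i).2) b).
  have [x1 [y1 [ax1 Pxy nWy]]] := step_picks (stage_finite i) Hab Wa nWb.
  have [_ AH sA _] := stage_finite i.
  apply: nWy; apply: red_comp Wa => //; first exact: subset_trans HE.
  rewrite (Ki i)//; apply: (@comp_trans _ _ _ _ x1); first by rewrite -(Ki i).
  by apply: comp_edge; exists i.+1.
have redi i (q : rat * rat) : (i0 <= i)%N -> dec i = (n, q) ->
    (ratr q.1 < f a < ratr q.2)%R ->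
    red (stage i) (dec i).1 (box (dec i).2) a.
  move=> ii -> /andP[q1 q2] /=; split; first by rewrite (Ki i)// cn.
  by exists a; split; [exists [::]|split => //; exact: comp_refl].
(* If the component of [b] is finite, a box around [f a] that avoids all its labels makes [b]
   blue. *)
have [fb|nfb] := pselect (finite_set (comp limit b)).
  have [s sE] : exists s : seq R, f @` comp limit b = [set` s].
    exact/finite_seqP/finite_image.
  have nas : f a \notin s.
    apply/negP => fas; have : [set` s] (f a) by [].
    rewrite -sE => -[z bz /finj za]; apply: nxb; apply: comp_trans xa _.
    by apply: (comp_sym limit_sym); rewrite -za.
  have [q [qa qs]] := seq_gap_around nas.
  have [i ii iE] := dec_cofinal (n, q) i0.
  exists i; split => //; split; first exact: redi iE qa.
  rewrite iE => -[_ [z [_ [bz [/= z1 z2]]]]].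
  have : [set` s] (f z).
    by rewrite -sE; exists z => //; exact: sub_comp (@stage_limit i) bz.
  by move=> /qs; rewrite z1 z2.
(* An infinite component exceeds the size [n] at some stage, which makes [b] blue whatever the
   box. *)
have [Y [Yb fY nY]] : exists Y : set J, [/\ Y `<=` comp limit b, finite_set Y &
    n%:R%:E < @counting J R Y].
  have [X Xb nX] := infinite_set_fset n.+1 nfb.
  eexists; split; [exact: Xb|exact: finite_fset|].
  rewrite countingE; last exact: finite_fset.
  by rewrite set_fsetK lte_fin ltr_nat.
have [i1 Hi1] := finite_comp_stage stage_mono fY Yb.
have nas : f a \notin [::] by [].
have [q [qa _]] := seq_gap_around nas.
have [i ii iE] := dec_cofinal (n, q) (maxn i0 i1).
move: ii; rewrite geq_max => /andP[ii0 ii1].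
exists i; split => //; split; first exact: redi iE qa.
rewrite iE => -[/= cb _].
have : @counting J R Y <= n%:R%:E.
  apply: le_trans cb; apply: le_counting => z /Hi1.
  by apply: sub_comp; exact: stage_mono.
by rewrite leNgt nY.
Qed.

(** A vertex that is a root at every stage is a root of [H], by saturation, or the least vertex of
    an infinite component of the limit, which is a null event. Continuity from above then makes the
    roots of a late stage almost as few as those of [H]. *)
Lemma finite_subgraph_rank (eps : R) : (0 < eps)%R ->
  exists2 A, finite_subgraph H A & rank mu H <= rank mu A + eps%:E.
Proof.
move=> e0.
have AE i : stage i `<=` E.
  by have [_ AH _ _] := stage_finite i; exact: subset_trans HE.
have mr i : measurable (roots (stage i)).
  have [mA _ _ _] := stage_finite i.
  by apply: (measurable_roots mf finj msg sgE) => //; exact: AE.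
have mrH : measurable (roots H) by apply: (measurable_roots mf finj msg sgE).
have mcap : measurable (\bigcap_i roots (stage i)) by exact: bigcapT_measurable.
have LE : limit `<=` E by exact: subset_trans HE.
pose X := [set r | ~ finite_set (comp limit r) /\ fmin f limit r r].
have X0 : mu X = 0.
  by apply: (infinite_comp_fmin_null mf finj msg sgK sgP sgE).
have mX : measurable X.
  apply: measurable_Pand.
    apply: measurable_Pnot.
    by apply: (@measurable_finite_comp _ _ _ _ _ mf finj _ msg sgE _ J (fun=> limit) id) => //; exact: mrel2_cst.
  by apply: (@measurable_fmin _ _ _ _ _ mf finj _ msg sgE _ J (fun=> limit) id id) => //; exact: mrel2_cst.
have capE : \bigcap_i roots (stage i) `<=` roots H `|` X.
  move=> r Hr.
  have rmin z : comp limit r z -> (f r <= f z)%R.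
    by move=> /(comp_bigcup stage_mono)[i rz]; have [_] := Hr i I; apply.
  have [fr|nfr] := pselect (finite_set (comp limit r)).
    by left; split; rewrite -(limit_saturated fr).
  by right; split => //; split => //; exact: comp_refl.
have cap_le : mu (\bigcap_i roots (stage i)) <= mu (roots H).
  rewrite -[leRHS]adde0 -X0.
  apply: (@le_trans _ _ (mu (roots H `|` X))); last exact: measureU2.
  by apply: le_measure => //; rewrite inE//; exact: measurableU.
have cv : (mu \o (fun i => roots (stage i))) i @[i --> \oo] -->
    mu (\bigcap_i roots (stage i)).
  apply: nonincreasing_cvg_mu => //.
    by apply: le_lt_trans (probability_le1 _ _) _; rewrite ?ltry.
  by move=> i j ij; apply/subsetPset/sub_roots/stage_mono.
have fin (Y : set J) : measurable Y -> mu Y \is a fin_num by exact: fin_num_measure.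
have [i lti] : exists i, mu (roots (stage i)) < mu (roots H) + eps%:E.
  have lt : mu (\bigcap_i roots (stage i)) < mu (roots H) + eps%:E.
    apply: le_lt_trans cap_le _.
    by rewrite -[ltLHS]adde0 lteD2lE ?fin// lte_fin.
  have : \forall i \near \oo, mu (roots (stage i)) < mu (roots H) + eps%:E.
    exact: (cv _ (open_ereal_lt' lt)).
  by move=> [N _ HN]; exists N; apply: HN => /=.
exists (stage i) => //.
have [mA AH sA fA] := stage_finite i.
rewrite (rankE mf finj msg sgK sgP sgE)// (rankE mf finj msg sgK sgP sgE)//.
rewrite -(fineK (fin _ mrH)) -(fineK (fin _ (mr i))) in lti *.
rewrite -EFinD lte_fin in lti.
rewrite -!EFinB -EFinD lee_fin -addrA lerD2l.
by rewrite lerNl opprD opprK lerBlDr ltW.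
Qed.

End one_graph.

Lemma rank_le_edge_measure H : measurable H -> H `<=` E -> sym_set H ->
  rank mu H <= eta H.
Proof.
move=> mH HE sH; apply/lee_addgt0Pr => e e0.
have [A [mA AH sA fA]] := finite_subgraph_rank mH HE sH e0.
move=> /le_trans; apply; rewrite leeD2r//.
apply: (@le_trans _ _ (eta A)); last by apply: le_measure; rewrite ?inE.
apply: (rank_le_edge_measure_finite eE etaS mf finj msg sgK sgP sgE) => //.
exact: subset_trans HE.
Qed.

(** For [A] almost of full rank in [H], the removed edges have measure [eta H - eta A], at most
    [rank H - rank A] because [rank A <= eta A]. *)
Lemma edge_measure_le_rank_hyperfinite H : measurable H -> H `<=` E ->
  sym_set H -> eta H <= rank mu H -> hyperfinite eta H.
Proof.
move=> mH HE sH le eps e0.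
have [A [mA AH sA fA] rA] := finite_subgraph_rank mH HE sH e0.
have AE : A `<=` E by exact: subset_trans HE.
exists (H `\` A); split => //.
- exact: measurableD.
- by move=> x y [Hxy nA]; split; [exact: sH|move=> /sA].
- have fineta (B : set (J * J)) : measurable B -> eta B \is a fin_num.
    move=> mB; rewrite ge0_fin_numE//; apply: le_lt_trans etafin.
    by apply: le_measure; rewrite ?inE.
  rewrite measureD//; last by rewrite -ge0_fin_numE// fineta.
  rewrite (setIidr AH) leeBlDl ?fineta//.
  apply: le_trans le _; apply: le_trans rA _; rewrite leeD2r//.
  exact: (rank_le_edge_measure_finite eE etaS mf finj msg sgK sgP sgE).
- by move=> x; rewrite setDD (setIidr AH); exact: fA.
Qed.

End exhaustion.

(** * The wired maximal spanning forest *)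

Lemma le_counting_inj (R : realType) (S T : choiceType) (A : set S) (B : set T)
    (h : S -> T) : {in A &, injective h} -> h @` A `<=` B ->
  (@counting S R A <= @counting T R B)%E.
Proof.
move=> hinj AB; rewrite -(card_eq_counting R (inj_card_eq hinj)).
exact: le_counting.
Qed.

Lemma comp_fpath (d : measure_display) (J : measurableType d) (G : set (J * J))
    (g : J -> J) (v : J) (p : seq J) : fpath g v p ->
  (forall a, a \in belast v p -> G (a, g a)) -> comp G v (last v p).
Proof.
elim: p v => [v _ _|w p IH v /= /andP[/eqP <- wp] Hp]; first exact: comp_refl.
apply: (@comp_trans _ _ _ _ (g v)).
  by apply: comp_edge; apply: Hp; rewrite inE eqxx.
by apply: IH => // a ap; apply: Hp; rewrite inE ap orbT.
Qed.

Section maximal_spanning_forest.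
Context (R : realType) (d : measure_display) (J : measurableType d).
Context (mu : probability J R) (E : set (J * J)).
Context (eta : {measure set (J * J)%type -> \bar R}).
Context (symE : sym_set E).
Context (finE : forall x, finite_set [set y | E (x, y)]).
Context (eE : is_edge_measure mu E eta).
Context (etaS : forall A, measurable A -> eta [set z | A (z.2, z.1)] = eta A).
Context (etafin : (eta setT < +oo)%E).
Context (f : J -> R) (mf : measurable_fun setT f) (finj : injective f).
Context (sg : nat -> J -> J) (msg : forall i, measurable_fun setT (sg i)).
Context (sgK : forall i, involutive (sg i)).
Context (sgP : forall i B, measurable B -> mu (sg i @^-1` B) = mu B).
Context (sgE : forall x y, E (x, y) -> exists i, y = sg i x).
Context (disp : Order.disp_t) (O : orderType disp) (key : J * J -> O).
Context (key_sym : forall x y, key (x, y) = key (y, x)).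
Context (key_inj : forall x y x' y', key (x, y) = key (x', y') ->
  (x, y) = (x', y') \/ (x, y) = (y', x')).
Context (mkey : measurable
  [set w : (J * J) * (J * J) | (key w.1 < key w.2)%O]).
Local Open Scope ereal_scope.
Local Notation orb := (orb sg).
Local Notation roots := (roots f).
Local Notation fmin := (fmin f).
Implicit Types (H A U : set (J * J)) (e : J * J).

Definition above H e : set (J * J) := [set z | H z /\ (key e < key z)%O].

Definition msf H : set (J * J) := [set e | H e /\
  (~ comp (above H e) e.1 e.2 /\
   (finite_set (comp (above H e) e.1) \/ finite_set (comp (above H e) e.2)))].

Lemma msf_sub H : msf H `<=` H. Proof. by move=> e []. Qed.

Lemma sym_above H e : sym_set H -> sym_set (above H e).
Proof. by move=> sH x y [Hxy lt]; split; [exact: sH|rewrite key_sym]. Qed.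

Lemma above_swap H x y : above H (x, y) = above H (y, x).
Proof. by rewrite /above key_sym. Qed.

Lemma sym_msf H : sym_set H -> sym_set (msf H).
Proof.
move=> sH x y [Hxy [/= nc fin]]; split; first exact: sH.
rewrite /= above_swap; split; last by case: fin; [right|left].
by apply: contra_not nc; apply: comp_sym; exact: sym_above.
Qed.

Lemma above_sub H e : above H e `<=` H. Proof. by move=> z []. Qed.

Lemma mrel2_above H : measurable H -> mrel2 (above H).
Proof.
move=> mH a b ma mb; apply: measurable_Pand.
  by apply: (measurable_preim _ mH); mfun.
by apply: (@measurable_preim _ _ _ _ (fun u : J * J => (u, (a u, b u))) _ _ mkey); mfun.
Qed.

Let mfst : measurable_fun setT (@fst J J). Proof. by mfun. Qed.
Let msnd : measurable_fun setT (@snd J J). Proof. by mfun. Qed.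

Let finite_above H (x : J * J -> J) : measurable H -> H `<=` E ->
  measurable_fun setT x ->
  measurable [set e | finite_set (comp (above H e) (x e))].
Proof.
move=> mH HE mx; apply: (@measurable_finite_comp _ _ _ _ _ mf finj _ msg sgE) => //.
  exact: mrel2_above.
by move=> e; exact: subset_trans (@above_sub H e) HE.
Qed.

Let fmin_above H (x r : J * J -> J) : measurable H -> H `<=` E ->
  measurable_fun setT x -> measurable_fun setT r ->
  measurable [set e | fmin (above H e) (x e) (r e)].
Proof.
move=> mH HE mx mr; apply: (@measurable_fmin _ _ _ _ _ mf finj _ msg sgE) => //.
  exact: mrel2_above.
by move=> e; exact: subset_trans (@above_sub H e) HE.
Qed.

Lemma measurable_msf H : measurable H -> H `<=` E -> measurable (msf H).
Proof.
move=> mH HE; apply: measurable_Pand => //; apply: measurable_Pand.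
  apply: measurable_Pnot.
  apply: (@measurable_comp _ _ _ _ _ mf finj _ msg sgE) => //.
    exact: mrel2_above.
  by move=> e; exact: subset_trans (@above_sub H e) HE.
by apply: measurable_Por; exact: finite_above.
Qed.

(* The least edge of a cycle has its ends joined by the rest of the cycle. *)
Lemma msf_acyclic H : sym_set H -> acyclic (msf H).
Proof.
move=> sH [x [s [sz us ps cs]]].
pose c := x :: s.
have cyc : cycle (edge_rel (msf H)) c.
  by rewrite /= rcons_path ps.
have [u uc umin] := @finite_argmin _ _ _ [set` c]
  (fun u => key (u, next c u)) x (finite_seq _) (mem_head _ _).
have [i s' cE] := rot_to uc.
have us' : uniq (u :: s') by rewrite -cE rot_uniq.
have cyc' : cycle (edge_rel (msf H)) (u :: s') by rewrite -cE rot_cycle.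
have umin' z : z \in u :: s' ->
    (key (u, next (u :: s') u) <= key (z, next (u :: s') z))%O.
  by move=> zc; rewrite -cE !next_rot//; apply: umin; rewrite /= -(mem_rot i) cE.
have sz' : (2 <= size s')%N.
  by have := congr1 size cE; rewrite size_rot /c /= => -[<-].
case: s' cE us' cyc' umin' sz' => [//|v [//|t s']] cE us' cyc' umin' _.
set c' := [:: u, v, t & s'] in cE us' cyc' umin'.
have fc : fcycle (next c') c' by exact: cycle_next.
have next_u : next c' u = v by rewrite /= eqxx.
have vu : v != u.
  by move: us' => /= /andP[+ _]; rewrite !inE !negb_or eq_sym => /andP[].
have next_v : next c' v = t by rewrite /= (negbTE vu) eqxx.
have tu : t != u.
  by move: us' => /= /andP[+ _]; rewrite !inE !negb_or => /and3P[_ + _]; rewrite eq_sym.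
have Fuv : msf H (u, v).
  have : edge_rel (msf H) u (next c' u) by apply: next_cycle => //; rewrite inE eqxx.
  by rewrite next_u => /asboolP.
case: (Fuv) => _ [/= nc _]; apply: nc.
apply: (@comp_sym _ _ (above H (u, v)) v u); first exact: sym_above.
rewrite -[X in comp _ _ X](last_rcons v (t :: s') u).
apply: (@comp_fpath _ _ _ (next c')).
  by move: fc; rewrite /c' /= => /andP[_].
rewrite belast_rcons => a ac.
have ac' : a \in c' by rewrite inE ac orbT.
have Fa : msf H (a, next c' a).
  by have /asboolP : edge_rel (msf H) a (next c' a) by exact: next_cycle.
split; first exact: msf_sub.
(* Equal keys mean the same unordered edge. The same orientation contradicts uniqueness of vertices,
   and the reversed one would make [u] the successor of [v], impossible in a cycle of length at
   least 3. *)
rewrite lt_neqAle -{2}next_u umin'// andbT; apply/eqP => /key_inj[[ua _]|[una va]].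
  by move: us'; rewrite /c' cons_uniq ua ac.
by move/eqP: tu; apply; rewrite -next_v va; exact: esym una.
Qed.

(** Take the heaviest edge [(a, b)] of [U] leaving the finite component [T]. Heavier edges of [H]
    belong to [U] and hence do not leave [T], so [a] has a finite component above [(a, b)] that
    misses [b]. Then [(a, b)] is in the forest, a contradiction. *)
Lemma msf_comp H U x : H `<=` E -> U `<=` H ->
  (forall e e', U e -> H e' -> (key e < key e')%O -> U e') ->
  finite_set (comp (msf H `&` U) x) -> comp (msf H `&` U) x = comp U x.
Proof.
move=> HE UH up fx; apply/seteqP; split => y; first by apply: sub_comp => z [].
apply: comp_closed; first exact: comp_refl.
set T := comp (msf H `&` U) x => a0 b0 Ta0 Uab0; apply: contrapT => nTb0.
pose S := [set z : J * J | [/\ T z.1, U z & ~ T z.2]].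
have fS : finite_set S.
  apply: (@sub_finite_set _ _ (\bigcup_(a in T) (pair a @` [set y | E (a, y)]))).
    by move=> [a b] [/= Ta Uab _]; exists a => //; exists b => //; exact/HE/UH.
  by apply: bigcup_finite => // a _; exact: finite_image.
have [[a b] [/= Ta Uab nTb] abmax] :=
  @finite_argmin _ (Order.dual O) _ S key (a0, b0) fS (And3 Ta0 Uab0 nTb0).
have compT : comp (above H (a, b)) a `<=` T.
  apply: comp_closed => // c c' Tc [Hc lt]; apply: contrapT => nTc'.
  have Uc : U (c, c') by exact: up Uab Hc lt.
  by have := abmax (c, c') (And3 Tc Uc nTc'); rewrite leEdual leNgt lt.
apply: (nTb); apply: comp_trans Ta _; apply: comp_edge; split => //.
split; first exact: UH.
split; first by move=> /= /compT /nTb.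
by left; exact: sub_finite_set fx.
Qed.

(** The orientation of a forest edge in which [e.1] is on the losing side: its root disappears
    because the other side is infinite or has a smaller least label. *)
Let kill H : set (J * J) := [set e | msf H e /\
  (finite_set (comp (above H e) e.1) /\
   (~ finite_set (comp (above H e) e.2) \/
    exists r1, orb e.1 r1 /\ exists r2, orb e.2 r2 /\
      (fmin (above H e) e.1 r1 /\ (fmin (above H e) e.2 r2 /\ (f r2 < f r1)%R))))].

Let measurable_kill H : measurable H -> H `<=` E -> measurable (kill H).
Proof.
move=> mH HE; apply: measurable_Pand; first exact: measurable_msf.
apply: measurable_Pand; first exact: finite_above.
apply: measurable_Por; first by apply: measurable_Pnot; exact: finite_above.
apply: (measurable_orb_ex msg) => // r1 mr1.
apply: (measurable_orb_ex msg) => // r2 mr2.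
apply: measurable_Pand; first exact: fmin_above.
apply: measurable_Pand; first exact: fmin_above.
by apply: measurable_lt_set; mfun.
Qed.

Let msf_kill H x y : sym_set H -> H `<=` E -> msf H (x, y) ->
  kill H (x, y) \/ kill H (y, x).
Proof.
move=> sH HE Fxy; have Fyx := sym_msf sH Fxy.
have sA := sym_above (e := (x, y)) sH.
have AE : above H (x, y) `<=` E by exact: subset_trans (@above_sub _ _) HE.
have [_ [/= nc fin]] := Fxy.
have [fx|nfx] := pselect (finite_set (comp (above H (x, y)) x)); last first.
  case: fin => // fy; right; split => //=; rewrite above_swap; split => //.
  by left.
have [fy|nfy] := pselect (finite_set (comp (above H (x, y)) y)); last first.
  by left; split => //; split => //; left.
have [r1 xr1] := fmin_ex f fx; have [r2 yr2] := fmin_ex f fy.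
have o1 : orb x r1 by case: xr1 => /(comp_orb sgE AE).
have o2 : orb y r2 by case: yr2 => /(comp_orb sgE AE).
have : f r1 != f r2.
  apply/eqP => /finj r12; apply: nc.
  have [xr _] := xr1; have [yr _] := yr2.
  by apply: comp_trans xr _; rewrite r12; exact: comp_sym.
rewrite neq_lt => /orP[lt|lt].
  right; split => //=; rewrite above_swap; split => //; right.
  by exists r2; split => //; exists r1; split.
left; split => //=; split => //; right.
by exists r1; split => //; exists r2; split.
Qed.

(** If a lighter edge, inserted later, were charged to the same [v], the component of [x'] would by
    then contain [v], both ends of [(x, y)] and the whole side of [y]. That side is infinite or has
    a label below that of [v], whereas the side of [x'] is finite with least vertex [v]. *)
Let kill_le H x y x' y' v : sym_set H ->
  kill H (x, y) -> fmin (above H (x, y)) x v ->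
  kill H (x', y') -> fmin (above H (x', y')) x' v ->
  ~ (key (x', y') < key (x, y))%O.
Proof.
move=> sH [Fe [fx alt]] xv [Fe' [/= fx' _]] x'v lt.
have sub : above H (x, y) `<=` above H (x', y').
  by move=> z [Hz lt']; split => //; exact: lt_trans lt'.
have sA' := sym_above (e := (x', y')) sH.
have x'y : comp (above H (x', y')) x' y.
  apply: (@comp_trans _ _ _ _ x); last first.
    by apply: comp_edge; split => //; exact: msf_sub.
  apply: (@comp_trans _ _ _ _ v); first by case: x'v.
  by apply: (comp_sym sA'); apply: (sub_comp sub); case: xv.
have yx' : comp (above H (x, y)) y `<=` comp (above H (x', y')) x'.
  by move=> z /(sub_comp sub); exact: comp_trans.
case: alt => [|[r1 [_ [r2 [_ [xr1 [yr2 lt12]]]]]]].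
  by apply; exact: sub_finite_set fx'.
have [yr _] := yr2; have [_ vmin] := x'v.
have := vmin _ (yx' _ yr); rewrite (fmin_uniq finj xv xr1).
by rewrite leNgt lt12.
Qed.

(** Equal keys leave the reversed edge as the only alternative; it would connect both ends to [v] by
    heavier edges, against membership in the forest. *)
Let kill_uniq H x y x' y' v : sym_set H ->
  kill H (x, y) -> fmin (above H (x, y)) x v ->
  kill H (x', y') -> fmin (above H (x', y')) x' v -> (x, y) = (x', y').
Proof.
move=> sH k m k' m'.
have : key (x, y) = key (x', y').
  apply/eqP; rewrite eq_le !leNgt; apply/andP; split; apply/negP.
    exact: (kill_le sH k m k' m').
  exact: (kill_le sH k' m' k m).
move=> /key_inj[//|[xy' yx']]; exfalso.
move: m'; rewrite above_swap -xy' -yx' => -[yv _].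
have [[_ [/= nc _]] _] := k; apply: nc; have [xv _] := m.
by apply: comp_trans xv _; apply: comp_sym yv; exact: sym_above.
Qed.

(** In [H] the component of [v] contains the other side of the edge, which is infinite or has a
    smaller label. *)
Let kill_root H x y v : sym_set H ->
  kill H (x, y) -> fmin (above H (x, y)) x v -> ~ roots H v.
Proof.
move=> sH [Fe [_ alt]] xv [fv vmin].
have sub := @above_sub H (x, y).
have vy : comp H v y.
  apply: (@comp_trans _ _ _ _ x); last by apply: comp_edge; exact: msf_sub.
  by apply: (comp_sym sH); apply: (sub_comp sub); case: xv.
have yv : comp (above H (x, y)) y `<=` comp H v.
  by move=> z /(sub_comp sub); exact: comp_trans.
case: alt => [|[r1 [_ [r2 [_ [xr1 [yr2 lt12]]]]]]].
  by apply; exact: sub_finite_set fv.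
have [yr _] := yr2; have := vmin _ (yv _ yr).
by rewrite (fmin_uniq finj xv xr1) leNgt lt12.
Qed.

(* An edge of the forest, when inserted in decreasing order of keys, merges two
   components, one of them finite; it is charged to the root that disappears. *)
Lemma msf_edge_measure_le H : measurable H -> H `<=` E -> sym_set H ->
  eta (msf H) <= rank mu H.
Proof.
move=> mH HE sH; have mk := measurable_kill mH HE.
have mF := measurable_msf mH HE.
have mkt : measurable [set z | kill H (z.2, z.1)].
  by apply: (measurable_preim _ mk); mfun.
have h1 : eta (msf H) <= eta (kill H) + eta (kill H).
  rewrite -[X in _ + X](etaS mk).
  apply: (@le_trans _ _ (eta (kill H `|` [set z | kill H (z.2, z.1)]))); last first.
    exact: measureU2.
  apply: le_measure; rewrite ?inE//; first exact: measurableU.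
  by move=> [x y] /(msf_kill sH HE).
apply: le_trans h1 _; rewrite eE// -ge0_muleDl ?lee_fin ?invr_ge0//.
rewrite -EFinD (_ : (2%:R^-1 + 2%:R^-1 = 1 :> R)%R) ?mul1e; last first.
  by rewrite -mulr2n -[(_ *+ 2)%R]mulr_natl mulfV// pnatr_eq0.
pose Q := [set z : J * J | exists y, orb z.1 y /\
  (kill H (z.1, y) /\ fmin (above H (z.1, y)) z.1 z.2)].
have mQ : measurable Q.
  apply: (measurable_orb_ex msg) => // h mh; apply: measurable_Pand.
    by apply: (measurable_preim _ mk); mfun.
  apply: (@measurable_fmin _ _ _ _ _ mf finj _ msg sgE _ _
    (fun z : J * J => above H (z.1, h z)) fst snd) => //.
    move=> a b ma mb; apply: measurable_Pand.
      by apply: (measurable_preim _ mH); mfun.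
    by apply: (@measurable_preim _ _ _ _
      (fun u : J * J => ((u.1, h u), (a u, b u))) _ _ mkey); mfun.
  by move=> z; exact: subset_trans (@above_sub _ _) HE.
have QE x v : Q (x, v) -> orb x v.
  move=> [y [_ [_ [/= xv _]]]]; apply: (comp_orb sgE _ xv).
  exact: subset_trans (@above_sub _ _) HE.
apply: (@le_trans _ _ (\int[mu]_x deg R Q x)).
  apply: le_integral_ge0 => x; first exact: counting_ge0.
  have /choice[h hP] : forall y, exists v, kill H (x, y) -> fmin (above H (x, y)) x v.
    move=> y; have [k|nk] := pselect (kill H (x, y)); last by exists x.
    by have [_ [/= /(fmin_ex f)[v xv] _]] := k; exists v.
  (* Different edges at [x] are charged to different roots, so the degree in [kill H] is at most
     that in [Q]. *)
  apply: (@le_counting_inj _ _ _ _ _ h).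
    move=> y y' /set_mem[/= k _] /set_mem[/= k' _] hh.
    have m' := hP _ k'; rewrite -hh in m'.
    by have [] := kill_uniq sH k (hP _ k) k' m'.
  move=> _ [y [/= k Exy] <-]; exists y; split; last by split => //; exact: hP.
  exact: (comp_orb sgE (@subset_refl _ E) (comp_edge Exy)).
rewrite (mass_transport mf finj msg sgK sgP mQ QE).
rewrite (rankE mf finj msg sgK sgP sgE)//.
have mr : measurable (roots H) by exact: (measurable_roots mf finj msg sgE).
rewrite -probability_setC// -(setIT (~` _)) -integral_indic//; last exact: measurableC.
apply: le_integral_ge0 => v; first exact: counting_ge0.
(* The mass arriving at [v] is at most 1 by [kill_uniq], and 0 at roots of [H] by [kill_root]. *)
have [[x0 [y0 [_ [k0 m0]]]]|nex] := pselect (exists x, Q (x, v)).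
  rewrite indicE mem_set; last exact: kill_root k0 m0.
  rewrite -(counting_set1 R x0); apply: le_counting => x [y [_ [k m]]].
  by have [] := kill_uniq sH k m k0 m0.
rewrite /deg (_ : mkset _ = set0) ?counting_set0 ?lee_fin//.
by apply/seteqP; split => x //= Qx; apply: nex; exists x.
Qed.

Lemma le_rank A B : measurable A -> measurable B -> A `<=` E -> B `<=` E ->
  sym_set A -> sym_set B -> roots B `<=` roots A -> rank mu A <= rank mu B.
Proof.
move=> mA mB AE BE sA sB BA.
rewrite !(rankE mf finj msg sgK sgP sgE)//; apply: leeB => //.
by apply: le_measure => //; rewrite inE; exact: (measurable_roots mf finj msg sgE).
Qed.

Lemma msf_rank H U : measurable H -> measurable U -> H `<=` E -> U `<=` H ->
  sym_set H -> sym_set U ->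
  (forall e e', U e -> H e' -> (key e < key e')%O -> U e') ->
  rank mu U <= rank mu (msf H `&` U).
Proof.
move=> mH mU HE UH sH sU up; apply: le_rank => //.
- by apply: measurableI => //; exact: measurable_msf.
- exact: subset_trans HE.
- by apply: subset_trans HE => z [_ /UH].
- by move=> x y [/(sym_msf sH) ? /sU].
move=> r [fr rmin]; have e := msf_comp HE UH up fr.
by split; rewrite -e.
Qed.

(** [eta (msf H) <= rank H <= rank (msf H)], the second inequality being [msf_rank] for [U = H];
    this is the criterion for hyperfiniteness. *)
Lemma msf_hyperfinite H : measurable H -> H `<=` E -> sym_set H ->
  hyperfinite eta (msf H).
Proof.
move=> mH HE sH.
apply: (edge_measure_le_rank_hyperfinite symE finE eE etaS etafin mf finj msg
  sgK sgP sgE key_inj mkey).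
- exact: measurable_msf.
- exact: subset_trans (@msf_sub H) HE.
- exact: sym_msf.
apply: le_trans (msf_edge_measure_le mH HE sH) _.
have := @msf_rank H H mH mH HE (@subset_refl _ _) sH sH (fun _ _ _ h _ => h).
by rewrite (setIidl (@msf_sub H)).
Qed.

(** Such an [A] equals [msf A]: its edges are not spanned by heavier edges of [H], let alone of [A],
    and the finiteness clause is automatic. *)
Lemma finite_sub_msf_edge_measure H A : A `<=` msf H -> measurable A ->
  H `<=` E -> sym_set A -> (forall x, finite_set (comp A x)) ->
  eta A <= rank mu A.
Proof.
move=> AF mA HE sA fA.
have AH : A `<=` H by exact: subset_trans (@msf_sub H).
have AE : A `<=` E by exact: subset_trans HE.
rewrite (_ : eta A = eta (msf A)); first exact: msf_edge_measure_le.
congr (eta _); apply/seteqP; split => [e Ae|]; last exact: msf_sub.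
have [_ [nc _]] := AF _ Ae.
split => //; split; last first.
  by left; apply: sub_finite_set (fA e.1) => z; apply: sub_comp; exact: above_sub.
by apply: contra_not nc; apply: sub_comp => z [Az lt]; split => //; exact: AH.
Qed.

(** Removing a set of measure at most [eps] leaves finite components, where the previous lemma
    applies; rank is monotone. *)
Lemma msf_edge_measure_le_rank H A : measurable H -> H `<=` E -> sym_set H ->
  measurable A -> A `<=` E -> sym_set A -> eta (msf H `&` A) <= rank mu A.
Proof.
move=> mH HE sH mA AE sA; apply/lee_addgt0Pr => eps e0.
have [S [mS SF sS leS fS]] := msf_hyperfinite mH HE sH e0.
have mF := measurable_msf mH HE.
have mFA : measurable (msf H `&` A) by exact: measurableI.
set B := (msf H `&` A) `\` S.
have mB : measurable B by exact: measurableD.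
have sB : sym_set B.
  by move=> x y [[/(sym_msf sH) ? /sA ?] nS]; split => //; move=> /sS.
have BF : B `<=` msf H by move=> z [[]].
have BA : B `<=` A by move=> z [[]].
apply: (@le_trans _ _ (eta (B `|` S))).
  apply: le_measure; rewrite ?inE//; first exact: measurableU.
  by move=> z FAz; have [Sz|nSz] := pselect (S z); [right|left].
apply: le_trans (measureU2 _ mB mS) _; apply: leeD => //.
apply: (@le_trans _ _ (rank mu B)).
  apply: (finite_sub_msf_edge_measure BF) => // x.
  apply: sub_finite_set (fS x) => z; apply: sub_comp => w [[Fw _] nS].
  by split.
apply: le_rank => //; first exact: subset_trans AE.
exact: sub_roots.
Qed.

End maximal_spanning_forest.

(** * The greedy forest of a weighted graphing *)

Section greedy_forest.
Context (R : realType) (d : measure_display) (J : measurableType d).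
Context (mu : probability J R) (E : set (J * J)).
Context (eta : {measure set (J * J)%type -> \bar R}).
Context (sb : standard_borel J R) (gE : graphing mu E).
Context (eE : is_edge_measure mu E eta).
Local Open Scope ereal_scope.

Section lexicographic_key.
Context (f : J -> R) (mf : measurable_fun setT f) (finj : injective f).
Context (fim : forall A : set J, measurable A -> measurable (f @` A)).
Context (w : J * J -> R) (mw : measurable_fun setT w) (sw : sym_fun w).

(* Ties between weights are broken by the labels of the ends. *)
Let key (z : J * J) : R *l (R *l R) :=
  (w z, (Num.max (f z.1) (f z.2), Num.min (f z.1) (f z.2))).

Let keyE z z' : (key z < key z')%O <-> (w z <= w z')%R /\
  ((w z' <= w z)%R ->
   (Num.max (f z.1) (f z.2) <= Num.max (f z'.1) (f z'.2))%R /\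
   ((Num.max (f z'.1) (f z'.2) <= Num.max (f z.1) (f z.2))%R ->
    (Num.min (f z.1) (f z.2) < Num.min (f z'.1) (f z'.2))%R)).
Proof.
rewrite !ltEprodlexi /=; split.
  move=> /andP[-> /implyP h]; split => // /h /andP[-> /implyP h']; split => //.
move=> [-> h]; apply/implyP => /h[-> h']; exact/implyP.
Qed.

Let key_weight z z' : (key z < key z')%O -> (w z <= w z')%R.
Proof. by move=> /keyE[]. Qed.

Let key_sym x y : key (x, y) = key (y, x).
Proof. by rewrite /key sw /= maxC minC. Qed.

Let key_inj x y x' y' : key (x, y) = key (x', y') ->
  (x, y) = (x', y') \/ (x, y) = (y', x').
Proof.
move=> [_]; case: (leP (f x) (f y)) => _; case: (leP (f x') (f y')) => _.
- by move=> /finj -> /finj ->; left.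
- by move=> /finj -> /finj ->; right.
- by move=> /finj -> /finj ->; right.
- by move=> /finj -> /finj ->; left.
Qed.

Let mkey : measurable [set z : (J * J) * (J * J) | (key z.1 < key z.2)%O].
Proof.
have mmax (h : (J * J) * (J * J) -> J * J) : measurable_fun setT h ->
    measurable_fun setT (fun z => Num.max (f (h z).1) (f (h z).2)).
  by move=> mh; apply: measurable_maxr; mfun.
have mmin (h : (J * J) * (J * J) -> J * J) : measurable_fun setT h ->
    measurable_fun setT (fun z => Num.min (f (h z).1) (f (h z).2)).
  by move=> mh; apply: measurable_minr; mfun.
have m1 : measurable_fun setT (fun z : (J * J) * (J * J) => z.1) by mfun.
have m2 : measurable_fun setT (fun z : (J * J) * (J * J) => z.2) by mfun.
rewrite (_ : mkset _ = [set z : (J * J) * (J * J) | (w z.1 <= w z.2)%R /\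
  ((w z.2 <= w z.1)%R ->
   (Num.max (f z.1.1) (f z.1.2) <= Num.max (f z.2.1) (f z.2.2))%R /\
   ((Num.max (f z.2.1) (f z.2.2) <= Num.max (f z.1.1) (f z.1.2))%R ->
    (Num.min (f z.1.1) (f z.1.2) < Num.min (f z.2.1) (f z.2.2))%R))]).
  apply: measurable_Pand; first by apply: measurable_le_comp; mfun.
  apply: measurable_Pimply; first by apply: measurable_le_comp; mfun.
  apply: measurable_Pand.
    by apply: measurable_le_comp; [exact: (mmax _ m1)|exact: (mmax _ m2)].
  apply: measurable_Pimply.
    by apply: measurable_le_comp; [exact: (mmax _ m2)|exact: (mmax _ m1)].
  by apply: measurable_lt_set; [exact: (mmin _ m1)|exact: (mmin _ m2)].
by apply/seteqP; split => z /= /keyE.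
Qed.

Lemma inv_card_ge0 (S : set J) : 0 <= inv_card R S.
Proof.
rewrite /inv_card; have := counting_ge0 R S; case: counting => // r.
by rewrite !lee_fin invr_ge0.
Qed.

(** The results on rank and forests ask that every edge be realised by a generating involution.
    Deleting the edges at the invariant null set [Z] gives such a graph [E'] with the same edge
    measure and ranks, so the conclusions transfer to [E]. *)
Lemma greedy_forest_aux (H : set (J * J)) :
  measurable H -> H `<=` E -> sym_set H ->
  (forall A, measurable A -> A `<=` E -> sym_set A -> rank mu A <= eta A) /\
  exists F : set (J * J),
  [/\ measurable F, F `<=` H, sym_set F & acyclic F] /\
  [/\ hyperfinite eta F,
      forall A, measurable A -> A `<=` E -> sym_set A ->
        eta (F `&` A) <= rank mu A,
      forall t : R, rank mu [set z | H z /\ (t < w z)%R] <=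
        eta [set z | F z /\ (t < w z)%R] &
      {ae mu, forall x, finite_set (comp F x) -> comp F x = comp H x}].
Proof.
move=> mH HE sH; have [mE symE _ _ _] := gE.
have [Z [sg [[mZ Z0 invZ] [msg sgK sgP sgE]]]] :=
  generating_involutions gE eE mf finj fim.
pose E' := [set z | E z /\ ~ Z z.1].
have mE' : measurable E' by rewrite /E'; mset.
have E'E : E' `<=` E by move=> z [].
have symE' : sym_set E'.
  by move=> x y [Exy /= nZx]; split; [exact: symE|move=> /(invZ _ _ Exy)].
have finE' x : finite_set [set y | E' (x, y)].
  by apply: sub_finite_set (finite_nbhd gE x) => y [].
have etaI (B : set (J * J)) : measurable B -> eta B = eta (B `&` E').
  move=> mB; have mBE : measurable (B `&` E') by exact: measurableI.
  have mZ1 : measurable [set z : J * J | Z z.1] by mset.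
  apply/eqP; rewrite eq_le; apply/andP; split; last first.
    by apply: le_measure; rewrite ?inE//; exact: subIsetl.
  rewrite (edge_measure_setI gE eE mB) -[leRHS]adde0.
  have [<- _] := edge_measure_null_vertices gE eE mZ Z0.
  apply: (@le_trans _ _ (eta ((B `&` E') `|` [set z | Z z.1]))); last exact: measureU2.
  apply: le_measure; rewrite ?inE; [exact: measurableI|exact: measurableU|].
  by move=> z [Bz Ez]; have [Zz|nZz] := pselect (Z z.1); [right|left].
have eE' : is_edge_measure mu E' eta.
  move=> B mB; rewrite etaI// eE; last exact: measurableI.
  by rewrite -setIA (setIidl E'E).
have etaS := edge_measure_swap gE eE.
have etafin := edge_measure_finite gE eE.
have sgE' x y : E' (x, y) -> exists i, y = sg i x by move=> [Exy nZ]; exact: sgE.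
(* By invariance of [Z], a component starting outside [Z] never enters it. *)
have compI (A : set (J * J)) x : A `<=` E -> ~ Z x -> comp A x = comp (A `&` E') x.
  move=> AE nZx; apply/seteqP; split => y; last by apply: sub_comp => z [].
  suff : comp A x `<=` [set y | comp (A `&` E') x y /\ ~ Z y] by move=> h /h[].
  apply: comp_closed; first by split => //; exact: comp_refl.
  move=> a b [xa nZa] Aab; split; last by move=> /(invZ _ _ (AE _ Aab)).
  by apply: comp_trans xa _; apply: comp_edge; split => //; split => //; exact: AE.
have rankI (A : set (J * J)) : A `<=` E -> rank mu A = rank mu (A `&` E').
  move=> AE; congr (1 - _); apply: (integral_ge0_null mZ Z0) => x.
  - exact: inv_card_ge0.
  - exact: inv_card_ge0.
  - by move=> nZx; rewrite (compI _ _ AE nZx).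
have symI (A : set (J * J)) : sym_set A -> sym_set (A `&` E').
  by move=> sA x y [/sA ? /symE'].
have mI (A : set (J * J)) : measurable A -> measurable (A `&` E').
  by move=> mA; exact: measurableI.
have IE (A : set (J * J)) : A `&` E' `<=` E' by exact: subIsetr.
split.
  move=> A mA AE sA; rewrite rankI// etaI//.
  apply: (rank_le_edge_measure symE' finE' eE' etaS mf finj msg sgK sgP sgE'
    key_inj mkey) => //; [exact: mI|exact: symI].
pose H' := H `&` E'.
have mH' : measurable H' by exact: mI.
have sH' : sym_set H' by exact: symI.
have H'E : H' `<=` E' by exact: IE.
pose F := msf key H'.
have mF : measurable F by exact: (measurable_msf mf finj msg sgE' mkey).
have FH' : F `<=` H' by exact: msf_sub.
exists F; split; first split => //.
- by move=> z /FH'[].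
- exact: (sym_msf key_sym).
- exact: (msf_acyclic key_sym key_inj).
split.
- exact: (msf_hyperfinite symE' finE' eE' etaS etafin mf finj msg sgK sgP sgE'
    key_sym key_inj mkey).
- move=> A mA AE sA; rewrite (rankI A)//.
  have -> : F `&` A = F `&` (A `&` E').
    by apply/seteqP; split => z [Fz Az]; split => //; [split => //; case: (FH' _ Fz)|case: Az].
  apply: (msf_edge_measure_le_rank symE' finE' eE' etaS etafin mf finj msg sgK
    sgP sgE' key_sym key_inj mkey) => //; [exact: mI|exact: symI].
(* Keys compare weights first, so a superlevel set of [w] is closed upwards for [key], as [msf_rank]
   requires. *)
- move=> t; pose U := [set z | H z /\ (t < w z)%R].
  have mU : measurable U by rewrite /U; mset; mfun.
  have sU : sym_set U.
    by move=> x y [/sH Hxy tw]; split => //; rewrite -sw.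
  rewrite rankI; last by move=> z [/HE].
  have UH' : U `&` E' `<=` H' by move=> z [[Hz _] Ez].
  have -> : [set z | F z /\ (t < w z)%R] = F `&` (U `&` E').
    by apply/seteqP; split => z; [move=> [Fz tw]; have [Hz Ez] := FH' _ Fz|move=> [Fz [[]]]].
  apply: le_trans (msf_rank finE' mf finj msg sgK sgP sgE' key_sym mkey
    mH' (mI _ mU) H'E UH' sH' (symI _ sU) _) _.
    move=> e e' [[He te] Ee] [He' Ee'] /key_weight le; split => //; split => //.
    exact: lt_le_trans le.
  apply: (rank_le_edge_measure symE' finE' eE' etaS mf finj msg sgK sgP sgE'
    key_inj mkey).
  + by apply: measurableI => //; exact: mI.
  + by move=> z [/FH'[]].
  + by move=> x y [/(sym_msf key_sym sH') ? /(symI _ sU)].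
- exists Z; split => // x /= nx; apply: contrapT => nZx; apply: nx => fx.
  rewrite (compI _ _ HE nZx).
  rewrite -[in LHS](setIidl FH'); apply: (msf_comp finE' H'E) => //.
  by rewrite (setIidl FH').
Qed.

End lexicographic_key.

(** Exhaustion by finite subgraphs selects edges by a key; the zero weight, with ties broken by
    labels, provides one. *)
Lemma rank_le_edge_measure_graphing (A : set (J * J)) :
  measurable A -> A `<=` E -> sym_set A -> rank mu A <= eta A.
Proof.
have [f [mf [finj fim]]] := sb.
have m0 : measurable_fun setT (fun _ : J * J => 0 : R)%R by exact: measurable_cst.
by have [h _] := greedy_forest_aux mf finj fim m0 (fun _ _ => erefl)
  measurable0 (@sub0set _ E) (fun _ _ => id); exact: h.
Qed.

Lemma greedy_forest (w : J * J -> R) (H : set (J * J)) :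
  measurable_fun setT w -> sym_fun w ->
  measurable H -> H `<=` E -> sym_set H ->
  exists F : set (J * J),
  [/\ measurable F, F `<=` H, sym_set F & acyclic F] /\
  [/\ hyperfinite eta F,
      forall A, measurable A -> A `<=` E -> sym_set A ->
        eta (F `&` A) <= rank mu A,
      forall t : R, rank mu [set z | H z /\ (t < w z)%R] <=
        eta [set z | F z /\ (t < w z)%R] &
      {ae mu, forall x, finite_set (comp F x) -> comp F x = comp H x}].
Proof.
move=> mw sw mH HE sH; have [f [mf [finj fim]]] := sb.
by have [_ h] := greedy_forest_aux mf finj fim mw sw mH HE sH.
Qed.

End greedy_forest.

(** * Bounded functions and functionals on L1 *)

Section bounded_functions.
Context (R : realType) (d : measure_display) (T : measurableType d).
Context (eta : {measure set T -> \bar R}) (etafin : (eta setT < +oo)%E).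
Implicit Types (g h : T -> R) (A : set T).

Definition bmeas h := measurable_fun setT h /\ exists M, forall z, `|h z| <= M.

Lemma bmeas_integrable h : bmeas h -> eta.-integrable setT (EFin \o h).
Proof.
move=> [mh [M hM]]; apply: measurable_bounded_integrable => //.
exists M; split; first exact: num_real.
by move=> x Mx z _; apply: le_trans (hM z) _; exact: ltW.
Qed.

Lemma bmeasD g h : bmeas g -> bmeas h -> bmeas (fun z => g z + h z).
Proof.
move=> [mg [M gM]] [mh [N hN]]; split; first exact: measurable_funD.
by exists (M + N) => z; apply: le_trans (ler_normD _ _) _; exact: lerD.
Qed.

Lemma bmeasM g h : bmeas g -> bmeas h -> bmeas (fun z => g z * h z).
Proof.
move=> [mg [M gM]] [mh [N hN]]; split; first exact: measurable_funM.
by exists (M * N) => z; rewrite normrM; apply: ler_pM.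
Qed.

Lemma bmeas_cst (c : R) : bmeas (fun=> c).
Proof. by split; [exact: measurable_cst|exists `|c|]. Qed.

Lemma bmeas_indic A : measurable A -> bmeas (\1_A).
Proof.
move=> mA; split; first exact: measurable_indic.
by exists 1 => z; rewrite indicE; case: (_ \in _); rewrite ?normr1 ?normr0.
Qed.

Lemma fineta A : measurable A -> eta A \is a fin_num.
Proof.
move=> mA; rewrite ge0_fin_numE//; apply: le_lt_trans etafin.
by apply: le_measure; rewrite ?inE.
Qed.

Lemma Rint_indic A h : \int[eta]_z (\1_A z * h z) = \int[eta]_(z in A) h z.
Proof.
rewrite [RHS]Rintegral_mkcond; apply: eq_Rintegral => z _.
by rewrite patchE indicE; case: ifPn; rewrite ?mul1r ?mul0r.
Qed.

Lemma Rint_indic1 A : measurable A -> \int[eta]_z \1_A z = fine (eta A).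
Proof. by move=> mA; rewrite /Rintegral integral_indic// setIT. Qed.

Lemma RintD g h : bmeas g -> bmeas h ->
  \int[eta]_z (g z + h z) = \int[eta]_z g z + \int[eta]_z h z.
Proof. by move=> bg bh; apply: RintegralD => //; exact: bmeas_integrable. Qed.

Lemma RintZ (c : R) h : bmeas h -> \int[eta]_z (c * h z) = c * \int[eta]_z h z.
Proof. by move=> bh; apply: RintegralZl => //; exact: bmeas_integrable. Qed.

Lemma le_Rint g h : bmeas g -> bmeas h -> (forall z, g z <= h z) ->
  \int[eta]_z g z <= \int[eta]_z h z.
Proof. by move=> bg bh gh; apply: le_Rintegral => //; exact: bmeas_integrable. Qed.

Lemma Rint_bound h (c : R) : bmeas h -> (forall z, `|h z| <= c) ->
  `|\int[eta]_z h z| <= c * fine (eta setT).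
Proof.
move=> bh hc; apply: le_trans (le_normr_Rintegral _ _) _ => //.
  exact: bmeas_integrable.
rewrite -Rintegral_cst//; apply: le_Rint => //; last exact: bmeas_cst.
case: bh => mh [M hM]; split; first exact: measurableT_comp.
by exists M => z; rewrite normr_id.
Qed.

Lemma positive_null (X : set T) h : measurable X ->
  eta.-integrable setT (EFin \o h) -> (forall z, X z -> 0 < h z) ->
  \int[eta]_(z in X) h z <= 0 -> eta X = 0%E.
Proof.
move=> mX ih hpos hle.
have ihX : eta.-integrable X (EFin \o h) by exact: (integrableS measurableT).
have mh : measurable_fun X (EFin \o h) by exact: measurable_int ihX.
have h0 : (\int[eta]_(z in X) `|(h z)%:E| = 0)%E.
  transitivity (\int[eta]_(z in X) (h z)%:E)%E.
    by apply: eq_integral => z /set_mem /hpos h0; rewrite gee0_abs// lee_fin ltW.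
  have fi : (\int[eta]_(z in X) (h z)%:E \is a fin_num)%E.
    exact: integrable_fin_num.
  rewrite -(fineK fi); congr (_%:E); apply/eqP; rewrite eq_le hle /=.
  by apply: Rintegral_ge0 => z /hpos /ltW.
have [N [mN N0 XN]] := (ae_eq_integral_abs _ mX mh).1 h0.
apply/eqP; rewrite eq_le measure_ge0 andbT -N0; apply: le_measure; rewrite ?inE//.
move=> z Xz; apply: XN => /= /(_ Xz) [h0']; have := hpos _ Xz.
by rewrite h0' ltxx.
Qed.

(* [staircase] rounds a function with values in [0, n * delta] down to multiples
   of [delta]. *)
Definition staircase (delta : R) (n : nat) h (z : T) : R :=
  \sum_(j < n) delta * \1_[set z | j.+1%:R * delta < h z] z.

Lemma staircaseS delta n h z : staircase delta n.+1 h z =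
  delta * \1_[set z | n.+1%:R * delta < h z] z + staircase delta n h z.
Proof. by rewrite /staircase big_ord_recr /= addrC. Qed.

Let measurable_level (t : R) h : measurable_fun setT h ->
  measurable [set z | t < h z].
Proof. by move=> mh; apply: measurable_lt_set; mfun. Qed.

Lemma bmeas_staircase delta n h : measurable_fun setT h ->
  bmeas (staircase delta n h).
Proof.
move=> mh; elim: n => [|n IH].
  rewrite (_ : staircase _ _ _ = fun=> 0); first exact: bmeas_cst.
  by apply/funext => z; rewrite /staircase big_ord0.
rewrite (_ : staircase _ _ _ = fun z => delta *
   \1_[set z | n.+1%:R * delta < h z] z + staircase delta n h z).
  apply: bmeasD => //; apply: bmeasM; first exact: bmeas_cst.
  exact/bmeas_indic/measurable_level.
by apply/funext => z; rewrite staircaseS.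
Qed.

Lemma staircase_bounds delta n h z : 0 < delta -> 0 <= h z <= n%:R * delta ->
  staircase delta n h z <= h z <= staircase delta n h z + delta.
Proof.
move=> d0 /andP[h0 hn].
have full m : m%:R * delta < h z -> staircase delta m h z = m%:R * delta.
  elim: m => [|m IH] lt; first by rewrite /staircase big_ord0 mul0r.
  rewrite staircaseS indicE mem_set//= mulr1 IH.
    by rewrite -natr1 mulrDl mul1r addrC.
  by apply: le_lt_trans lt; rewrite ler_pM2r// ler_nat.
have stop m : h z <= m.+1%:R * delta -> staircase delta m.+1 h z = staircase delta m h z.
  by move=> le; rewrite staircaseS indicE memNset /= ?mulr0 ?add0r// ltNge le.
have lb m : staircase delta m h z <= h z.
  elim: m => [|m IH]; first by rewrite /staircase big_ord0.
  have [lt|ge] := ltP (m.+1%:R * delta) (h z); first by rewrite full// ltW.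
  by rewrite stop.
rewrite lb /=; elim: n hn => [|n IH] hn.
  rewrite /staircase big_ord0 add0r; apply: le_trans hn _.
  by rewrite mul0r ltW.
rewrite stop//; have [le|lt] := leP (h z) (n%:R * delta); first exact: IH.
by rewrite full// -[X in _ + X]mul1r -mulrDl natr1.
Qed.

Lemma small_delta (M c e : R) : 0 <= M -> 0 <= c -> 0 < e ->
  exists delta n, [/\ 0 < delta, M <= n%:R * delta & delta * c <= e].
Proof.
move=> M0 c0 e0; pose delta := e / (c + 1).
have c1 : 0 < c + 1 by rewrite ltr_wpDl.
have d0 : 0 < delta by rewrite divr_gt0.
exists delta, (Num.bound (M / delta)); split => //.
  by rewrite -ler_pdivrMr// ltW// archi_boundP// divr_ge0// ltW.
rewrite /delta -mulrA; apply: ler_piMr; first exact: ltW.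
by rewrite mulrC ler_pdivrMr// mul1r lerDl.
Qed.

(** Rounding [v] down to a staircase turns both integrals into finite sums over superlevel sets,
    where the hypothesis applies level by level. *)
Lemma layer_cake_le (v g : T -> R) (F : set T) (M : R) :
  measurable_fun setT v -> measurable_fun setT g -> measurable F ->
  (forall z, 0 <= v z <= M) -> (forall z, 0 <= g z <= 1) ->
  (forall t, 0 <= t ->
    \int[eta]_(z in [set z | t < v z]) g z <= fine (eta (F `&` [set z | t < v z]))) ->
  \int[eta]_z (g z * v z) <= \int[eta]_z (\1_F z * v z).
Proof.
move=> mv mg mF vM g1 lev.
have bv : bmeas v.
  by split => //; exists M => z; have /andP[v0 vm] := vM z; rewrite ger0_norm.
have bg : bmeas g.
  by split => //; exists 1 => z; have /andP[v0 vm] := g1 z; rewrite ger0_norm.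
have bF := bmeas_indic mF.
have M0 : 0 <= M by have /andP[v0 vm] := vM point; exact: le_trans vm.
apply/ler_addgt0Pr => e e0.
have [delta [n [d0 Mn de]]] := small_delta M0 (fine_ge0 (measure_ge0 eta setT)) e0.
have bS := bmeas_staircase delta n mv.
have Sb z : staircase delta n v z <= v z <= staircase delta n v z + delta.
  apply: staircase_bounds => //; have /andP[-> vm] := vM z.
  exact: le_trans Mn.
have step m : \int[eta]_z (g z * staircase delta m v z) <=
    \int[eta]_z (\1_F z * staircase delta m v z).
  elim: m => [|m IH].
    apply: le_Rint => [||z]; last by rewrite /staircase big_ord0 !mulr0.
      by apply: bmeasM => //; exact: bmeas_staircase.
    by apply: bmeasM => //; exact: bmeas_staircase.
  set U := [set z | m.+1%:R * delta < v z].
  have mU : measurable U by exact: measurable_level.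
  have bU := bmeas_indic mU.
  have bSm := bmeas_staircase delta m mv.
  have expand k : bmeas k -> \int[eta]_z (k z * staircase delta m.+1 v z) =
      delta * \int[eta]_(z in U) k z + \int[eta]_z (k z * staircase delta m v z).
    move=> bk; rewrite -(Rint_indic U k) -RintZ; last exact: bmeasM.
    rewrite -RintD; [|by apply: bmeasM; [exact: bmeas_cst|exact: bmeasM]|exact: bmeasM].
    by apply: eq_Rintegral => z _; rewrite staircaseS mulrDr mulrCA (mulrC (k z)).
  rewrite !expand//; apply: lerD => //; rewrite ler_pM2l//.
  apply: le_trans (lev _ _) _; first by rewrite mulr_ge0// ltW.
  rewrite -Rint_indic1; last exact: measurableI.
  rewrite -(Rint_indic U); apply: le_Rint; [|exact: bmeasM|].
    by apply: bmeas_indic; exact: measurableI.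
  by move=> z; rewrite indicI /= mulrC.
(* Only the side of [g] pays for the rounding, since the staircase lies below [v]; as [g <= 1], the
   price is at most [delta * eta setT]. *)
apply: (@le_trans _ _ (\int[eta]_z (g z * staircase delta n v z + delta * g z))).
  apply: le_Rint.
  - exact: bmeasM.
  - by apply: bmeasD; apply: bmeasM => //; exact: bmeas_cst.
  move=> z; have /andP[_ vS] := Sb z; have /andP[g0 _] := g1 z.
  by rewrite (mulrC delta) -mulrDr ler_wpM2l.
rewrite RintD; [|exact: bmeasM|by apply: bmeasM => //; exact: bmeas_cst].
apply: lerD; last first.
  rewrite RintZ//; apply: le_trans de; rewrite ler_pM2l//.
  apply: le_trans (ler_norm _) _; rewrite -[leRHS]mul1r.
  apply: Rint_bound => // z; have /andP[g0 ?] := g1 z; by rewrite ger0_norm.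
apply: le_trans (step n) _; apply: le_Rint; [exact: bmeasM|exact: bmeasM|].
move=> z; have /andP[Sv _] := Sb z; by rewrite ler_wpM2l.
Qed.

End bounded_functions.

(** * Functionals as bounded symmetric weights *)

Section L1_functionals.
Context (R : realType) (d : measure_display) (J : measurableType d).
Context (eta : {measure set (J * J)%type -> \bar R}).
Context (etafin : (eta setT < +oo)%E).
Context (etaS : forall A, measurable A -> eta [set z | A (z.2, z.1)] = eta A).
Context (L : (J * J -> R) -> R) (LL : L1_functional eta L).
Local Notation intble h := (eta.-integrable setT (EFin \o h)).
Implicit Types (g h : J * J -> R) (A : set (J * J)).

Lemma L1_linear (a : R) g h : intble g -> intble h ->
  L (fun z => a * g z + h z) = a * L g + L h.
Proof. by case: LL => + _; apply. Qed.

Lemma L1_zero : L (fun=> 0) = 0.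
Proof.
have i0 : intble (fun _ : J * J => 0) by exact/(bmeas_integrable etafin)/bmeas_cst.
have := L1_linear (-1) i0 i0.
rewrite (_ : (fun z => _) = fun=> 0); last by apply/funext => z; rewrite mulr0 addr0.
by move=> ->; rewrite mulN1r addNr.
Qed.

Lemma L1_bound : exists2 C : R, 0 <= C & forall h, intble h ->
  `|L h| <= C * \int[eta]_z `|h z|.
Proof.
have [_ [C HC]] := LL; exists (Num.max C 0); first by rewrite le_max lexx orbT.
move=> h ih; have := HC h ih.
have ia : intble (fun z => `|h z|) by exact: integrable_norm ih.
have fi : (\int[eta]_z (`|h z|)%:E \is a fin_num)%E by exact: integrable_fin_num ia.
rewrite -(fineK fi) -EFinM lee_fin => /le_trans; apply.
apply: ler_wpM2r; first by apply: Rintegral_ge0.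
by rewrite le_max lexx.
Qed.

Lemma L1_sub g h : intble g -> intble h -> L (fun z => g z - h z) = L g - L h.
Proof.
move=> ig ih; have := L1_linear (-1) ih ig.
rewrite (_ : (fun z => _) = fun z => g z - h z).
  by move=> ->; rewrite mulN1r addrC.
by apply/funext => z; rewrite mulN1r addrC.
Qed.

Lemma L1_ae_eq g h : intble g -> intble h -> {ae eta, forall z, g z = h z} ->
  L g = L h.
Proof.
move=> ig ih gh; have [C C0 HC] := L1_bound.
have id_ : intble (fun z => g z - h z) by exact: (integrableB measurableT ig ih).
apply/eqP; rewrite -subr_eq0 -L1_sub// -normr_le0; apply: le_trans (HC _ id_) _.
rewrite (_ : \int[eta]_z _ = 0) ?mulr0//.
rewrite /Rintegral (@ae_eq_integral _ _ _ _ _ (cst 0%E))//.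
- by rewrite integral0.
- by apply: measurable_int (integrable_norm id_).
- by apply: filterS gh => z /= -> _; rewrite subrr normr0.
Qed.

(** The values of [L] on indicators are additive in the set. Their bound by [C * eta A] gives
    countable additivity and absolute continuity, and the Radon-Nikodym derivative is the
    density. *)
Lemma L1_density : exists2 w0 : J * J -> R, intble w0 &
  forall A, measurable A -> L (\1_A) = \int[eta]_(z in A) w0 z.
Proof.
have [C C0 HC] := L1_bound.
have iI A : measurable A -> intble (\1_A : J * J -> R).
  by move=> mA; exact/(bmeas_integrable etafin)/bmeas_indic.
have LI A : measurable A -> `|L (\1_A)| <= C * fine (eta A).
  move=> mA; apply: le_trans (HC _ (iI _ mA)) _; rewrite ler_wpM2l//.
  rewrite -Rint_indic1// le_eqVlt; apply/orP; left; apply/eqP.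
  by apply: eq_Rintegral => z _; rewrite ger0_norm// indicE.
have LU A B : measurable A -> measurable B -> A `&` B = set0 ->
    L (\1_(A `|` B)) = L (\1_A) + L (\1_B).
  move=> mA mB AB; rewrite -[L (\1_A)]mul1r -L1_linear; [|exact: iI..].
  congr L; apply/funext => z; rewrite mul1r !indicE in_setU.
  have [Az|nAz] := pselect (A z); last by rewrite (memNset nAz) /= add0r.
  have nBz : ~ B z by move=> Bz; have : (A `&` B) z by []; rewrite AB.
  by rewrite (mem_set Az) (memNset nBz) addr0.
pose nu A : \bar R := (L (\1_A))%:E.
have nu0 : nu set0 = 0%E.
  transitivity (L (fun=> 0))%:E; last by rewrite L1_zero.
  by congr (L _)%:E; apply/funext => z; rewrite indic0.
have nufin A : measurable A -> nu A \is a fin_num by [].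
have nuadd : semi_sigma_additive nu.
  move=> F mF tF mU; set U := \bigcup_n F n.
  pose Un n := \big[setU/set0]_(i < n) F i.
  have mUn n : measurable (Un n) by apply: bigsetU_measurable.
  have sumE n : (\sum_(0 <= i < n) nu (F i))%E = (L (\1_(Un n)))%:E.
    elim: n => [|n IH]; first by rewrite big_nil /Un big_ord0 -/(nu set0) nu0.
    rewrite big_nat_recr//= IH /nu -EFinD -LU//.
      by rewrite /Un big_ord_recr.
    apply/seteqP; split => z //; rewrite /Un -bigcup_mkord => -[[k /= kn Fk] Fn].
    have [kz|kz] := eqVneq k n; first by rewrite kz ltnn in kn.
    have : (F k `&` F n) z by [].
    by rewrite ((iffLR trivIsetP tF) k n).
  have UnU n : Un n `<=` U by rewrite /Un /U -bigcup_mkord; move=> z [k _ Fk]; exists k.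
  under eq_fun do rewrite sumE.
  apply: cvg_EFin; first by near=> n.
  rewrite (_ : fine \o _ = fun n => L (\1_(Un n)))//.
  have mD n : measurable (U `\` Un n) by exact: measurableD.
  have cv : (fine \o (fun n => eta (U `\` Un n))) n @[n --> \oo] --> (0 : R).
    apply: fine_cvg.
    have capE : \bigcap_n (U `\` Un n) = set0.
      apply/seteqP; split => z // h; have [[k _ Fk] _] := h 0%N I.
      have [_] := h k.+1 I; apply; rewrite /Un -bigcup_mkord.
      by exists k => //=.
    have -> : (0 : R)%:E = eta (\bigcap_n (U `\` Un n)) by rewrite capE measure0.
    apply: nonincreasing_cvg_mu => //.
    - by rewrite -ge0_fin_numE//; exact: (fineta etafin).
    - by rewrite capE.
    - move=> n m nm; apply/subsetPset; apply: setDS.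
      by rewrite /Un -!bigcup_mkord => z [k /= kn Fk]; exists k => //=; exact: leq_trans nm.
  apply/cvgrPdist_le => e e0.
  have C1 : 0 < C + 1 by rewrite ltr_wpDl.
  have /cvgrPdist_le/(_ _ (divr_gt0 e0 C1)) := cv.
  apply: filterS => n /=; rewrite sub0r normrN.
  have -> : L (\1_U) - L (\1_(Un n)) = L (\1_(U `\` Un n)).
    have -> : \1_U = \1_(U `\` Un n `|` Un n) :> (J * J -> R).
      by congr (\1_ _); rewrite setDKU//; exact: UnU.
    rewrite LU ?addrK//; last by rewrite setDE -setIA setICl setI0.
  rewrite ger0_norm ?fine_ge0// => h; apply: le_trans (LI _ (mD n)) _.
  apply: le_trans (ler_wpM2l C0 h) _; rewrite mulrCA ler_piMr ?ltW//.
  by rewrite ltr_pdivrMr// mul1r ltrDl.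
pose nuc : {charge set (J * J)%type -> \bar R} :=
  HB.pack nu (isCharge.Build _ _ _ nu nu0 nufin nuadd).
have ef : fin_num_fun eta by move=> A mA; exact: (fineta etafin).
have sf : sigma_finite setT eta.
  by apply: fin_num_fun_sigma_finite => //; rewrite measure0.
pose H1 := isFinite.Build _ _ _ _ ef.
pose H2 := isSFinite.Build _ _ _ _ (sfinite_measure_sigma_finite sf).
pose H3 := isSigmaFinite.Build _ _ _ _ sf.
pose etaf := HB.pack_for (FiniteMeasure.type (J * J)%type R) (Measure.sort eta)
  H1 H2 H3.
have dom : nuc `<< etaf.
  apply/null_content_dominatesP => A mA A0; apply/eqP; rewrite eqe -normr_le0.
  apply: le_trans (LI _ mA) _.
  have -> : eta A = 0%E by exact: A0.
  by rewrite mulr0.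
pose w := Radon_Nikodym nuc etaf.
have wfin z : w z \is a fin_num by exact: Radon_Nikodym_fin_num.
have iw : etaf.-integrable setT w by exact: Radon_Nikodym_integrable.
have wE A : measurable A -> nuc A = (\int[etaf]_(z in A) w z)%E.
  by move=> mA; exact: Radon_Nikodym_integral.
exists (fine \o w).
  by rewrite (_ : EFin \o _ = w)//; apply/funext => z /=; rewrite fineK.
move=> A mA; have := wE A mA; rewrite /nuc /= /nu /Rintegral => e.
rewrite -[LHS]/(fine (L (\1_A))%:E) e; congr fine.
by apply: eq_integral => z _ /=; rewrite fineK.
Unshelve. all: by end_near.
Qed.


Lemma Rint_swap A h : measurable A -> sym_set A -> intble h ->
  \int[eta]_(z in A) h (z.2, z.1) = \int[eta]_(z in A) h z.
Proof.
move=> mA sA ih.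
have msw : measurable_fun setT (fun z : J * J => (z.2, z.1)) by mfun.
pose m2 := measure_function_pushforward__canonical__measure_function_Measure eta msw.
have mh : measurable_fun setT (EFin \o h) by exact: measurable_int ih.
have swA : (fun z : J * J => (z.2, z.1)) @^-1` A = A.
  by apply/seteqP; split => -[x y] /= /sA.
have m2E (B : set (J * J)) : measurable B -> B `<=` setT -> m2 B = eta B.
  by move=> mB _; exact: etaS.
have ish : intble (fun z => h (z.2, z.1)).
  have /integrableP[_ hfin] := ih; apply/integrableP; split.
    exact: (measurable_fun_applied mh msw).
  move: hfin; rewrite -(eq_measure_integral _ m2E) /=.
  rewrite (ge0_integral_pushforward msw); [by rewrite preimage_setT|
    exact: measurableT| |by move=> z _; rewrite lee_fin].
  apply/measurable_EFinP; apply: measurableT_comp => //.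
  exact/measurable_EFinP.
rewrite /Rintegral; congr fine.
transitivity (\int[m2]_(z in A) (EFin \o h) z)%E; last first.
  by apply: eq_measure_integral => B mB _; exact: etaS.
rewrite (integral_pushforward msw mh)// swA//.
exact: (integrableS measurableT mA).
Qed.

(** The density exceeds [C] in absolute value only on a null set, where its integral would otherwise
    beat the bound on [L]. After clamping, averaging with the reversal makes it symmetric and
    changes no integral over a symmetric set. *)
Lemma L1_weight : exists (C : R) (w : J * J -> R),
  [/\ 0 <= C, measurable_fun setT w, sym_fun w, (forall z, `|w z| <= C) &
      forall A, measurable A -> sym_set A -> L (\1_A) = \int[eta]_(z in A) w z].
Proof.
have [C C0 HC] := L1_bound; have [w0 iw0 w0E] := L1_density.
have mw0 : measurable_fun setT w0 by apply/measurable_EFinP; exact: measurable_int iw0.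
have LI A : measurable A -> `|L (\1_A)| <= C * fine (eta A).
  move=> mA; have iA : intble (\1_A : J * J -> R).
    exact/(bmeas_integrable etafin)/bmeas_indic.
  apply: le_trans (HC _ iA) _; rewrite ler_wpM2l//.
  rewrite -Rint_indic1// le_eqVlt; apply/orP; left; apply/eqP.
  by apply: eq_Rintegral => z _; rewrite ger0_norm// indicE.
have null (s : R) : `|s| = 1 -> eta [set z | C < s * w0 z] = 0%E.
  move=> s1; set X := mkset _.
  have msw0 : measurable_fun setT (fun z => s * w0 z).
    by apply: measurable_funM => //; exact: measurable_cst.
  have mX : measurable X by apply: measurable_lt_set => //; exact: measurable_cst.
  have isw : intble (fun z => s * w0 z) by exact: (integrableZl measurableT s iw0).
  have iC : intble (fun _ : J * J => C) by exact/(bmeas_integrable etafin)/bmeas_cst.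
  have idf : intble (fun z => s * w0 z - C) by exact: (integrableB measurableT isw iC).
  apply: (@positive_null _ _ _ _ X _ mX idf).
    by move=> z; rewrite /X /= subr_gt0.
  rewrite RintegralB//; [|exact: (integrableS measurableT mX)..].
  rewrite RintegralZl//; last exact: (integrableS measurableT mX).
  rewrite Rintegral_cst// -w0E// subr_le0.
  apply: le_trans (ler_norm _) _; rewrite normrM s1 mul1r.
  exact: LI.
pose w1 z := Num.max (- C) (Num.min C (w0 z)).
have mw1 : measurable_fun setT w1.
  by apply: measurable_maxr => //; apply: measurable_minr.
have w1C z : `|w1 z| <= C.
  rewrite ler_norml /w1 le_max lexx /= ge_max ge_min lexx /= andbT.
  by rewrite (@le_trans _ _ 0) ?oppr_le0.
have w1E A : measurable A -> \int[eta]_(z in A) w1 z = \int[eta]_(z in A) w0 z.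
  move=> mA; rewrite /Rintegral; congr fine; apply: ae_eq_integral => //.
  - by apply/measurable_EFinP; exact: measurable_funTS.
  - by apply/measurable_EFinP; exact: measurable_funTS.
  have n1 := null 1 (normr1 _); have n2 := null (-1) (normrN1 _).
  have mX (s : R) : measurable [set z | C < s * w0 z].
    apply: measurable_lt_set; first exact: measurable_cst.
    by apply: measurable_funM => //; exact: measurable_cst.
  exists ([set z | C < 1 * w0 z] `|` [set z | C < -1 * w0 z]); split.
  - exact: measurableU.
  - exact: null_set_setU.
  move=> z /= nz; apply: contrapT => /not_orP[/negP h1 /negP h2]; apply: nz => _.
  rewrite mul1r -leNgt in h1; rewrite mulN1r -leNgt lerNl in h2.
  by rewrite /w1 (min_idPr h1) (max_idPr h2).
have iw1 : intble w1.
  by apply: (bmeas_integrable etafin); split => //; exists C.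
have msw : measurable_fun setT (fun z : J * J => (z.2, z.1)) by mfun.
have iw1s : intble (fun z => w1 (z.2, z.1)).
  apply: (bmeas_integrable etafin); split; last by exists C => z; exact: w1C.
  exact: (measurable_fun_applied mw1 msw).
pose w z := 2%:R^-1 * (w1 z + w1 (z.2, z.1)).
have sumi : intble (fun z => w1 z + w1 (z.2, z.1)).
  exact: (integrableD measurableT iw1 iw1s).
exists C, w; split => //.
- apply: measurable_funM; first exact: measurable_cst.
  by apply: measurable_funD => //; exact: (measurable_fun_applied mw1 msw).
- by move=> x y; rewrite /w /= addrC.
- move=> z; rewrite /w normrM ger0_norm ?invr_ge0// mulrC ler_pdivrMr//.
  apply: le_trans (ler_normD _ _) _; rewrite mulr_natr mulr2n.
  exact: lerD.
move=> A mA sA; rewrite w0E// -w1E// /w.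
rewrite RintegralZl//; last exact: (integrableS measurableT mA).
rewrite RintegralD//; [|exact: (integrableS measurableT mA)..].
by rewrite Rint_swap//; field.
Qed.

(** Linearity gives the formula for staircases of [g], whose level sets are symmetric because [g]
    is; both sides are continuous under uniform approximation. *)
Lemma L1_weight_rep (C : R) (w : J * J -> R) : 0 <= C ->
  measurable_fun setT w -> (forall z, `|w z| <= C) ->
  (forall A, measurable A -> sym_set A -> L (\1_A) = \int[eta]_(z in A) w z) ->
  forall g, measurable_fun setT g -> sym_fun g -> (forall z, 0 <= g z <= 1) ->
  L g = \int[eta]_z (g z * w z).
Proof.
move=> C0 mw wC wE g mg sg g1.
have bw : bmeas w by split => //; exists C.
have bg : bmeas g.
  by split => //; exists 1 => z; have /andP[h0 h1] := g1 z; rewrite ger0_norm.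
have [D D0 HD] := L1_bound.
apply/eqP; rewrite -subr_eq0 -normr_le0; apply/ler_addgt0Pr => e e0; rewrite add0r.
have etaT0 : 0 <= fine (eta setT) by exact: fine_ge0.
(* A uniform error [delta] costs [D * delta * eta setT] in [L] and [C * delta * eta setT] in the
   integral, hence the factor [D + C]. *)
have [delta [n [d0 Mn de]]] := @small_delta R 1 ((D + C) * fine (eta setT)) e ler01
  (mulr_ge0 (addr_ge0 D0 C0) etaT0) e0.
have bS m := bmeas_staircase delta m mg.
have stepL m : L (staircase delta m g) = \int[eta]_z (staircase delta m g z * w z).
  elim: m => [|m IH].
    rewrite (_ : staircase _ _ _ = fun=> 0); last first.
      by apply/funext => z; rewrite /staircase big_ord0.
    rewrite L1_zero; under eq_Rintegral do rewrite mul0r.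
    by rewrite Rintegral_cst// mul0r.
  pose U := [set z | m.+1%:R * delta < g z].
  have mU : measurable U by apply: measurable_lt_set => //; exact: measurable_cst.
  have sU : sym_set U by move=> x y; rewrite /U /= sg.
  have bU := bmeas_indic R mU.
  rewrite (_ : staircase _ _ _ = fun z => delta * \1_U z + staircase delta m g z);
    last by apply/funext => z; rewrite staircaseS.
  rewrite L1_linear; [|exact: (bmeas_integrable etafin)..].
  rewrite IH wE// -(Rint_indic eta U w) -(RintZ etafin); last exact: bmeasM.
  rewrite -(RintD etafin).
  - by apply: eq_Rintegral => z _; rewrite mulrDl mulrA.
  - by apply: bmeasM; [exact: bmeas_cst|exact: bmeasM].
  - exact: bmeasM.
have Sb z : `|g z - staircase delta n g z| <= delta.
  have : 0 <= g z <= n%:R * delta.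
    by have /andP[-> h1] := g1 z; exact: le_trans Mn.
  move=> /(staircase_bounds d0)/andP[h1 h2].
  by rewrite ger0_norm ?subr_ge0// lerBlDl.
have bd : bmeas (fun z => g z - staircase delta n g z).
  split; first by apply: measurable_funB => //; case: (bS n).
  by exists delta.
have -> : L g - \int[eta]_z (g z * w z) =
    L (fun z => g z - staircase delta n g z) -
    \int[eta]_z ((g z - staircase delta n g z) * w z).
  rewrite L1_sub; [|exact: (bmeas_integrable etafin)..].
  rewrite [X in _ - X = _](_ : _ = \int[eta]_z ((g z - staircase delta n g z) * w z) +
     \int[eta]_z (staircase delta n g z * w z)).
    by rewrite stepL opprD addrA addrAC.
  rewrite -(RintD etafin); [|exact: bmeasM..].
  by apply: eq_Rintegral => z _; rewrite -mulrDl subrK.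
apply: le_trans (ler_normB _ _) _; apply: le_trans de.
have h1 : `|L (fun z => g z - staircase delta n g z)| <= D * (delta * fine (eta setT)).
  apply: le_trans (HD _ _) _; first exact: (bmeas_integrable etafin).
  rewrite ler_wpM2l//; apply: le_trans (ler_norm _) _; apply: (Rint_bound etafin).
    split; first by apply: measurableT_comp => //; case: bd.
    by exists delta => z; rewrite normr_id.
  by move=> z; rewrite normr_id.
have h2 : `|\int[eta]_z ((g z - staircase delta n g z) * w z)| <=
    (delta * C) * fine (eta setT).
  apply: (Rint_bound etafin); first exact: bmeasM.
  by move=> z; rewrite normrM; apply: ler_pM.
apply: le_trans (lerD h1 h2) _; rewrite le_eqVlt; apply/orP; left; apply/eqP.
by ring.
Qed.

End L1_functionals.

(** * Exposed points *)

Section exposed_points.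
Context (R : realType) (d : measure_display) (J : measurableType d).
Context (mu : probability J R) (E : set (J * J)).
Context (eta : {measure set (J * J)%type -> \bar R}).
Context (sb : standard_borel J R) (gE : graphing mu E).
Context (eE : is_edge_measure mu E eta).
Local Notation intble h := (eta.-integrable setT (EFin \o h)).
Implicit Types (g h f : J * J -> R) (A F : set (J * J)).

Let etafin : (eta setT < +oo)%E. Proof. exact: edge_measure_finite gE eE. Qed.
Let etaS := edge_measure_swap gE eE.
Let mE : measurable E. Proof. by case: gE. Qed.
Let symE : sym_set E. Proof. by case: gE. Qed.

Let fin_eta A : measurable A -> eta A \is a fin_num.
Proof. exact: (fineta etafin). Qed.

Let intS A h : measurable A -> intble h -> eta.-integrable A (EFin \o h).
Proof. by move=> mA; exact: (integrableS measurableT mA). Qed.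

Let int_indic A : measurable A -> intble (\1_A : J * J -> R).
Proof. by move=> mA; exact/(bmeas_integrable etafin)/bmeas_indic. Qed.

Let RintE A h : measurable A -> intble h ->
  (\int[eta]_(z in A) (h z)%:E)%E = (\int[eta]_(z in A) h z)%:E.
Proof.
move=> mA ih; rewrite /Rintegral fineK//.
exact: (integrable_fin_num mA (intS mA ih)).
Qed.

Let Rint_indicI A F : measurable A -> measurable F ->
  \int[eta]_(z in A) \1_F z = fine (eta (A `&` F)).
Proof.
by move=> mA mF; rewrite /Rintegral integral_indic// setIC.
Qed.

Let null_off_E : eta (~` E) = 0%E.
Proof.
rewrite (edge_measure_setI gE eE); last exact: measurableC.
by rewrite setICl measure0.
Qed.

(** The sets where [g] is negative or exceeds 1 are symmetric, so the polytope inequalities apply to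
    them, the second together with [rank <= eta]. On either set a positive function would have
    nonpositive integral. *)
Lemma mm_plus_range g : mm_plus mu eta E g ->
  {ae eta, forall z, E z /\ 0 <= g z <= 1}.
Proof.
move=> [mg sg ig gA].
pose N1 := [set z | E z /\ g z < 0]; pose N2 := [set z | E z /\ 1 < g z].
have mN1 : measurable N1.
  by apply: measurable_Pand => //; apply: measurable_lt_set => //; exact: measurable_cst.
have mN2 : measurable N2.
  by apply: measurable_Pand => //; apply: measurable_lt_set => //; exact: measurable_cst.
have sN1 : sym_set N1 by move=> x y [/symE ? gxy]; split => //; rewrite -sg.
have sN2 : sym_set N2 by move=> x y [/symE ? gxy]; split => //; rewrite -sg.
have N1E : N1 `<=` E by move=> z [].
have N2E : N2 `<=` E by move=> z [].
have n1 : eta N1 = 0%E.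
  apply: (@positive_null _ _ _ eta N1 (fun z => -1 * g z)) => //.
  - exact: (integrableZl measurableT (-1) ig).
  - by move=> z [_ gz]; rewrite mulN1r oppr_gt0.
  rewrite RintegralZl//; last exact: intS.
  by rewrite mulN1r oppr_le0 -lee_fin -RintE//; have [] := gA _ mN1 N1E sN1.
have n2 : eta N2 = 0%E.
  have i1 : intble (fun _ : J * J => 1) by exact/(bmeas_integrable etafin)/bmeas_cst.
  apply: (@positive_null _ _ _ eta N2 (fun z => g z - 1)) => //.
  - exact: (integrableB measurableT ig i1).
  - by move=> z [_ gz]; rewrite subr_gt0.
  rewrite RintegralB//; [|exact: intS..].
  rewrite Rintegral_cst// mul1r subr_le0 -lee_fin -RintE// fineK ?fin_eta//.
  have [_ /le_trans] := gA _ mN2 N2E sN2; apply.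
  exact: (rank_le_edge_measure_graphing sb gE eE).
exists ((N1 `|` N2) `|` ~` E); split.
- by apply: measurableU; [exact: measurableU|exact: measurableC].
- by apply: null_set_setU => //; [exact: measurableU|exact: measurableC|exact: null_set_setU].
move=> z /= nz; apply: contrapT => /not_orP[/not_orP[h1 h2] /contrapT Ez].
apply: nz; split => //; rewrite !leNgt; apply/andP; split; apply/negP => lt.
  by apply: h1.
by apply: h2.
Qed.

Let sym_indic F : sym_set F -> sym_fun (\1_F : J * J -> R).
Proof.
move=> sF x y; rewrite !indicE; congr (_%:R); congr nat_of_bool.
by apply/idP/idP => /set_mem/sF/mem_set.
Qed.

(** Integrals are compared on symmetric subsets of [E] only. This suffices because both functions
    are symmetric, and with them the sets where one lies below the other; the complement of [E] is
    null. *)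
Lemma restriction_ae_eq f F : measurable_fun setT f -> sym_fun f -> intble f ->
  measurable F -> sym_set F -> is_restriction eta E F f ->
  {ae eta, forall z, f z = \1_F z}.
Proof.
move=> mf sf jf mF sF fF.
have mI : measurable_fun setT (\1_F : J * J -> R) by exact: measurable_indic.
have symI := sym_indic sF.
have iI := int_indic mF.
have null g h : measurable_fun setT g -> measurable_fun setT h -> sym_fun g ->
    sym_fun h -> intble g -> intble h ->
    (forall A, measurable A -> A `<=` E -> sym_set A ->
      \int[eta]_(z in A) g z = \int[eta]_(z in A) h z) ->
    measurable [set z | E z /\ g z < h z] /\ eta [set z | E z /\ g z < h z] = 0%E.
  move=> mg mh sg sh ig ih gh; set X := mkset _.
  have mX : measurable X by apply: measurable_Pand => //; exact: measurable_lt_set.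
  have XE : X `<=` E by move=> z [].
  have sX : sym_set X.
    by move=> x y [/symE Exy lt]; split => //; rewrite -sg -sh.
  split => //; apply: (@positive_null _ _ _ eta X (fun z => h z - g z)) => //.
  - exact: (integrableB measurableT ih ig).
  - by move=> z [_]; rewrite subr_gt0.
  by rewrite RintegralB//; [rewrite (gh X)// subrr|exact: intS..].
have fFR A : measurable A -> A `<=` E -> sym_set A ->
    \int[eta]_(z in A) f z = \int[eta]_(z in A) \1_F z.
  by move=> mA AE sA; rewrite Rint_indicI// -fF.
have [m1 n1] := null f (\1_F) mf mI sf symI jf iI fFR.
have [m2 n2] := null (\1_F) f mI mf symI sf iI jf
  (fun A mA AE sA => esym (fFR A mA AE sA)).
exists (([set z | E z /\ f z < \1_F z] `|` [set z | E z /\ \1_F z < f z]) `|` ~` E).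
split.
- by apply: measurableU; [exact: measurableU|exact: measurableC].
- by apply: null_set_setU => //; [exact: measurableU|exact: measurableC|exact: null_set_setU].
move=> z /= nz; apply: contrapT => /not_orP[/not_orP[h1 h2] /contrapT Ez].
apply: nz; apply/eqP; rewrite eq_le !leNgt; apply/andP; split; apply/negP => lt.
  by apply: h2.
by apply: h1.
Qed.

(* The functional pairs with +1 on [F] and -1 off [F], and an element of the
   polytope takes its values in [0, 1]. *)
Lemma restriction_exposed (C : (J * J -> R) -> Prop) f F :
  (forall g, C g -> mm_plus mu eta E g) -> C f ->
  measurable F -> sym_set F -> is_restriction eta E F f -> exposed eta C f.
Proof.
move=> Cmm Cf mF sF fF; split => //.
have [mf sf jf _] := Cmm _ Cf.
have fae := restriction_ae_eq mf sf jf mF sF fF.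
pose s z : R := 2%:R * \1_F z - 1.
have ms : measurable_fun setT s.
  apply: measurable_funB; last exact: measurable_cst.
  by apply: measurable_funM; [exact: measurable_cst|exact: measurable_indic].
have s1 z : `|s z| = 1.
  rewrite /s indicE; case: (_ \in _); rewrite ?mulr1 ?mulr0 ?sub0r ?normrN1//.
  by rewrite (_ : 2%:R - 1 = 1 :> R) ?normr1//; ring.
have is_ g : intble g -> intble (fun z => g z * s z).
  move=> ig; apply: (le_integrable measurableT _ _ ig).
    apply/measurable_EFinP; apply: measurable_funM => //.
    by apply/measurable_EFinP; exact: measurable_int ig.
  by move=> z _ /=; rewrite normrM s1 mulr1.
pose L g := \int[eta]_z (g z * s z).
exists L; split.
  split.
    move=> a g h ig ih; rewrite /L -RintegralZl//; last exact: is_.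
    have iag : intble (fun z => a * (g z * s z)).
      exact: (integrableZl measurableT a (is_ _ ig)).
    rewrite -RintegralD//; last exact: is_.
    by apply: eq_Rintegral => z _; ring.
  exists 1 => g ig; rewrite mul1e.
  have ina : intble (fun z => `|g z|) by exact: integrable_norm ig.
  rewrite RintE// lee_fin /L; apply: le_trans (le_normr_Rintegral _ (is_ _ ig)) _ => //.
  rewrite le_eqVlt; apply/orP; left; apply/eqP.
  by apply: eq_Rintegral => z _; rewrite normrM s1 mulr1.
move=> g Cg ngf; have [mg sg ig _] := Cmm _ Cg.
rewrite ltNge; apply/negP => le; apply: ngf.
have grange := mm_plus_range (Cmm _ Cg).
have id_ : intble (fun z => f z - g z) by exact: (integrableB measurableT jf ig).
have ina : intble (fun z => `|f z - g z|) by exact: integrable_norm id_.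
(* Almost everywhere [f] is 1 on [F] and 0 off it while [g] lies in [0, 1], so multiplying [f - g]
   by [s] yields its absolute value: the gap of the functional is the L1 distance. *)
have e : \int[eta]_z `|f z - g z| = L f - L g.
  rewrite /L -RintegralB//; [|exact: is_..].
  rewrite /Rintegral; congr fine; apply: ae_eq_integral => //.
  - exact: measurable_int ina.
  - have -> : (fun z => (f z * s z - g z * s z)%:E) =
        EFin \o (fun z => (f z - g z) * s z).
      by apply/funext => z /=; rewrite mulrBl.
    exact: measurable_int (is_ _ id_).
  apply: filterS2 fae grange => z /= -> [_ /andP[g0 g1]] _; congr EFin.
  rewrite /s indicE; case: (_ \in _); rewrite ?mulr1 ?mulr0 /=.
    by rewrite ger0_norm ?subr_ge0//; ring.
  by rewrite sub0r normrN ger0_norm//; ring.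
have i0 : (\int[eta]_z `|(f z - g z)%:E| = 0)%E.
  rewrite [LHS](RintE measurableT ina); congr EFin; apply/eqP.
  by rewrite eq_le Rintegral_ge0// andbT e subr_le0.
have mfg : measurable_fun setT (EFin \o (fun z => f z - g z)).
  exact: measurable_int id_.
have := (ae_eq_integral_abs eta measurableT mfg).1 i0.
by apply: filterS => z /= /(_ I) [] /eqP; rewrite subr_eq0 => /eqP ->.
Qed.

Let indic_mm_plus F : measurable F -> sym_set F ->
  (forall A, measurable A -> A `<=` E -> sym_set A ->
    (eta (F `&` A) <= rank mu A)%E) ->
  mm_plus mu eta E (\1_F).
Proof.
move=> mF sF leF; split.
- exact: measurable_indic.
- exact: sym_indic.
- exact: int_indic.
move=> A mA AE sA; rewrite integral_indic//; split => //.
exact: leF.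
Qed.

Let indic_restriction F f : measurable F ->
  intble f -> {ae eta, forall z, \1_F z = f z} -> is_restriction eta E F f.
Proof.
move=> mF jf fae A mA AE sA; rewrite setIC -integral_indic//.
apply: ae_eq_integral => //.
- exact: measurable_int (intS mA jf).
- exact: measurable_int (intS mA (int_indic mF)).
by apply: filterS fae => z -> _.
Qed.

(** A representative of [f] that lies in [0, 1] at every point, as the layer-cake comparison and the
    representation of [L] ask for pointwise bounds. *)
Let clamp f z : R := \1_E z * Num.max 0 (Num.min 1 (f z)).

Let clamp_range f z : 0 <= clamp f z <= 1.
Proof.
rewrite /clamp indicE; case: (_ \in _); rewrite ?mul1r ?mul0r ?lexx ?ler01//.
by rewrite le_max lexx /= ge_max ler01 ge_min lexx.
Qed.

Let measurable_clamp f : measurable_fun setT f -> measurable_fun setT (clamp f).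
Proof.
move=> mf; apply: measurable_funM; first exact: measurable_indic.
by apply: measurable_maxr => //; apply: measurable_minr.
Qed.

Let sym_clamp f : sym_fun f -> sym_fun (clamp f).
Proof. by move=> sf x y; rewrite /clamp sf (sym_indic symE). Qed.

Let clamp_ae f : mm_plus mu eta E f -> {ae eta, forall z, f z = clamp f z}.
Proof.
move=> /mm_plus_range; apply: filterS => z [Ez /andP[f0 f1]].
by rewrite /clamp indicE mem_set// mul1r (min_idPr f1) (max_idPr f0).
Qed.

Let bmeas_clamp f : measurable_fun setT f -> bmeas (clamp f).
Proof.
move=> mf; split; first exact: measurable_clamp.
by exists 1 => z; have /andP[h0 h1] := clamp_range f z; rewrite ger0_norm.
Qed.

Let clamp_level f (U : set (J * J)) : mm_plus mu eta E f -> measurable U ->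
  \int[eta]_(z in U) clamp f z = \int[eta]_(z in E `&` U) f z.
Proof.
move=> mmf mU; have [mf _ jf _] := mmf.
have mEU : measurable (E `&` U) by exact: measurableI.
transitivity (\int[eta]_(z in E `&` U) clamp f z).
  rewrite -(Rint_indic eta U) -(Rint_indic eta (E `&` U)).
  apply: eq_Rintegral => z _; rewrite /clamp !indicE in_setI.
  by case: (z \in E); case: (z \in U); rewrite ?mul1r ?mul0r ?mulr0.
rewrite /Rintegral; congr fine; apply: ae_eq_integral => //.
- exact: measurable_int (intS mEU (bmeas_integrable etafin (bmeas_clamp mf))).
- exact: measurable_int (intS mEU jf).
by apply: filterS (clamp_ae mmf) => z <- _.
Qed.

Let clamp_level_le f (w : J * J -> R) (t : R) : mm_plus mu eta E f ->
  measurable_fun setT w -> sym_fun w ->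
  ((\int[eta]_(z in [set z | t < w z]) clamp f z)%:E <=
   rank mu [set z | E z /\ (t < w z)%R])%E.
Proof.
move=> mmf mw sw; have [mf sf jf fA] := mmf.
have mU : measurable [set z | t < w z].
  by apply: measurable_lt_set => //; exact: measurable_cst.
have mEU : measurable (E `&` [set z | t < w z]) by exact: measurableI.
rewrite clamp_level// -RintE//.
have [|_ ->//] := fA _ mEU (@subIsetl _ _ _).
by move=> x y [/symE ? /=]; rewrite sw.
Qed.

Lemma exposed_mm_plus f : exposed eta (mm_plus mu eta E) f ->
  exists F, [/\ measurable F, F `<=` E, sym_set F,
    hyperfinite eta F /\ forest eta F & is_restriction eta E F f].
Proof.
move=> [mmf [L [LL Lexp]]]; have [mf sf jf fA] := mmf.
have [C [w [C0 mw sw wC wE]]] := L1_weight etafin etaS LL.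
(* The total mass is free here, so edges of nonpositive weight cannot help the functional and are
   left out of the greedy forest. *)
pose H := [set z | E z /\ 0 < w z].
have mH : measurable H.
  by apply: measurable_Pand => //; apply: measurable_lt_set => //; exact: measurable_cst.
have HE : H `<=` E by move=> z [].
have sH : sym_set H by move=> x y [/symE Exy w0]; split => //; rewrite -sw.
have [F [[mF FH sF acF] [hypF leF rankF _]]] := greedy_forest sb gE eE mw sw mH HE sH.
have FE : F `<=` E by exact: subset_trans HE.
have mmF := indic_mm_plus mF sF leF.
have bc := bmeas_clamp mf; have bI := bmeas_indic R mF.
have bw : bmeas w by split => //; exists C.
have Lle : L f <= L (\1_F).
  rewrite (L1_ae_eq LL jf (bmeas_integrable etafin bc) (clamp_ae mmf)).
  rewrite (L1_weight_rep etafin LL C0 mw wC wE (measurable_clamp mf)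
    (sym_clamp sf) (@clamp_range f)).
  rewrite wE// -(Rint_indic eta F).
  pose v z := Num.max (w z) 0.
  have mv : measurable_fun setT v.
    by apply: measurable_maxr => //; exact: measurable_cst.
  have vC z : 0 <= v z <= C.
    rewrite /v le_max lexx orbT /= ge_max C0 andbT.
    by apply: le_trans (ler_norm _) _.
  have bv : bmeas v.
    by split => //; exists C => z; have /andP[h0 h1] := vC z; rewrite ger0_norm.
  apply: (@le_trans _ _ (\int[eta]_z (clamp f z * v z))).
    apply: (le_Rint etafin); [exact: bmeasM|exact: bmeasM|move=> z].
    have /andP[h0 _] := clamp_range f z.
    by rewrite ler_wpM2l// /v le_max lexx.
  apply: (@le_trans _ _ (\int[eta]_z (\1_F z * v z))); last first.
    rewrite le_eqVlt; apply/orP; left; apply/eqP; apply: eq_Rintegral => z _.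
    rewrite indicE; have [Fz|nFz] := pselect (F z); last by rewrite memNset// !mul0r.
    have [_ w0] := FH _ Fz.
    by rewrite mem_set// !mul1r /v (max_idPl (ltW w0)).
  apply: (layer_cake_le etafin mv (measurable_clamp mf) mF vC (@clamp_range f)).
  move=> t t0.
  (* Truncating the weight at 0 does not affect the levels [t >= 0], the only ones the layer-cake
     comparison uses. *)
  have -> : [set z | t < v z] = [set z | t < w z].
    by apply/seteqP; split => z /=; rewrite /v lt_max (ltNge t 0) t0 orbF.
  rewrite -lee_fin [leRHS]fineK; last first.
    apply: fin_eta; apply: measurableI => //.
    by apply: measurable_lt_set => //; exact: measurable_cst.
  apply: le_trans (clamp_level_le t mmf mw sw) _.
  have -> : [set z | E z /\ t < w z] = [set z | H z /\ t < w z].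
    apply/seteqP; split => z /=; last by move=> [[Ez _] tw].
    by move=> [Ez tw]; split => //; split => //; exact: le_lt_trans tw.
  exact: rankF.
have fF : {ae eta, forall z, \1_F z = f z}.
  apply: contrapT => nae; have := Lexp _ mmF nae.
  by rewrite ltNge Lle.
exists F; split => //; last exact: indic_restriction.
split => //; exists set0; split; [exact: measurable0|by []|exact: measure0|].
by rewrite setD0.
Qed.

Lemma exposed_bmm_plus f : exposed eta (bmm_plus mu eta E) f ->
  exists F, [/\ ess_spanning_forest mu eta E F, hyperfinite eta F &
    is_restriction eta E F f].
Proof.
move=> [[mmf fE] [L [LL Lexp]]]; have [mf sf jf fA] := mmf.
have [C [w [C0 mw sw wC wE]]] := L1_weight etafin etaS LL.
have [F [[mF FE sF acF] [hypF leF rankF compF]]] :=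
  greedy_forest sb gE eE mw sw mE (@subset_refl _ E) symE.
have mmF := indic_mm_plus mF sF leF.
have etaF : eta F = rank mu E.
  apply/eqP; rewrite eq_le; apply/andP; split.
    by have := leF E mE (@subset_refl _ E) symE; rewrite (setIidl FE).
  (* This level lies strictly below all values of [w], so the superlevel sets are the whole of [E]
     and of [F]. *)
  have := rankF (- C - 1).
  have lt z : - C - 1 < w z.
    by have := wC z; rewrite ler_norml => /andP[h _]; rewrite ltrBlDr (le_lt_trans h)// ltrDl.
  rewrite (_ : [set z | E z /\ _] = E); last first.
    by apply/seteqP; split => z /=; [case|split].
  rewrite (_ : [set z | F z /\ _] = F)//.
  by apply/seteqP; split => z /=; [case|split].
have bmmF : bmm_plus mu eta E (\1_F).
  by split => //; rewrite integral_indic// (setIidl FE).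
have bc := bmeas_clamp mf; have bI := bmeas_indic R mF.
have bw : bmeas w by split => //; exists C.
have bC := bmeas_cst (J * J)%type C.
have Lle : L f <= L (\1_F).
  rewrite (L1_ae_eq LL jf (bmeas_integrable etafin bc) (clamp_ae mmf)).
  rewrite (L1_weight_rep etafin LL C0 mw wC wE (measurable_clamp mf)
    (sym_clamp sf) (@clamp_range f)).
  rewrite wE// -(Rint_indic eta F).
  (* The shift makes the weight nonnegative. It adds [C] times the total mass to each side, and [f]
     and the indicator of [F] have the same mass [rank E]. *)
  pose v z := w z + C.
  have bv : bmeas v by exact: bmeasD.
  have mv : measurable_fun setT v by case: bv.
  have vC z : 0 <= v z <= C + C.
    have := wC z; rewrite ler_norml /v => /andP[h1 h2].
    by rewrite -lerBlDr sub0r h1 lerD2r.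
  have : \int[eta]_z (clamp f z * v z) <= \int[eta]_z (\1_F z * v z).
    apply: (layer_cake_le etafin mv (measurable_clamp mf) mF vC (@clamp_range f)).
    move=> t t0.
    have -> : [set z | t < v z] = [set z | t - C < w z].
      by apply/seteqP; split => z /=; rewrite /v ltrBlDr.
    rewrite -lee_fin [leRHS]fineK; last first.
      apply: fin_eta; apply: measurableI => //.
      by apply: measurable_lt_set => //; exact: measurable_cst.
    by apply: le_trans (clamp_level_le (t - C) mmf mw sw) _; exact: rankF.
  have expand g : bmeas g -> \int[eta]_z (g z * v z) =
      \int[eta]_z (g z * w z) + C * \int[eta]_z g z.
    move=> bg; rewrite -(RintZ etafin)// -(RintD etafin); [|exact: bmeasM..].
    by apply: eq_Rintegral => z _; rewrite /v; ring.
  rewrite !expand//.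
  rewrite Rint_indic1// etaF -fE.
  rewrite (clamp_level mmf measurableT) setIT.
  by rewrite RintE// lerD2r.
have fF : {ae eta, forall z, \1_F z = f z}.
  apply: contrapT => nae; have := Lexp _ bmmF nae.
  by rewrite ltNge Lle.
exists F; split => //; last exact: indic_restriction.
split => //.
  exists set0; split; [exact: measurable0|by []|exact: measure0|].
  by rewrite setD0.
(* A finite component of [F] fills its component in [E], so finiteness of either one passes to the
   other. *)
apply: filterS compF => x cx; split => [fx|nfx].
  by apply: cx; apply: sub_finite_set fx => y; exact: sub_comp.
by apply: contra_not nfx => fx; rewrite -cx.
Qed.

End exposed_points.

Theorem theorem1p2 (R : realType) (d : measure_display) (J : measurableType d)
    (mu : probability J R) (E : set (J * J))
    (eta : {measure set (J * J)%type -> \bar R}) :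
  standard_borel J R -> graphing mu E -> is_edge_measure mu E eta ->
  (forall f : J * J -> R, mm_plus mu eta E f ->
     (exposed eta (mm_plus mu eta E) f <->
      exists F : set (J * J),
        [/\ measurable F, F `<=` E, sym_set F,
            hyperfinite eta F /\ forest eta F &
            is_restriction eta E F f])) /\
  (forall f : J * J -> R, bmm_plus mu eta E f ->
     (exposed eta (bmm_plus mu eta E) f <->
      exists F : set (J * J),
        [/\ ess_spanning_forest mu eta E F, hyperfinite eta F &
            is_restriction eta E F f])).
Proof.
move=> sb gE eE; split => f Cf; split.
- exact: exposed_mm_plus.
- move=> [F [mF _ sF _ fF]].
  exact: (restriction_exposed sb gE eE _ Cf mF sF fF).
- exact: exposed_bmm_plus.
- move=> [F [[mF _ sF _ _] _ fF]].
  by apply: (restriction_exposed sb gE eE _ Cf mF sF fF) => g [].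
Qed.
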